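(* For any holomorphic map $f : X \to Y$ between irreducible complex spaces such that $f(X)$ is not contained in the singular set $S(Y)$ of $Y$, there exists a unique pull-back morphism $$\hat f^{*} : f^{*}(\beta_Y^{\bullet}) \to \beta_X^{\bullet}$$ which is compatible with the pull-back $\hat f^*: f^*(\alpha_Y^\bullet)\to\alpha_X^\bullet$ of the $\alpha^\bullet$-sheaves, graded of degree $0$, and compatible with the exterior product and with the de Rham differential (i.e. $\hat f^*(u\wedge v)=\hat f^*(u)\wedge \hat f^*(v)$ and $\hat f^*(du)=d\hat f^*(u)$ for local sections $u,v$ of $\beta_Y^\bullet$). For any holomorphic maps $f : X \to Y$ and $g : Y \to Z$ between irreducible complex spaces such that $f(X)\not\subset S(Y)$ and $g(f(X))\not\subset S(Z)$ we have $$\widehat{g\circ f}^{*}(\sigma) = \hat f^{*}(\hat g^{*}(\sigma)) \qquad \text{for all local sections } \sigma \text{ of } \beta_Z^{\bullet}.$$ Moreover, for each integer $p\ge 0$ the pull-back $\hat f^{*}$ induces a pull-back $$\hat f^{*}[p] : f^{*}(\alpha_Y^{\bullet}[p]) \to \alpha_X^{\bullet}[p],$$ and, for $f,g$ as in the previous paragraph, $\widehat{g\circ f}^{*}[p] = \hat f^{*}[p]\circ \hat g^{*}[p]$ for each $p\ge 0$.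
   Context: Complex spaces are reduced; $S(X)$ is the singular set of $X$. For $X$ of pure dimension, $\Omega_X^{\bullet}$ is the graded sheaf of holomorphic (Kähler) differential forms. $L_X^q$ is the sheaf of meromorphic $q$-forms on $X$ which become holomorphic on any desingularization of $X$, i.e. $L_X^q=\tau_*\Omega^q_{\tilde X}$ for any desingularization $\tau:\tilde X\to X$; it is coherent, torsion free, and $L_X^\bullet$ is stable by exterior product and by the de Rham differential $d$. $\alpha_X^q\subset L_X^q$ is the coherent subsheaf of sections $\sigma$ which locally on $X$ can be written, on the complement of $S(X)$, as a finite sum $\sigma=\sum_j\rho_j\,\omega_j$ with $\omega_j$ holomorphic $q$-forms (sections of $\Omega_X^q$) and $\rho_j$ functions that are $\mathscr C^\infty$ on the complement of $S(X)$ and bounded near $S(X)$. (Equivalently, $\sigma$ is locally a root of a monic polynomial $z^k+\sum_{h=1}^kS_hz^{k-h}$ with $S_h$ a section of the degree $h$ symmetric power of $\Omega_X^q/\text{torsion}$.) Put $\alpha_X^\bullet[0]:=\alpha_X^\bullet$ and for $p,q\ge0$ $$\alpha_X^q[p+1]:=\sum_{r=0}^{q}\alpha_X^r[p]\wedge\alpha_X^{q-r}[p]+\sum_{r=0}^{q-1}\alpha_X^r[p]\wedge d\big(\alpha_X^{q-r-1}[p]\big)\subset L_X^q .$$ This is an increasing sequence in $p$ of coherent subsheaves of $L_X^\bullet$, and $\beta_X^{\bullet}:=\bigcup_{p\ge0}\alpha_X^\bullet[p]$. For $f:X\to Y$ holomorphic between irreducible complex spaces with $f(X)\not\subset S(Y)$,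 the pull-back $\hat f^*:f^*(\alpha_Y^\bullet)\to\alpha_X^\bullet$ is the morphism which extends the usual pull-back $f^*(\Omega_Y^\bullet/\text{torsion})\to\Omega_X^\bullet/\text{torsion}$ of holomorphic forms. *)

(* Defs.v *)
From HB Require Import structures.
From mathcomp Require Import all_boot all_order all_fingroup all_algebra.
From mathcomp Require Import complex.
From mathcomp Require Import all_classical all_reals topology normedtype derive.

Set Implicit Arguments.
Unset Strict Implicit.
Unset Printing Implicit Defensive.

Import Order.TTheory GRing.Theory Num.Theory.
Import numFieldNormedType.Exports.
Local Open Scope classical_set_scope.
Local Open Scope ring_scope.
Local Open Scope complex_scope.

(** [R[i]] seen as a [numClosedFieldType], so that the topology of its norm is
    found by unification. *)
Definition C (R : realType) : numClosedFieldType := R[i].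

(** * Reduced complex spaces *)

(** A reduced complex space is a Hausdorff space with a sheaf of complex-valued
    functions that is locally isomorphic to a model [(A, O_D / I)], where
    [A = {F_1 = ... = F_k = 0}] in an open set [D] of [C^n] and
    [I = (F_1, ..., F_k)].  Reducedness is the last clause of [is_model]: at
    every point of [A], [I] contains all the germs vanishing on [A], so that
    [O_D / I] is a sheaf of functions on [A].

    The sheaf is given by its stalks: [hol x g] says that [g] is holomorphic in
    some neighbourhood of [x].  The sheaf axioms follow from the charts. *)

Definition is_model (R : realType) (n : nat) (A : set 'rV[C R]_n) : Prop :=
  exists (D : set 'rV[C R]_n) (k : nat) (F : 'I_k -> 'rV[C R]_n -> C R),
  [/\ open D,
      (forall j z, D z -> differentiable (F j) z),
      A = [set z | D z /\ forall j, F j z = 0] &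
      forall a (h : 'rV[C R]_n -> C R), A a ->
        (\forall z \near a, differentiable h z) ->
        (\forall z \near a, A z -> h z = 0) ->
        exists c : 'I_k -> 'rV[C R]_n -> C R,
          (forall j, \forall z \near a, differentiable (c j) z) /\
          \forall z \near a, h z = \sum_j c j z * F j z].

Record is_chart (R : realType) (T : topologicalType)
    (hol : T -> (T -> C R) -> Prop) (n : nat) (N : set T)
    (A : set 'rV[C R]_n) (phi : T -> 'rV[C R]_n) (psi : 'rV[C R]_n -> T)
    : Prop := IsChart {
  chart_open : open N;
  chart_to : forall x, N x -> A (phi x);
  chart_of : forall z, A z -> N (psi z);
  chart_toK : forall x, N x -> psi (phi x) = x;
  chart_ofK : forall z, A z -> phi (psi z) = z;
  chart_to_cont : forall x, N x -> {for x, continuous phi};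
  chart_of_cont : {within A, continuous psi};
  chart_hol : forall x g, N x ->
    (hol x g <-> exists h : 'rV[C R]_n -> C R,
       (\forall z \near phi x, differentiable h z) /\
       \forall y \near x, g y = h (phi y)) }.

Record complexSpace (R : realType) := ComplexSpace {
  carrier :> topologicalType;
  hol : carrier -> (carrier -> C R) -> Prop;
  complexSpace_hausdorff : hausdorff_space carrier;
  complexSpace_charts : forall x : carrier,
    exists (n : nat) (N : set carrier) (A : set 'rV[C R]_n) phi psi,
      [/\ is_model A, is_chart hol N A phi psi & N x] }.

Definition hol_on (R : realType) (X : complexSpace R) (U : set X)
    (g : X -> C R) : Prop := forall x, U x -> hol x g.

Definition hol_map_on (R : realType) (X Y : complexSpace R) (U : set X)
    (f : X -> Y) : Prop :=
  forall x, U x -> {for x, continuous f} /\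
    forall g : Y -> C R, hol (f x) g -> hol x (g \o f).

Definition holomorphic (R : realType) (X Y : complexSpace R) (f : X -> Y) :
  Prop := hol_map_on setT f.

Definition reg (R : realType) (X : complexSpace R) : set X :=
  [set x | exists (n : nat) (N : set X) (D : set 'rV[C R]_n) phi psi,
     [/\ open D, is_chart (@hol R X) N D phi psi & N x]].
Arguments reg {R} X _.

Definition sing (R : realType) (X : complexSpace R) : set X := ~` reg X.
Arguments sing {R} X _.

(** Irreducibility in terms of the regular part; such an [X] has pure
    dimension. *)
Definition irreducible (R : realType) (X : complexSpace R) : Prop :=
  reg X !=set0 /\ connected (reg X).

(** * Differential forms *)

(** Tangent vectors at [x] are the derivations of the stalk of holomorphic
    functions at [x].  They are represented by functionals on all functions, of
    which only the values on functions holomorphic near [x] matter. *)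

Definition vec (R : realType) (X : complexSpace R) := (X -> C R) -> C R.

Definition is_deriv (R : realType) (X : complexSpace R) (x : X) (v : vec X) :
    Prop :=
  forall g h : X -> C R, hol x g -> hol x h ->
    [/\ (\forall y \near x, g y = h y) -> v g = v h,
        forall c : C R, v (fun y => c * g y + h y) = c * v g + v h &
        v (fun y => g y * h y) = g x * v h + h x * v g].

(** All the sheaves of forms considered here are torsion free, so a section on
    [U] is known by its restriction to the regular part of [U].  A [q]-form is
    represented by a total function, of which only the values at regular points
    and on tuples of derivations matter; [eq_form U] is equality of sections
    on [U]. *)

Definition qform (R : realType) (X : complexSpace R) (q : nat) :=
  X -> ('I_q -> vec X) -> C R.

Definition eq_form (R : realType) (X : complexSpace R) (q : nat) (U : set X)
    (a b : qform X q) : Prop :=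
  forall x, U x -> reg X x ->
  forall v : 'I_q -> vec X, (forall i, is_deriv x (v i)) -> a x v = b x v.

Definition form0 (R : realType) (X : complexSpace R) (q : nat) : qform X q :=
  fun _ _ => 0.

Definition form_add (R : realType) (X : complexSpace R) (q : nat)
  (a b : qform X q) : qform X q := fun x v => a x v + b x v.

Definition form_scale (R : realType) (X : complexSpace R) (q : nat)
  (g : X -> C R) (a : qform X q) : qform X q := fun x v => g x * a x v.

Definition wedge (R : realType) (X : complexSpace R) (r s : nat)
    (a : qform X r) (b : qform X s) : qform X (r + s) :=
  fun x v => (r`!%:R * s`!%:R)^-1 *
    \sum_(w : 'S_(r + s)) (-1) ^+ w *
      (a x (fun i => v (w (lshift s i))) * b x (fun i => v (w (rshift r i)))).

Definition pull (R : realType) (X Y : complexSpace R) (f : X -> Y) (q : nat)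
    (a : qform Y q) : qform X q :=
  fun x v => a (f x) (fun i g => v i (g \o f)).

(** A term [(g, h)] stands for [g dh_1 /\ ... /\ dh_q], and a list of terms for
    their sum. *)

Definition term (R : realType) (X : complexSpace R) (q : nat) :=
  ((X -> C R) * ('I_q -> X -> C R))%type.

Fixpoint hol_terms (R : realType) (X : complexSpace R) (q : nat) (U : set X)
    (l : seq (term X q)) : Prop :=
  if l is t :: l' then
    [/\ hol_on U t.1, (forall i, hol_on U (t.2 i)) & hol_terms U l']
  else True.

Definition kahler (R : realType) (X : complexSpace R) (q : nat)
    (l : seq (term X q)) : qform X q :=
  fun x v => \sum_(t <- l) t.1 x * \det (\matrix_(i < q, j < q) v i (t.2 j)).

Definition dterm (R : realType) (X : complexSpace R) (q : nat)
    (t : term X q) : term X q.+1 :=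
  (cst 1, fun i => if unlift ord0 i is Some j then t.2 j else t.1).

Definition comp_term (R : realType) (X Y : complexSpace R) (f : X -> Y)
    (q : nat) (t : term Y q) : term X q :=
  (t.1 \o f, fun i => t.2 i \o f).

(** Sections on [U] of the sheaf of Kähler forms modulo torsion; on a manifold,
    holomorphic forms. *)
Definition Omega (R : realType) (X : complexSpace R) (q : nat) (U : set X)
    (a : qform X q) : Prop :=
  forall x, U x -> exists (N : set X) (l : seq (term X q)),
    [/\ open N, N x, N `<=` U, hol_terms N l & eq_form N a (kahler l)].

(** de Rham differential of a form that is holomorphic on the regular part of
    its domain: [d (\sum g dh_1 /\ ... /\ dh_q) = \sum dg /\ dh_1 /\ ... /\
    dh_q] for any local expression of the form; the result does not depend on
    this expression. *)
Definition dform (R : realType) (X : complexSpace R) (q : nat) (a : qform X q) :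
    qform X q.+1 :=
  fun x v => xget 0 [set c | exists (N : set X) (l : seq (term X q)),
    [/\ open N, N x, hol_terms N l, eq_form N a (kahler l) &
        c = kahler [seq dterm t | t <- l] x v]].

(** * The sheaves L, alpha, alpha[p] and beta *)

(** Proper modifications of [X] by a manifold, with centre in [sing X]. *)
Definition desingularization (R : realType) (X' X : complexSpace R)
    (tau : X' -> X) : Prop :=
  [/\ reg X' = setT,
      holomorphic tau,
      (forall K : set X, compact K -> compact (tau @^-1` K)),
      dense (tau @^-1` reg X) &
      exists theta : X -> X',
        [/\ hol_map_on (reg X) theta,
            forall x, reg X x -> tau (theta x) = x &
            forall x', reg X (tau x') -> theta (tau x') = x']].

(** The direct image of the sheaf of holomorphic forms of [X'].  Such forms are
    holomorphic on [reg X] since [tau] is an isomorphism there. *)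
Definition L_sheaf (R : realType) (X : complexSpace R) (q : nat) (U : set X)
    (a : qform X q) : Prop :=
  Omega (U `&` reg X) a /\
  forall (X' : complexSpace R) (tau : X' -> X), desingularization tau ->
    exists b : qform X' q, Omega (tau @^-1` U) b /\
      eq_form (tau @^-1` (U `&` reg X)) b (pull tau a).

Fixpoint Ck (R : realType) (m k : nat) (W : set 'rV[R]_m) (g : 'rV[R]_m -> R) :
    Prop :=
  (forall u, W u -> {for u, continuous g}) /\
  if k is k'.+1 then
    forall j : 'I_m, (forall u, W u -> derivable g u (delta_mx 0 j)) /\
      Ck k' W ('D_(delta_mx 0 j) g)
  else True.

Definition cplx (R : realType) (n : nat) (u : 'rV[R]_(n + n)) : 'rV[C R]_n :=
  \row_(j < n) (u 0 (lshift n j) +i* u 0 (rshift n j)).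

(** Smooth complex-valued functions on an open set [U] of regular points: in
    holomorphic coordinates, the real and imaginary parts are of class C^k for
    all k with respect to the underlying real coordinates. *)
Definition smooth_on (R : realType) (X : complexSpace R) (U : set X)
    (rho : X -> C R) : Prop :=
  forall x, U x ->
  exists (n : nat) (N : set X) (D : set 'rV[C R]_n) phi psi,
    [/\ open D, is_chart (@hol R X) N D phi psi, N x, N `<=` U &
        forall k,
          Ck k (@cplx R n @^-1` D) (fun u => complex.Re (rho (psi (cplx u)))) /\
          Ck k (@cplx R n @^-1` D) (fun u => complex.Im (rho (psi (cplx u))))].

Definition bounded_near_sing (R : realType) (X : complexSpace R) (U : set X)
    (rho : X -> C R) : Prop :=
  forall x, U x -> sing X x ->
  exists M : C R, \forall y \near x, reg X y -> `|rho y| <= M.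

Definition alpha0 (R : realType) (X : complexSpace R) (q : nat) (U : set X)
    (a : qform X q) : Prop :=
  L_sheaf U a /\
  forall x, U x -> exists (N : set X) (k : nat)
      (rho : 'I_k -> X -> C R) (omega : 'I_k -> qform X q),
    [/\ open N, N x, N `<=` U,
        (forall j, [/\ smooth_on (N `&` reg X) (rho j),
                       bounded_near_sing N (rho j) & Omega N (omega j)]) &
        eq_form N a (fun y v => \sum_j rho j y * omega j y v)].

(** Sections on [W] that are finite sums of terms [a /\ b] and [a /\ db], with
    [a] and [b] sections of [F] on [W]. *)
Inductive step_sum (R : realType) (X : complexSpace R)
    (F : forall q, set X -> qform X q -> Prop) (W : set X) :
    forall q, qform X q -> Prop :=
| step_zero q : step_sum F W (@form0 R X q)
| step_add q (a b : qform X q) :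
    step_sum F W a -> step_sum F W b -> step_sum F W (form_add a b)
| step_wedge r s (a : qform X r) (b : qform X s) :
    F r W a -> F s W b -> step_sum F W (wedge a b)
| step_wedge_d r s (a : qform X r) (b : qform X s) :
    F r W a -> F s W b -> step_sum F W (wedge a (dform b)).

Fixpoint alpha (R : realType) (X : complexSpace R) (p q : nat) (U : set X)
    (a : qform X q) : Prop :=
  if p is p'.+1 then
    forall x, U x -> exists (N : set X) (b : qform X q),
      [/\ open N, N x, N `<=` U, step_sum (@alpha R X p') N b & eq_form N a b]
  else alpha0 U a.

Definition beta (R : realType) (X : complexSpace R) (q : nat) (U : set X)
    (a : qform X q) : Prop :=
  forall x, U x -> exists (N : set X) (p : nat),
    [/\ open N, N x, N `<=` U & alpha p N a].

(** * Pull-back morphisms *)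

(** A degree 0 morphism of graded [O_X]-modules from [f^* FY] to [FX], given
    through the adjunction between [f^*] and [f_*] as an [O_Y]-linear morphism
    from [FY] to [f_* FX]. *)

(** Only the values on open sets and on sections over them matter. *)
Definition section_map (R : realType) (X Y : complexSpace R) :=
  forall q, set Y -> qform Y q -> qform X q.

Record is_morphism (R : realType) (X Y : complexSpace R) (f : X -> Y)
    (FY : forall q, set Y -> qform Y q -> Prop)
    (FX : forall q, set X -> qform X q -> Prop) (Psi : section_map X Y) :
    Prop := IsMorphism {
  mor_section : forall q V (a : qform Y q), open V ->
    FY q V a -> FX q (f @^-1` V) (Psi q V a);
  mor_restr : forall q V V' (a a' : qform Y q), open V -> open V' -> V' `<=` V ->
    FY q V a -> FY q V' a' -> eq_form V' a a' ->
    eq_form (f @^-1` V') (Psi q V a) (Psi q V' a');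
  mor_add : forall q V (a b : qform Y q), open V -> FY q V a -> FY q V b ->
    eq_form (f @^-1` V) (Psi q V (form_add a b))
                        (form_add (Psi q V a) (Psi q V b));
  mor_scale : forall q V (g : Y -> C R) (a : qform Y q), open V ->
    hol_on V g -> FY q V a ->
    eq_form (f @^-1` V) (Psi q V (form_scale g a))
                        (form_scale (g \o f) (Psi q V a)) }.

Definition agree_on (R : realType) (X Y : complexSpace R) (f : X -> Y)
    (FY : forall q, set Y -> qform Y q -> Prop) (Psi Psi' : section_map X Y) :
    Prop :=
  forall q V (a : qform Y q), open V -> FY q V a ->
    eq_form (f @^-1` V) (Psi q V a) (Psi' q V a).

(** [Phi] is the pull-back of the alpha sheaves: it extends the pull-back
    [\sum g dh_1 /\ ... /\ dh_q |-> \sum (g o f) d(h_1 o f) /\ ... /\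
    d(h_q o f)] of holomorphic forms. *)
Definition alpha_pullback (R : realType) (X Y : complexSpace R) (f : X -> Y)
    (Phi : section_map X Y) : Prop :=
  is_morphism f (@alpha R Y 0) (@alpha R X 0) Phi /\
  forall q V (l : seq (term Y q)), open V -> hol_terms V l ->
    eq_form (f @^-1` V) (Phi q V (kahler l))
                        (kahler [seq comp_term f t | t <- l]).

Record beta_pullback (R : realType) (X Y : complexSpace R) (f : X -> Y)
    (Phi Psi : section_map X Y) : Prop := BetaPullback {
  beta_mor : is_morphism f (@beta R Y) (@beta R X) Psi;
  beta_alpha : agree_on f (@alpha R Y 0) Psi Phi;
  beta_wedge : forall r s V (u : qform Y r) (v : qform Y s), open V ->
    beta V u -> beta V v ->
    eq_form (f @^-1` V) (Psi (r + s)%N V (wedge u v))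
                        (wedge (Psi r V u) (Psi s V v));
  beta_d : forall q V (u : qform Y q), open V -> beta V u ->
    eq_form (f @^-1` V) (Psi q.+1 V (dform u)) (dform (Psi q V u)) }.

Definition induced (R : realType) (X Y : complexSpace R) (f : X -> Y)
    (p : nat) (Psi Psip : section_map X Y) : Prop :=
  is_morphism f (@alpha R Y p) (@alpha R X p) Psip /\
  agree_on f (@alpha R Y p) Psip Psi.

(* Main.v *)
(** A section of [beta] on [Y] is a holomorphic form on [reg Y], so its pull-back is
    imposed at the regular points [x] of [X] with [f x] regular.  These points are
    dense in [X].  Indeed, [reg X] being a connected manifold has a dimension [d],
    and by the constant rank theorem [sing X] is locally the zero set of the minors
    of size [n - d] of the Jacobian of the equations of [X]; the same holds for [Y].
    If equations of [sing Y] composed with [f] vanished on an open subset of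
    [reg X], they would vanish everywhere by the identity theorem.

    As a form that is holomorphic on [reg X] is determined by its values on a dense
    set, a section on [X] extending the pull-back of [a] is unique, and this gives
    uniqueness and functoriality.  Extensions are compatible with sums, exterior
    products and [d], so they pass from [alpha] to each [alpha[p]] by induction on
    [p], and then to [beta].

    A holomorphic function is only assumed to be complex differentiable, hence the
    way through Goursat's lemma and Cauchy's formula.  That [d] does not depend on
    the expression of a form is the formula for [d] on constant vector fields in a
    chart, where a derivation of the stalk is a tangent vector by Hadamard's lemma. *)

Require Import Defs.

From HB Require Import structures.
From mathcomp Require Import all_boot all_order all_fingroup all_algebra.
From mathcomp Require Import complex ring lra.
From mathcomp Require Import all_classical all_reals topology normedtype landau derive.
From mathcomp Require Import sequences exp trigo measure lebesgue_measure.
From mathcomp Require Import lebesgue_integral ftc.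

Set Implicit Arguments.
Unset Strict Implicit.
Unset Printing Implicit Defensive.

Import Order.TTheory GRing.Theory Num.Theory.
Import numFieldNormedType.Exports.
Local Open Scope classical_set_scope.
Local Open Scope ring_scope.
Local Open Scope complex_scope.

(** * Norms and derivatives *)

Section RealNorm.
Variable R : realType.
Local Notation K := (C R).

(** A morphism is given only by its axioms, and the bounded coefficients in a section of [alpha0]
    have no pull-back where [f] takes singular values. Both difficulties are avoided by the single
    relation [extends]. It mentions neither [p] nor the coefficients, and the choice [Ext] made from
    it depends neither on [p] nor on the open set, so that one function serves for [beta] and for
    every [alpha p]. That a pull-back lands in [alpha0] is taken from the given morphism, which its
    values on Kähler forms force to be an extension.

    The delicate point is the constant rank theorem: the rank of the Jacobian is controlled at the
    points of the zero set only, and not in a neighbourhood in the ambient space, so that the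
    classical statement does not apply. Reducedness has to make up for this, by way of a
    differential inequality.

    Norms over [C R] have values in [C R], whose order is not total. All estimates are therefore
    made with the real number [rn v]. *)

Definition rn (V : normedModType K) (v : V) : R := complex.Re (`|v| : R[i]).

Lemma normE (V : normedModType K) (v : V) : `|v| = (rn v)%:C :> K.
Proof. by rewrite /rn (RRe_real (normr_real v)). Qed.

Lemma rn_ge0 (V : normedModType K) (v : V) : 0 <= rn v.
Proof. by rewrite -lecR -normE; exact: normr_ge0. Qed.

Lemma rn0 (V : normedModType K) : rn (0 : V) = 0.
Proof. by apply: complexI; rewrite -normE normr0. Qed.

Lemma rn_eq0 (V : normedModType K) (v : V) : rn v = 0 -> v = 0.
Proof. by move=> h; apply/eqP; rewrite -normr_eq0 normE h. Qed.

Lemma rn_le0 (V : normedModType K) (v : V) : rn v <= 0 -> v = 0.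
Proof. by move=> h; apply: rn_eq0; apply/eqP; rewrite eq_le h rn_ge0. Qed.

Lemma rnN (V : normedModType K) (v : V) : rn (- v) = rn v.
Proof. by rewrite /rn normrN. Qed.

Lemma rnD (V : normedModType K) (u v : V) : rn (u + v) <= rn u + rn v.
Proof. by rewrite -lecR rmorphD /= -!normE; exact: ler_normD. Qed.

Lemma rnB (V : normedModType K) (u v : V) : rn (u - v) <= rn u + rn v.
Proof. by rewrite -(rnN v); exact: rnD. Qed.

Lemma rnC (V : normedModType K) (u v : V) : rn (u - v) = rn (v - u).
Proof. by rewrite -rnN opprB. Qed.

Lemma rn_tri (V : normedModType K) (w u v : V) : rn (u - v) <= rn (u - w) + rn (w - v).
Proof. by rewrite -[u - v](subrKA w); exact: rnD. Qed.

Lemma rnZ (V : normedModType K) (k : K) (v : V) : rn (k *: v) = rn k * rn v.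
Proof. by apply: complexI; rewrite rmorphM /= -!normE; exact: normrZ. Qed.

Lemma rnM (k l : K) : rn (k * l) = rn k * rn l.
Proof. by apply: complexI; rewrite rmorphM /= -!normE; exact: normrM. Qed.

Lemma rn1 : rn (1 : K) = 1.
Proof. by apply: complexI; rewrite -normE; exact: normr1. Qed.

Lemma rnV (k : K) : rn k^-1 = (rn k)^-1.
Proof. by apply: complexI; rewrite fmorphV /= -!normE; exact: normfV. Qed.

Lemma rnX (k : K) n : rn (k ^+ n) = rn k ^+ n.
Proof. by elim: n => [|n IH]; rewrite ?expr0 ?rn1// !exprS rnM IH. Qed.

Lemma rnR (r : R) : rn (r%:C : K) = `|r|.
Proof. by rewrite /rn normc_def /= expr0n /= addr0 sqrtr_sqr. Qed.

Lemma rnRge (r : R) : 0 <= r -> rn (r%:C : K) = r.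
Proof. by move=> h; rewrite rnR ger0_norm. Qed.

Lemma rn_sqr (z : K) : rn z ^+ 2 = complex.Re z ^+ 2 + complex.Im z ^+ 2.
Proof.
rewrite /rn normc_def /= sqr_sqrtr //.
by rewrite addr_ge0 // sqr_ge0.
Qed.

Lemma Re_le_rn (z : K) : `|complex.Re z| <= rn z.
Proof.
rewrite -(@ler_pXn2r _ 2%N) ?nnegrE ?rn_ge0 //.
by rewrite rn_sqr real_normK ?num_real // lerDl sqr_ge0.
Qed.

Lemma Im_le_rn (z : K) : `|complex.Im z| <= rn z.
Proof.
rewrite -(@ler_pXn2r _ 2%N) ?nnegrE ?rn_ge0 //.
by rewrite rn_sqr real_normK ?num_real // lerDr sqr_ge0.
Qed.

Lemma rn_le_ReIm (z : K) : rn z <= `|complex.Re z| + `|complex.Im z|.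
Proof.
rewrite -(@ler_pXn2r _ 2%N) ?nnegrE ?rn_ge0 ?addr_ge0 //.
rewrite rn_sqr sqrrD !real_normK ?num_real //.
have : 0 <= `|complex.Re z| * `|complex.Im z| by rewrite mulr_ge0.
by rewrite mulr2n; lra.
Qed.

Lemma rn_sum (V : normedModType K) (I : Type) (r : seq I) (P : pred I) (F : I -> V) :
  rn (\sum_(i <- r | P i) F i) <= \sum_(i <- r | P i) rn (F i).
Proof.
elim/big_ind2 : _ => [|x y u v h k|//]; first by rewrite rn0.
by apply: le_trans (rnD _ _) _; exact: lerD.
Qed.

Lemma Cpos_real (e : K) : 0 < e -> exists2 r : R, 0 < r & e = r%:C.
Proof.
move=> e0; exists (complex.Re e).
  by move: e0; rewrite ltcE => /andP[].
by rewrite RRe_real //; exact: gtr0_real.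
Qed.

Lemma near_rnP (V : normedModType K) (a : V) (P : V -> Prop) :
  (\forall z \near a, P z) <->
  exists2 e : R, 0 < e & forall z, rn (z - a) < e -> P z.
Proof.
split.
  move=> /nbhs_normP[e /= e0 h]; have [r r0 er] := Cpos_real e0.
  exists r => // z hz; apply: h => /=.
  by rewrite distrC normE er ltcR.
move=> [e e0 h]; apply/nbhs_normP; exists (e%:C : K) => /=; first by rewrite ltcR.
by move=> z /=; rewrite distrC normE ltcR; exact: h.
Qed.

Lemma near_ball (V : normedModType K) (a : V) (e : R) : 0 < e ->
  \forall z \near a, rn (z - a) < e.
Proof. by move=> e0; apply/near_rnP; exists e. Qed.

Lemma near_self (V : normedModType K) (a : V) (P : V -> Prop) :
  (\forall z \near a, P z) -> P a.
Proof. by move=> /near_rnP[e e0]; apply; rewrite subrr rn0. Qed.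

Lemma open_rnP (V : normedModType K) (U : set V) : open U <->
  forall a, U a -> exists2 e : R, 0 < e & forall z, rn (z - a) < e -> U z.
Proof.
rewrite openE; split=> h a /h k; first exact: (proj1 (near_rnP a (fun z => U z))).
exact: (proj2 (near_rnP a (fun z => U z))).
Qed.

Lemma contE (V W : normedModType K) (f : V -> W) (a : V) :
  {for a, continuous f} <->
  forall e : R, 0 < e -> exists2 d : R, 0 < d &
    forall z, rn (z - a) < d -> rn (f z - f a) < e.
Proof.
split.
  move=> h e e0.
  have k : \forall z \near a, rn (f z - f a) < e := h _ (near_ball (f a) e0).
  exact: (proj1 (near_rnP _ _) k).
move=> h U /near_rnP[e e0 he]; have [d d0 hd] := h e e0.
by apply: (proj2 (near_rnP a (fun z => U (f z)))); exists d => // z /hd /he.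
Qed.

(** As a relation with an explicit function [L], so that differentials are computed without packing
    linear maps. Boundedness is a separate clause because [V] is an arbitrary normed module. *)
Definition isd (V W : normedModType K) (f : V -> W) (x : V) (L : V -> W) :=
  [/\ linear L, (exists M : R, forall u, rn (L u) <= M * rn u) &
    forall e : R, 0 < e -> exists2 d : R, 0 < d &
      forall u, rn u < d -> rn (f (x + u) - f x - L u) <= e * rn u].

Lemma isdP (V W : normedModType K) (f : V -> W) x L :
  isd f x L <-> differentiable f x /\ 'd f x = L :> (V -> W).
Proof.
split.
  move=> [linL [M bM] h].
  pose lM := GRing.isLinear.Build _ _ _ _ L linL.
  pose LL : {linear V -> W} := HB.pack L lM.
  have LE : L = LL by [].
  have cL : continuous LL.
    apply: (proj1 (linear_bounded_continuous LL)).
    apply: (proj2 (linear_boundedP LL)).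
    exists (`|M|%:C : K); split; first by apply/complex_realP; exists `|M|.
    move=> k hk u; rewrite normE; apply: le_trans (_ : (`|M| * rn u)%:C <= _).
      rewrite lecR; apply: le_trans (bM u) _.
      by rewrite ler_wpM2r ?rn_ge0 // ler_norm.
    by rewrite rmorphM /= -normE ler_wpM2r // ltW.
  have dE : f \o shift x = cst (f x) + LL +o_ 0 id.
    apply/eqaddoP => e e0; have [r r0 er] := Cpos_real e0.
    have [d d0 hd] := h r r0.
    apply/(near_rnP (0:V)); exists d => // u; rewrite subr0 => /hd.
    rewrite er /= => k; rewrite !normE -rmorphM /= lecR.
    by move: k; rewrite opprD addrA [x + u]addrC.
  have dd : 'd f x = LL :> (V -> W) by apply: diff_unique.
  split=> //; apply/diff_locallyP; split; first by rewrite dd.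
  by rewrite dd.
move=> [df <-]; split; first exact: linearP.
  have /linear_lipschitz[k k0 hk] := diff_continuous df.
  have [M M0 kM] := Cpos_real k0.
  by exists M => u; rewrite -lecR rmorphM /= -!normE -kM.
move=> e e0; have [_ /eqaddoP h0] := proj1 (diff_locallyP _ _) df.
have e0' : 0 < (e%:C : K) by rewrite ltcR.
have [d d0 hd] := proj1 (near_rnP _ _) (h0 _ e0').
exists d => // u ud; have := hd u; rewrite subr0 => /(_ ud).
rewrite /= !normE -rmorphM /= lecR.
by rewrite opprD addrA [x + u]addrC.
Qed.

Lemma isd_diff (V W : normedModType K) (f : V -> W) x L : isd f x L -> differentiable f x.
Proof. by move=> /isdP[]. Qed.

Lemma isd_val (V W : normedModType K) (f : V -> W) x L : isd f x L ->
  'd f x = L :> (V -> W).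
Proof. by move=> /isdP[]. Qed.

Lemma diff_isd (V W : normedModType K) (f : V -> W) x :
  differentiable f x -> isd f x ('d f x).
Proof. by move=> h; apply/isdP. Qed.

Lemma isd_near (V W : normedModType K) (f g : V -> W) x L :
  (\forall z \near x, f z = g z) -> isd f x L -> isd g x L.
Proof.
move=> /near_rnP[r r0 h] [l b a]; split=> // e e0; have [d d0 hd] := a e e0.
exists (Num.min d r); first by rewrite lt_min d0.
move=> u; rewrite lt_min => /andP[ud ur]; rewrite -!h ?hd //.
  by rewrite subrr rn0.
by rewrite addrC addKr.
Qed.

Lemma near_diff (V W : normedModType K) (f g : V -> W) x :
  (\forall z \near x, f z = g z) -> differentiable f x ->
  differentiable g x.
Proof. by move=> h /diff_isd k; exact: isd_diff (isd_near h k). Qed.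

Lemma near_diffE (V W : normedModType K) (f g : V -> W) x :
  (\forall z \near x, f z = g z) -> differentiable f x ->
  'd g x = 'd f x :> (V -> W).
Proof. by move=> h /diff_isd k; exact: isd_val (isd_near h k). Qed.

End RealNorm.

(** * Complex integration and Goursat's lemma *)

Section RealCurves.
Variable R : realType.
Local Notation K := (C R).
Implicit Types (f : R -> R) (p q : R -> K).

Lemma der_epsP f (t l : R) : is_derive t 1 f l <->
  forall e : R, 0 < e -> exists2 d : R, 0 < d &
    forall s, `|s| < d -> `|f (t + s) - f t - s * l| <= e * `|s|.
Proof.
split.
  move=> h; have dl : 'D_1 f t = l := @derive_val _ _ _ _ _ _ _ h.
  have /derivable_nbhs/eqaddoP he := @ex_derive _ _ _ _ _ _ _ h.
  move=> e e0; have := he e e0 => /nbhs_normP[d /= d0 hd].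
  exists d => // s sd; have /hd : `|0 - s| < d by rewrite sub0r normrN.
  rewrite /= dl.
  change (`|f (s * 1 + t) - (f t + s * l)| <= e * `|s| -> `|f (t + s) - f t - s * l| <= e * `|s|).
  by rewrite mulr1 opprD addrA [s + t]addrC.
move=> h.
have c : (fun h0 => h0^-1 *: ((f \o shift t) (h0 *: 1) - f t)) @ 0^' --> l.
  apply/cvgrPdist_le => /= e e0; have [d d0 hd] := h e e0.
  rewrite near_withinE; apply/nbhs_normP; exists d => //= s /=.
  rewrite sub0r normrN => sd s0; have := hd s sd.
  rewrite [`|l - _|]distrC.
  have -> : s^-1 *: (f (s%:A + t) - f t) - l = s^-1 * (f (t + s) - f t - s * l).
    by rewrite [s%:A]mulr1 [s + t]addrC [RHS]mulrBr mulKf.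
  rewrite normrM normfV ler_pdivrMl ?normr_gt0 // [e * _]mulrC.
  by [].
split; first by apply/cvg_ex; exists l.
by rewrite /derive; apply/cvg_lim.
Qed.

(** The real derivative of a complex curve, spelled out because the norm of [K] takes its values in
    [K] and not in [R]. *)
Definition rder p (t : R) (c : K) := forall e : R, 0 < e -> exists2 d : R, 0 < d &
  forall s, `|s| < d -> rn (p (t + s) - p t - (s%:C : K) * c) <= e * `|s|.

Definition rcont p (t : R) := forall e : R, 0 < e -> exists2 d : R, 0 < d &
  forall s, `|s - t| < d -> rn (p s - p t) < e.

Lemma rder_Re p t c (k : K) : rder p t c ->
  is_derive t 1 (fun s => complex.Re (k * p s)) (complex.Re (k * c)).
Proof.
move=> h; apply/der_epsP => e e0.
have k0 : 0 < rn k + 1 by rewrite ltr_wpDl ?rn_ge0.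
have [d d0 hd] := h (e / (rn k + 1)) (divr_gt0 e0 k0).
exists d => // s sd; have := hd s sd => hs.
have -> : complex.Re (k * p (t + s)) - complex.Re (k * p t) - s * complex.Re (k * c)
  = complex.Re (k * (p (t + s) - p t - (s%:C : K) * c)).
  by case: k {k0 hd hs} => x y; case: (p (t + s)) => x1 y1; case: (p t) => x2 y2;
    case: c {h} => x3 y3 /=; ring.
apply: le_trans (Re_le_rn _) _; rewrite rnM.
apply: le_trans (ler_wpM2l (rn_ge0 k) hs) _.
rewrite mulrA ler_wpM2r // mulrA ler_pdivrMr // mulrC ler_wpM2l ?lerDl //.
exact: ltW.
Qed.

Lemma rderD p q t c d : rder p t c -> rder q t d -> rder (fun s => p s + q s) t (c + d).
Proof.
move=> hp hq e e0; have e2 : 0 < e / 2 by rewrite divr_gt0.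
have [d1 d10 h1] := hp _ e2; have [d2 d20 h2] := hq _ e2.
exists (Num.min d1 d2); first by rewrite lt_min d10.
move=> s; rewrite lt_min => /andP[/h1 k1 /h2 k2].
have -> : p (t + s) + q (t + s) - (p t + q t) - (s%:C : K) * (c + d)
  = (p (t + s) - p t - (s%:C : K) * c) + (q (t + s) - q t - (s%:C : K) * d) by ring.
by apply: le_trans (rnD _ _) _; lra.
Qed.

Lemma rderZ p t c (k : K) : rder p t c -> rder (fun s => k * p s) t (k * c).
Proof.
move=> hp e e0; have k0 : 0 < rn k + 1 by rewrite ltr_wpDl ?rn_ge0.
have [d d0 hd] := hp (e / (rn k + 1)) (divr_gt0 e0 k0).
exists d => // s /hd h.
have -> : k * p (t + s) - k * p t - (s%:C : K) * (k * c) =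
   k * (p (t + s) - p t - (s%:C : K) * c) by ring.
rewrite rnM; apply: le_trans (ler_wpM2l (rn_ge0 k) h) _.
rewrite mulrA ler_wpM2r // mulrA ler_pdivrMr // mulrC ler_wpM2l ?lerDl //.
exact: ltW.
Qed.

Lemma rder_cst (k : K) t : rder (fun=> k) t 0.
Proof.
by move=> e e0; exists 1 => // s _; rewrite subrr sub0r mulr0 oppr0 rn0 mulr_ge0 // ltW.
Qed.

Lemma rder_aff p t c (x y : R) : rder p (x + y * t) c ->
  rder (fun s => p (x + y * s)) t ((y%:C : K) * c).
Proof.
move=> hp e e0; have k0 : 0 < `|y| + 1 by rewrite ltr_wpDl.
have [d d0 hd] := hp (e / (`|y| + 1)) (divr_gt0 e0 k0).
exists (d / (`|y| + 1)); first exact: divr_gt0.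
move=> s; rewrite ltr_pdivlMr // => hs.
have /hd : `|y * s| < d.
  by rewrite normrM; apply: le_lt_trans hs; rewrite mulrC ler_wpM2l // lerDl.
rewrite [x + y * (t + s)](_ : _ = x + y * t + y * s); last by ring.
have -> : (s%:C : K) * ((y%:C : K) * c) = ((y * s)%:C : K) * c by rewrite rmorphM /=; ring.
move=> h; apply: le_trans h _; rewrite normrM mulrA ler_wpM2r // mulrAC ler_pdivrMr //.
by rewrite ler_wpM2l ?lerDl // ltW.
Qed.

Lemma rder_val p t c c' : c = c' -> rder p t c -> rder p t c'.
Proof. by move=> ->. Qed.

Lemma rder_rcont p t c : rder p t c -> rcont p t.
Proof.
move=> hp e e0; have [d d0 hd] := hp 1 ltr01.
have k0 : 0 < rn c + 2 by rewrite ltr_wpDl ?rn_ge0.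
exists (Num.min d (e / (rn c + 2))); first by rewrite lt_min d0 divr_gt0.
move=> s; rewrite lt_min ltr_pdivlMr // => /andP[/hd h1 h2].
move: h1; rewrite [t + _]addrC subrK mul1r => h1.
have -> : p s - p t = (p s - p t - ((s - t)%:C : K) * c) + ((s - t)%:C : K) * c by rewrite subrK.
apply: le_lt_trans (rnD _ _) _; rewrite rnM rnR.
have : 0 <= `|s - t| by [].
have := rn_ge0 c; move: h1 h2 e0; set x := rn (_ - _ - _); set y := `|s - t|; set z := rn c => *.
have [y0|y0] := eqVneq y 0; first by rewrite y0 mul0r; nra.
have y1 : 0 < y by rewrite lt_def y0.
nra.
Qed.

(** The real mean value theorem for the component of [p] in the direction of
    [p 1 - p 0]. *)
Lemma mean_value_le p (p' : R -> K) (M : R) :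
  (forall t, 0 <= t <= 1 -> rder p t (p' t)) ->
  (forall t, 0 <= t <= 1 -> rn (p' t) <= M) -> rn (p 1 - p 0) <= M.
Proof.
move=> hp hM; set c : K := (p 1 - p 0)^*%C.
have := @MVT_segment R (fun s => complex.Re (c * p s)) (fun s => complex.Re (c * p' s)) 0 1 ler01.
case.
- by move=> t /itvP ht; apply: rder_Re; apply: hp; rewrite !ht.
- apply: derivable_within_continuous => t; rewrite in_itv /= => ht.
  exact: (@ex_derive _ _ _ _ _ _ _ (rder_Re c (hp t ht))).
move=> t; rewrite in_itv /= => ht; rewrite subr0 mulr1 => h.
have cE : rn c = rn (p 1 - p 0).
  rewrite /c; move: (p 1 - p 0) => z.
  apply/eqP; rewrite -(@eqrXn2 _ 2) ?rn_ge0 //; rewrite !rn_sqr.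
  by case: z => x y /=; rewrite sqrrN.
have h2 : complex.Re (c * p 1) - complex.Re (c * p 0) = rn (p 1 - p 0) ^+ 2.
  rewrite rn_sqr /c; case: (p 1) => x1 y1; case: (p 0) => x2 y2 /=; ring.
have h3 : rn (p 1 - p 0) ^+ 2 <= rn (p 1 - p 0) * M.
  rewrite -h2 h; apply: le_trans (ler_norm _) _; apply: le_trans (Re_le_rn _) _.
  by rewrite rnM cE ler_wpM2l ?rn_ge0 ?hM.
have := rn_ge0 (p 1 - p 0); rewrite le_eqVlt => /orP[/eqP <-|r0].
  by apply: le_trans (hM 0 _); rewrite ?rn_ge0 ?lexx ?ler01.
by move: h3; rewrite expr2 ler_pM2l.
Qed.

(** The integral starts at [-1] so that [[0, 1]] is interior to the interval, and the derivatives at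
    [0] and [1] are two-sided. *)
Lemma antider_real f : continuous f ->
  exists F : R -> R, forall t : R, -1 < t < 2 -> is_derive t 1 F (f t).
Proof.
move=> cf; exists (fun x => \int[lebesgue_measure]_(t in `[-1, x]) f t)%R => t /andP[t1 t2].
have [] := @continuous_FTC1_closed R f (-1) t 2 t2 _ t1 (cf t).
  apply: continuous_compact_integrable; first exact: segment_compact.
  by apply: continuous_subspaceT.
by rewrite derive1E => h1 h2; split.
Qed.

(** A retraction onto [[0, 1]]: composing with it extends a curve to a continuous one on the line,
    as [antider_real] requires. *)
Definition clamp (t : R) : R := Num.max 0 (Num.min 1 t).

Lemma clamp_in t : 0 <= clamp t <= 1.
Proof. by rewrite /clamp le_max lexx ge_max ler01 ge_min lexx. Qed.

Lemma clamp_id t : 0 <= t <= 1 -> clamp t = t.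
Proof. by move=> /andP[a b]; rewrite /clamp (min_idPr b) (max_idPr a). Qed.

Lemma clamp_lip s t : `|clamp s - clamp t| <= `|s - t|.
Proof.
have c1 z : 1 <= z -> clamp z = 1.
  by move=> z1; rewrite /clamp (min_idPl z1) (max_idPr ler01).
have c0 z : z <= 0 -> clamp z = 0.
  move=> z0; rewrite /clamp (min_idPr (le_trans z0 ler01)).
  by apply/max_idPl.
have dd (x y : R) : x <= y -> 0 <= clamp y - clamp x /\ clamp y - clamp x <= y - x.
  move=> xy; have [x0|/ltW x0] := leP x 0; have [y0|/ltW y0] := leP y 0.
  - by rewrite !c0 //; split; lra.
  - rewrite (c0 x) //; have [y1|/ltW y1] := leP y 1.
      by rewrite clamp_id ?y0 //; split; lra.
    by rewrite c1 //; split; lra.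
  - by rewrite !c0 //; try (split; lra); lra.
  have [x1|/ltW x1] := leP x 1; have [y1|/ltW y1] := leP y 1.
  - by rewrite !clamp_id ?x0 ?y0 //; split; lra.
  - by rewrite (@clamp_id x) ?x0 // c1 //; split; lra.
  - by rewrite (c1 x) // (@clamp_id y) ?y0 //; split; lra.
  - by rewrite !c1 //; split; lra.
wlog st : s t / s <= t.
  by move=> H; have [/H//|/ltW/H] := leP s t; rewrite distrC [`|t - s|]distrC.
have [a b] := dd _ _ st.
by rewrite distrC [`|s - t|]distrC !ger0_norm // subr_ge0.
Qed.

Definition ccont p := forall t, 0 <= t <= 1 -> rcont p t.

Definition antider p (P : R -> K) := forall t, 0 <= t <= 1 -> rder P t (p t).

Lemma antider_ex p : ccont p -> exists P, antider p P.
Proof.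
move=> cp; pose q t := p (clamp t).
have cq t e : 0 < e -> exists2 d : R, 0 < d & forall s, `|s - t| < d -> rn (q s - q t) < e.
  move=> e0; have [d d0 hd] := cp _ (clamp_in t) e e0.
  by exists d => // s hs; apply: hd; apply: le_lt_trans hs; exact: clamp_lip.
have [F hF] : exists F : R -> R, forall t : R, -1 < t < 2 -> is_derive t 1 F (complex.Re (q t)).
  apply: antider_real => t; apply/cvgrPdist_lt => e e0; have [d d0 hd] := cq t e e0.
  apply/nbhs_normP; exists d => //= s /= hs.
  rewrite distrC; apply: le_lt_trans (hd s _); last by rewrite distrC.
  by have := Re_le_rn (q s - q t); case: (q s) => ? ?; case: (q t).
have [G hG] : exists F : R -> R, forall t : R, -1 < t < 2 -> is_derive t 1 F (complex.Im (q t)).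
  apply: antider_real => t; apply/cvgrPdist_lt => e e0; have [d d0 hd] := cq t e e0.
  apply/nbhs_normP; exists d => //= s /= hs.
  rewrite distrC; apply: le_lt_trans (hd s _); last by rewrite distrC.
  by have := Im_le_rn (q s - q t); case: (q s) => ? ?; case: (q t).
exists (fun t => F t +i* G t) => t t01.
have tt : -1 < t < 2 by lra.
have h1 := proj1 (der_epsP _ _ _) (hF t tt); have h2 := proj1 (der_epsP _ _ _) (hG t tt).
move=> e e0; have e2 : 0 < e / 2 by rewrite divr_gt0.
have [d1 d10 k1] := h1 _ e2; have [d2 d20 k2] := h2 _ e2.
exists (Num.min d1 d2); first by rewrite lt_min d10.
move=> s; rewrite lt_min => /andP[/k1 l1 /k2 l2].
apply: le_trans (rn_le_ReIm _) _.
rewrite /q (clamp_id t01) in l1 l2.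
move: l1 l2; case: (p t) => x y /=.
rewrite !mul0r subr0 addr0 => l1 l2.
by apply: le_trans (lerD l1 l2) _; lra.
Qed.

Lemma antider_uniq p P Q : antider p P -> antider p Q -> P 1 - P 0 = Q 1 - Q 0.
Proof.
move=> hP hQ; apply/eqP; rewrite -subr_eq0; apply/eqP; apply: rn_le0.
have -> : P 1 - P 0 - (Q 1 - Q 0) = (P 1 + (-1) * Q 1) - (P 0 + (-1) * Q 0) by ring.
apply: (@mean_value_le (fun t => P t + (-1) * Q t) (fun t => p t + (-1) * p t)) => t t01.
  by apply: rderD; [exact: hP | apply: rderZ; exact: hQ].
by rewrite mulN1r subrr rn0.
Qed.

(** The integral over [[0, 1]], as the increment of a primitive (and [0] if there is
    none): the primitives are built from the FTC on components. *)
Definition int01 p : K := xget 0 [set c | exists P, antider p P /\ c = P 1 - P 0].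

Lemma int01_val p P : antider p P -> int01 p = P 1 - P 0.
Proof.
move=> h; rewrite /int01; case: xgetP => [c _ [Q [hQ ->]]|/(_ (P 1 - P 0)) []].
  exact: antider_uniq hQ h.
by exists P.
Qed.

Lemma int01D p q : ccont p -> ccont q -> int01 (fun t => p t + q t) = int01 p + int01 q.
Proof.
move=> /antider_ex[P hP] /antider_ex[Q hQ]; rewrite (int01_val hP) (int01_val hQ).
rewrite (@int01_val _ (fun t => P t + Q t)); first by ring.
by move=> t t01; apply: rderD; [exact: hP | exact: hQ].
Qed.

Lemma int01Z p (k : K) : ccont p -> int01 (fun t => k * p t) = k * int01 p.
Proof.
move=> /antider_ex[P hP]; rewrite (int01_val hP) (@int01_val _ (fun t => k * P t)).
  by ring.
by move=> t t01; apply: rderZ; exact: hP.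
Qed.

Lemma rcontD p q t : rcont p t -> rcont q t -> rcont (fun t => p t + q t) t.
Proof.
move=> hp hq e e0; have e2 : 0 < e / 2 by rewrite divr_gt0.
have [d1 d10 h1] := hp _ e2; have [d2 d20 h2] := hq _ e2.
exists (Num.min d1 d2); first by rewrite lt_min d10.
move=> s; rewrite lt_min => /andP[/h1 k1 /h2 k2].
have -> : p s + q s - (p t + q t) = (p s - p t) + (q s - q t) by ring.
by apply: le_lt_trans (rnD _ _) _; lra.
Qed.

Lemma rcontZ p (k : K) t : rcont p t -> rcont (fun t => k * p t) t.
Proof.
move=> hp e e0; have k0 : 0 < rn k + 1 by rewrite ltr_wpDl ?rn_ge0.
have [d d0 hd] := hp (e / (rn k + 1)) (divr_gt0 e0 k0).
exists d => // s /hd; rewrite ltr_pdivlMr // => h.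
rewrite -mulrBr rnM; apply: le_lt_trans h; rewrite mulrC ler_wpM2l ?rn_ge0 //.
by rewrite lerDl.
Qed.

Lemma rcont_cst (k : K) t : rcont (fun=> k) t.
Proof. exact: rder_rcont (rder_cst k t). Qed.

Lemma ccontD p q : ccont p -> ccont q -> ccont (fun t => p t + q t).
Proof. by move=> hp hq t t01; apply: rcontD; [exact: hp|exact: hq]. Qed.

Lemma ccontZ p (k : K) : ccont p -> ccont (fun t => k * p t).
Proof. by move=> hp t t01; apply: rcontZ; exact: hp. Qed.

Lemma int01_cst (k : K) : int01 (fun=> k) = k.
Proof.
rewrite (@int01_val _ (fun t => (t%:C : K) * k)).
  by rewrite rmorph0 rmorph1 mul0r mul1r subr0.
move=> t _ e e0; exists 1 => // s _.
have -> : ((t + s)%:C : K) * k - (t%:C : K) * k - (s%:C : K) * k = 0.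
  by rewrite rmorphD /=; ring.
by rewrite rn0 mulr_ge0 // ltW.
Qed.

Lemma int01B p q : ccont p -> ccont q -> int01 (fun t => p t - q t) = int01 p - int01 q.
Proof.
move=> hp hq; rewrite -[in RHS]mulN1r -int01Z // -int01D //; last exact: ccontZ.
by congr int01; apply: funext => t; rewrite mulN1r.
Qed.

Lemma int01_bound p (M : R) : ccont p -> (forall t, 0 <= t <= 1 -> rn (p t) <= M) ->
  rn (int01 p) <= M.
Proof. by move=> /antider_ex[P hP] hM; rewrite (int01_val hP); exact: (mean_value_le hP hM). Qed.

Lemma int01_half p : ccont p -> int01 p =
  2^-1 * (int01 (fun t => p (0 + 2^-1 * t)) + int01 (fun t => p (2^-1 + 2^-1 * t))).
Proof.
move=> /antider_ex[P hP].
have c2 : ((2^-1 : R)%:C : K) = 2^-1 by rewrite fmorphV /= rmorphMn.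
have H (x : R) : 0 <= x <= 2^-1 ->
   antider (fun t => p (x + 2^-1 * t)) (fun t => 2 * P (x + 2^-1 * t)).
  move=> x0 t t01.
  apply: (@rder_val _ _ (2 * (((2^-1 : R)%:C : K) * p (x + 2^-1 * t)))).
    by rewrite c2 mulrA mulfV ?mul1r // pnatr_eq0.
  by apply: rderZ; apply: rder_aff; apply: hP; lra.
have h1 : 0 <= (0 : R) <= 2^-1 by lra.
have h2 : 0 <= (2^-1 : R) <= 2^-1 by lra.
rewrite (int01_val hP) (int01_val (H _ h1)) (int01_val (H _ h2)).
rewrite !mulr0 !mulr1 !add0r addr0 (_ : 2^-1 + 2^-1 = 1 :> R); last by lra.
by field.
Qed.

Lemma int01_rev p : ccont p -> int01 (fun t => p (1 + (-1) * t)) = int01 p.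
Proof.
move=> /antider_ex[P hP]; rewrite (int01_val hP).
rewrite (@int01_val _ (fun t => (-1) * P (1 + (-1) * t))).
  by rewrite mulr1 mulr0 addr0 subrr; ring.
move=> t t01; apply: (@rder_val _ _ (-1 * (((-1 : R)%:C : K) * p (1 + (-1) * t)))).
  by rewrite rmorphN rmorph1; ring.
by apply: rderZ; apply: rder_aff; apply: hP; lra.
Qed.

(** The intervals of centre [u n] and radius [2 * M / 2 ^+ n] are nested, since the step from [u n]
    to [u n.+1] is at most the difference of two consecutive radii. A supremum gives their common
    point. *)
Lemma real_geom_lim (u : nat -> R) (M : R) :
  (forall n, `|u n.+1 - u n| <= M / 2 ^+ n) ->
  exists l, forall n, `|l - u n| <= 2 * M / 2 ^+ n.
Proof.
move=> h; pose a n := u n - 2 * M / 2 ^+ n; pose b n := u n + 2 * M / 2 ^+ n.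
have two n : 2 * M / 2 ^+ n.+1 = M / 2 ^+ n.
  by rewrite exprS invfM mulrACA mulfV ?mul1r ?pnatr_eq0.
have M0 n : 0 <= M / 2 ^+ n by apply: le_trans (h n).
have aS n : a n <= a n.+1.
  have := h n; rewrite /a two ler_norml => /andP[h1 _].
  have e : 2 * M / 2 ^+ n = M / 2 ^+ n + M / 2 ^+ n by ring.
  by rewrite e; lra.
have bS n : b n.+1 <= b n.
  have := h n; rewrite /b two ler_norml => /andP[_ h1].
  have e : 2 * M / 2 ^+ n = M / 2 ^+ n + M / 2 ^+ n by ring.
  by rewrite e; lra.
have am n m : (n <= m)%N -> a n <= a m.
  elim: m => [|m IH]; first by rewrite leqn0 => /eqP->.
  by rewrite leq_eqVlt => /predU1P[->//|/IH k]; exact: le_trans k (aS m).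
have bm n m : (n <= m)%N -> b m <= b n.
  elim: m => [|m IH]; first by rewrite leqn0 => /eqP->.
  by rewrite leq_eqVlt => /predU1P[->//|/IH k]; exact: le_trans (bS m) k.
have ab n m : a n <= b m.
  have k i : a i <= b i.
    have := M0 i; rewrite /a /b (_ : 2 * M / 2 ^+ i = M / 2 ^+ i + M / 2 ^+ i); last by ring.
    by lra.
  by have [nm|/ltnW mn] := leqP n m; [apply: le_trans (am _ _ nm) _ | apply: le_trans (k n) _; exact: bm].
exists (sup (range a)) => n.
have s : has_sup (range a).
  by split; [exists (a 0%N), 0%N | exists (b 0%N) => _ [m _ <-]].
have h1 : a n <= sup (range a) by apply: sup_upper_bound => //; exists n.
have h2 : sup (range a) <= b n.
  by apply: ge_sup; [exists (a 0%N), 0%N | move=> _ [m _ <-]].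
by rewrite ler_norml; move: h1 h2; rewrite /a /b; lra.
Qed.

Lemma geom_lim (u : nat -> K) (M : R) :
  (forall n, rn (u n.+1 - u n) <= M / 2 ^+ n) ->
  exists l, forall n, rn (l - u n) <= 4 * M / 2 ^+ n.
Proof.
move=> h.
have [n|x hx] := @real_geom_lim (fun n => complex.Re (u n)) M.
  by apply: le_trans (h n); have := Re_le_rn (u n.+1 - u n); case: (u n.+1) => ? ?; case: (u n).
have [n|y hy] := @real_geom_lim (fun n => complex.Im (u n)) M.
  by apply: le_trans (h n); have := Im_le_rn (u n.+1 - u n); case: (u n.+1) => ? ?; case: (u n).
exists (x +i* y) => n; apply: le_trans (rn_le_ReIm _) _.
have := hx n; have := hy n; case: (u n) => a b /=.
have -> : 4 * M / 2 ^+ n = 2 * M / 2 ^+ n + 2 * M / 2 ^+ n by ring.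
by move=> *; lra.
Qed.

End RealCurves.

(** * Goursat's lemma for closed convex sets *)

Section Goursat.
Variable R : realType.
Local Notation K := (C R).

Lemma rder_seg (V : normedModType K) (f : V -> K) (a u : V) (t : R) :
  differentiable f (a + (t%:C : K) *: u) ->
  rder (fun s : R => f (a + (s%:C : K) *: u)) t ('d f (a + (t%:C : K) *: u) u).
Proof.
move=> /diff_isd[lL _ h] e e0.
have k0 : 0 < rn u + 1 by rewrite ltr_wpDl ?rn_ge0.
have [d d0 hd] := h _ (divr_gt0 e0 k0).
exists (d / (rn u + 1)); first exact: divr_gt0.
move=> s; rewrite ltr_pdivlMr // => hs.
have sd : rn ((s%:C : K) *: u) < d.
  by rewrite rnZ rnR; apply: le_lt_trans hs; rewrite ler_wpM2l // lerDl.
have := hd _ sd.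
have -> : a + (t%:C : K) *: u + (s%:C : K) *: u = a + ((t + s)%:C : K) *: u.
  by rewrite rmorphD /= scalerDl addrA.
have -> : 'd f (a + (t%:C : K) *: u) ((s%:C : K) *: u) = (s%:C : K) * 'd f (a + (t%:C : K) *: u) u.
  by rewrite linearZ.
move=> k; apply: le_trans k _; rewrite rnZ rnR.
have -> : e / (rn u + 1) * (`|s| * rn u) = e * `|s| * (rn u / (rn u + 1)) by ring.
rewrite ler_piMr ?mulr_ge0 ?(ltW e0) //.
by rewrite ler_pdivrMr // mul1r lerDl.
Qed.

Lemma rcont_seg (V : normedModType K) (f : V -> K) (a u : V) (t : R) :
  {for a + (t%:C : K) *: u, continuous f} -> rcont (fun s : R => f (a + (s%:C : K) *: u)) t.
Proof.
move=> /contE h e e0; have [d d0 hd] := h e e0.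
have k0 : 0 < rn u + 1 by rewrite ltr_wpDl ?rn_ge0.
exists (d / (rn u + 1)); first exact: divr_gt0.
move=> s; rewrite ltr_pdivlMr // => hs; apply: hd.
rewrite opprD addrACA subrr add0r -scalerBl -rmorphB /= rnZ rnR.
by apply: le_lt_trans hs; rewrite ler_wpM2l // lerDl.
Qed.

Lemma mean_value_le_seg (V : normedModType K) (f : V -> K) (a b : V) (M : R) :
  (forall t : R, 0 <= t <= 1 -> differentiable f (a + (t%:C : K) *: (b - a)) /\
     rn ('d f (a + (t%:C : K) *: (b - a)) (b - a)) <= M) ->
  rn (f b - f a) <= M.
Proof.
move=> h.
have := @mean_value_le R (fun s : R => f (a + (s%:C : K) *: (b - a)))
   (fun t => 'd f (a + (t%:C : K) *: (b - a)) (b - a)) M.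
rewrite rmorph0 rmorph1 scale1r scale0r addr0 [a + (b - a)]addrC subrK; apply.
  by move=> t t01; apply: rder_seg; have [] := h t t01.
by move=> t t01; have [] := h t t01.
Qed.

Definition cvx (V : normedModType K) (S : V -> Prop) :=
  forall a b, S a -> S b -> forall t : R, 0 <= t <= 1 -> S (a + (t%:C : K) *: (b - a)).

Definition seg_int (f : K -> K) (a b : K) : K :=
  (b - a) * int01 (fun t : R => f (a + (t%:C : K) *: (b - a))).

Section Convex.
Variables (S : K -> Prop) (f : K -> K).
Hypothesis (cS : cvx S) (cf : forall z, S z -> {for z, continuous f}).

Lemma ccont_seg a b : S a -> S b -> ccont (fun t : R => f (a + (t%:C : K) *: (b - a))).
Proof. by move=> Sa Sb t t01; apply: rcont_seg; apply: cf; exact: cS. Qed.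

Lemma seg_int_rev a b : S a -> S b -> seg_int f b a = - seg_int f a b.
Proof.
move=> Sa Sb; rewrite /seg_int -(int01_rev (ccont_seg Sa Sb)) -mulNr opprB.
congr (_ * int01 _); apply: funext => t; congr f.
by rewrite rmorphD rmorph1 rmorphM rmorphN rmorph1 /GRing.scale /=; ring.
Qed.

Definition mid (a b : K) : K := 2^-1 * (a + b).

Lemma half_C : ((2^-1 : R)%:C : K) = 2^-1.
Proof. by rewrite fmorphV /= rmorphMn. Qed.

Lemma mid_seg a b : mid a b = a + ((2^-1 : R)%:C : K) *: (b - a).
Proof. by rewrite half_C /mid /GRing.scale /=; field. Qed.

Lemma S_mid a b : S a -> S b -> S (mid a b).
Proof. by move=> Sa Sb; rewrite mid_seg; apply: cS => //; lra. Qed.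

Lemma seg_int_mid a b : S a -> S b ->
  seg_int f a b = seg_int f a (mid a b) + seg_int f (mid a b) b.
Proof.
move=> Sa Sb; rewrite /seg_int (int01_half (ccont_seg Sa Sb)).
have e1 : mid a b - a = 2^-1 * (b - a) by rewrite /mid; field.
have e2 : b - mid a b = 2^-1 * (b - a) by rewrite /mid; field.
rewrite e1 e2 mulrA [(b - a) * _]mulrC mulrDr; congr (_ * int01 _ + _ * int01 _); apply: funext => t; congr f.
  by rewrite add0r rmorphM /= half_C /GRing.scale /=; ring.
by rewrite mid_seg rmorphD rmorphM /= half_C /GRing.scale /=; ring.
Qed.

Lemma seg_int_bound a b (k : K) (M : R) : S a -> S b ->
  (forall t : R, 0 <= t <= 1 -> rn (f (a + (t%:C : K) *: (b - a)) - k) <= M) ->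
  rn (seg_int f a b - k * (b - a)) <= M * rn (b - a).
Proof.
move=> Sa Sb h; have c := ccont_seg Sa Sb.
rewrite /seg_int mulrC -mulrBl rnM ler_wpM2r ?rn_ge0 //.
rewrite -[k](int01_cst k) -int01B //; last by move=> t _; exact: rcont_cst.
apply: int01_bound => //.
by move=> t t01; apply: rcontD; [exact: c|exact: rcont_cst].
Qed.

Definition tri a b c := seg_int f a b + seg_int f b c + seg_int f c a.

Lemma tri_split a b c : S a -> S b -> S c ->
  tri a b c = tri a (mid a b) (mid c a) + tri (mid a b) b (mid b c)
    + tri (mid c a) (mid b c) c + tri (mid a b) (mid b c) (mid c a).
Proof.
move=> Sa Sb Sc; have Sab := S_mid Sa Sb; have Sbc := S_mid Sb Sc; have Sca := S_mid Sc Sa.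
rewrite /tri (seg_int_mid Sa Sb) (seg_int_mid Sb Sc) (seg_int_mid Sc Sa).
rewrite (seg_int_rev Sca Sab) (seg_int_rev Sab Sbc) (seg_int_rev Sbc Sca).
ring.
Qed.

End Convex.

Lemma seg_int_FTC (S : K -> Prop) (F f : K -> K) a b : cvx S -> S a -> S b ->
  (forall z, S z -> isd F z (fun u => f z * u)) -> seg_int f a b = F b - F a.
Proof.
move=> cS Sa Sb hF; set P := fun t : R => F (a + (t%:C : K) *: (b - a)).
have [->|ab] := eqVneq b a; first by rewrite /seg_int subrr mul0r subrr.
have nz : b - a != 0 by rewrite subr_eq0.
rewrite /seg_int (@int01_val _ _ (fun t => (b - a)^-1 * P t)).
  rewrite /P -mulrBr mulVKf // rmorph0 rmorph1 scale0r scale1r addr0.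
  by rewrite [a + (b - a)]addrC subrK.
move=> t t01; apply: (@rder_val _ _ _ ((b - a)^-1 * (f (a + (t%:C : K) *: (b - a)) * (b - a)))).
  by rewrite mulrC mulfK.
apply: rderZ; have Sz := cS a b Sa Sb t t01; have h := hF _ Sz.
by have := rder_seg (isd_diff h); rewrite (isd_val h).
Qed.

Lemma isd_id (V : normedModType K) (x : V) : isd id x id.
Proof.
split=> // [|e e0]; first by exists 1 => u; rewrite mul1r.
by exists 1 => // u _; rewrite [x + u]addrC addrK subrr rn0 mulr_ge0 ?rn_ge0 // ltW.
Qed.

Lemma isd_quad (p q z0 z : K) :
  isd (fun w => p * w + q / 2 * (w - z0) ^+ 2) z (fun u => (p + q * (z - z0)) * u).
Proof.
split; first by move=> k u v /=; rewrite /GRing.scale /=; ring.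
  by exists (rn (p + q * (z - z0))) => u; rewrite rnM.
move=> e e0; have k0 : 0 < rn (q / 2) + 1 by rewrite ltr_wpDl ?rn_ge0.
exists (e / (rn (q / 2) + 1)); first exact: divr_gt0.
move=> u; rewrite ltr_pdivlMr // => hu.
have -> : p * (z + u) + q / 2 * (z + u - z0) ^+ 2 - (p * z + q / 2 * (z - z0) ^+ 2)
   - (p + q * (z - z0)) * u = q / 2 * u * u by field.
rewrite 2!rnM ler_wpM2r ?rn_ge0 //; apply: ltW; apply: le_lt_trans hu.
by rewrite mulrC ler_wpM2l ?rn_ge0 ?lerDl.
Qed.

Definition in_tri (S : K -> Prop) (x : K * K * K) := [/\ S x.1.1, S x.1.2 & S x.2].
(** The perimeter rather than the diameter: it is exactly halved in each of the four pieces. *)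
Definition tri_dia (x : K * K * K) :=
  rn (x.1.2 - x.1.1) + rn (x.2 - x.1.2) + rn (x.1.1 - x.2).

Lemma rn_half (z : K) : rn (2^-1 * z) = rn z / 2.
Proof. by rewrite -half_C rnM rnRge ?invr_ge0 // mulrC. Qed.

Lemma goursat_step (S : K -> Prop) (f : K -> K) (x : K * K * K) : cvx S ->
  (forall z, S z -> {for z, continuous f}) -> in_tri S x -> exists y : K * K * K,
    [/\ in_tri S y, tri_dia y = tri_dia x / 2,
      rn (tri f x.1.1 x.1.2 x.2) <= 4 * rn (tri f y.1.1 y.1.2 y.2) &
      rn (y.1.1 - x.1.1) <= tri_dia x].
Proof.
move=> cS cf.
case: x => [[x1 x2] x3] [/= S1 S2 S3].
pose T (x : K * K * K) := tri f x.1.1 x.1.2 x.2.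
  have Sab := S_mid cS S1 S2; have Sbc := S_mid cS S2 S3; have Sca := S_mid cS S3 S1.
  have TE : T (x1, x2, x3) = T (x1, mid x1 x2, mid x3 x1) + T (mid x1 x2, x2, mid x2 x3)
    + T (mid x3 x1, mid x2 x3, x3) + T (mid x1 x2, mid x2 x3, mid x3 x1).
    exact: (tri_split cS cf).
  have d1 : rn (mid x1 x2 - x1) = rn (x2 - x1) / 2.
    by rewrite -rn_half; congr rn; rewrite /mid; field.
  have d2 : rn (x2 - mid x1 x2) = rn (x2 - x1) / 2.
    by rewrite -rn_half; congr rn; rewrite /mid; field.
  have d3 : rn (mid x2 x3 - x2) = rn (x3 - x2) / 2.
    by rewrite -rn_half; congr rn; rewrite /mid; field.
  have d4 : rn (x3 - mid x2 x3) = rn (x3 - x2) / 2.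
    by rewrite -rn_half; congr rn; rewrite /mid; field.
  have d5 : rn (mid x3 x1 - x3) = rn (x1 - x3) / 2.
    by rewrite -rn_half; congr rn; rewrite /mid; field.
  have d6 : rn (x1 - mid x3 x1) = rn (x1 - x3) / 2.
    by rewrite -rn_half; congr rn; rewrite /mid; field.
  have m1 : rn (mid x3 x1 - mid x1 x2) = rn (x3 - x2) / 2.
    by rewrite -rn_half; congr rn; rewrite /mid; field.
  have m2 : rn (mid x1 x2 - mid x2 x3) = rn (x1 - x3) / 2.
    by rewrite -rn_half; congr rn; rewrite /mid; field.
  have m3 : rn (mid x2 x3 - mid x3 x1) = rn (x2 - x1) / 2.
    by rewrite -rn_half; congr rn; rewrite /mid; field.
  have r1 := rn_ge0 (x2 - x1); have r2 := rn_ge0 (x3 - x2); have r3 := rn_ge0 (x1 - x3).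
  have big : [\/ rn (T (x1, x2, x3)) <= 4 * rn (T (x1, mid x1 x2, mid x3 x1)),
    rn (T (x1, x2, x3)) <= 4 * rn (T (mid x1 x2, x2, mid x2 x3)),
    rn (T (x1, x2, x3)) <= 4 * rn (T (mid x3 x1, mid x2 x3, x3)) |
    rn (T (x1, x2, x3)) <= 4 * rn (T (mid x1 x2, mid x2 x3, mid x3 x1))].
    have := rnD (T (x1, mid x1 x2, mid x3 x1) + T (mid x1 x2, x2, mid x2 x3)
       + T (mid x3 x1, mid x2 x3, x3)) (T (mid x1 x2, mid x2 x3, mid x3 x1)).
    have := rnD (T (x1, mid x1 x2, mid x3 x1) + T (mid x1 x2, x2, mid x2 x3))
       (T (mid x3 x1, mid x2 x3, x3)).
    have := rnD (T (x1, mid x1 x2, mid x3 x1)) (T (mid x1 x2, x2, mid x2 x3)).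
    rewrite -TE; set t0 := rn (T (x1, x2, x3)); set t1 := rn (T (x1, _, _)).
    set t2 := rn (T (_, x2, _)); set t3 := rn (T (_, x3)); set t4 := rn (T _).
    move=> h1 h2 h3.
    have [k1|k1] := leP t0 (4 * t1); first exact: Or41.
    have [k2|k2] := leP t0 (4 * t2); first exact: Or42.
    have [k3|k3] := leP t0 (4 * t3); first exact: Or43.
    by apply: Or44; lra.
  case: big => big.
  - exists (x1, mid x1 x2, mid x3 x1) ; split=> //; rewrite /tri_dia /=.
      by rewrite d1 d6 m1; lra.
    by rewrite subrr rn0; lra.
  - exists (mid x1 x2, x2, mid x2 x3) ; split=> //; rewrite /tri_dia /=.
      by rewrite d2 d3 m2; lra.
    by rewrite d1; lra.
  - exists (mid x3 x1, mid x2 x3, x3) ; split=> //; rewrite /tri_dia /=.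
      by rewrite m3 d4 d5; lra.
    by rewrite rnC d6; lra.
  - exists (mid x1 x2, mid x2 x3, mid x3 x1) ; split=> //; rewrite /tri_dia /=.
      by rewrite (rnC (mid x2 x3)) m2 (rnC (mid x3 x1)) m3 (rnC (mid x1 x2) (mid x3 x1)) m1; lra.
    by rewrite d1; lra.
Qed.

(** By bisection; the limit point of the nested triangles stays
    in [S] because [S] is closed. *)
Lemma goursat (S : K -> Prop) (f : K -> K) (a b c : K) : cvx S ->
  (forall p, (forall e : R, 0 < e -> exists2 z, S z & rn (p - z) < e) -> S p) ->
  (forall z, S z -> differentiable f z) -> S a -> S b -> S c -> tri f a b c = 0.
Proof.
move=> cS clS df Sa Sb Sc.
have cf z : S z -> {for z, continuous f} by move=> /df; exact: differentiable_continuous.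
pose T (x : K * K * K) := tri f x.1.1 x.1.2 x.2.
pose inS (x : K * K * K) := [/\ S x.1.1, S x.1.2 & S x.2].
pose dia (x : K * K * K) := rn (x.1.2 - x.1.1) + rn (x.2 - x.1.2) + rn (x.1.1 - x.2).
have step x : exists y, inS x ->
    [/\ inS y, dia y = dia x / 2, rn (T x) <= 4 * rn (T y) & rn (y.1.1 - x.1.1) <= dia x].
  have [xS|nx] := pselect (inS x); last by exists x.
  by have [y hy] := goursat_step cS cf xS; exists y.
have [next nextP] := choice step.
pose x n := iter n next (a, b, c).
set D := dia (a, b, c).
have xP n : [/\ inS (x n), dia (x n) = D / 2 ^+ n & rn (T (a, b, c)) <= 4 ^+ n * rn (T (x n))].
  elim: n => [|n [i1 i2 i3]]; first by rewrite /x /= !expr0 mul1r divr1.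
  have [j1 j2 j3 j4] := nextP _ i1; rewrite /x iterS -/(x n); split=> //.
    by rewrite j2 i2 exprS invfM; ring.
  apply: le_trans i3 _; rewrite exprSr -mulrA ler_wpM2l // exprn_ge0 //; lra.
have [n|p hp] := @geom_lim R (fun n => (x n).1.1) D.
  have [i1 i2 i3] := xP n; have [j1 j2 j3 j4] := nextP _ i1.
  by rewrite -i2.
have pow0 (e : R) : 0 < e -> exists n, 1 / 2 ^+ n < e.
  move=> e0; exists (Num.truncn e^-1).+1; rewrite div1r invf_plt ?posrE ?exprn_gt0 //.
  apply: lt_le_trans (truncnS_gt _) _.
  by rewrite -natrX ler_nat ltnW // ltn_expl.
have r1 := rn_ge0 (b - a); have r2 := rn_ge0 (c - b); have r3 := rn_ge0 (a - c).
have D0 : 0 <= D by rewrite /D /dia /=; lra.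
have small (e : R) : 0 < e -> exists2 n, D / 2 ^+ n < e & 4 * D / 2 ^+ n < e.
  move=> e0; have k0 : 0 < 4 * D + 1 by lra.
  have [n hn] := pow0 _ (divr_gt0 e0 k0).
  have q0 : 0 < (2 ^+ n : R)^-1 by rewrite invr_gt0 exprn_gt0.
  by exists n; move: hn; rewrite div1r ltr_pdivlMr //; nra.
have Sp : S p.
  apply: clS => e e0; have [n _ hn] := small e e0.
  by exists (x n).1.1; [have [[]] := xP n | exact: le_lt_trans (hp n) hn].
apply: rn_le0; apply/ler_addgt0Pr => eta eta0; rewrite add0r.
(* The [n]-th triangle has perimeter [D / 2 ^+ n] and lies within [6 * D / 2 ^+ n] of [p]. An error
   of [eps * rn (z - p)] in [f] thus contributes at most [eps * 6 * D * D / 4 ^+ n], and the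
   bisection costs a factor [4 ^+ n]. *)
have k0 : 0 < 6 * D * D + 1 by nra.
have [lL _ hL] := diff_isd (df _ Sp).
have k1 : 0 < eta / (6 * D * D + 1) by rewrite divr_gt0.
have [d d0 hd] := hL _ k1.
have [n _ _] := small _ d0.
have d6 : 0 < d / 2 by rewrite divr_gt0.
have {n}[n n1 n2] := small _ d6.
have [[S1 S2 S3] i2 i3] := xP n.
set x1 := (x n).1.1 in S1 *; set x2 := (x n).1.2 in S2 *; set x3 := (x n).2 in S3 *.
set dn := D / 2 ^+ n in i2 n1.
have pn : rn (p - x1) <= 4 * dn by rewrite /dn mulrA; exact: hp.
pose q := 'd f p 1; have dE u : 'd f p u = q * u.
  by rewrite -[in LHS](mulr1 u) -[u * 1]/(u *: 1) linearZ /= mulrC.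
(* The affine approximation has a quadratic primitive, so its integral around the triangle is zero
   and can be subtracted. *)
pose g z := f p + q * (z - p).
have triE : T (x n) = (seg_int f x1 x2 - seg_int g x1 x2) +
   (seg_int f x2 x3 - seg_int g x2 x3) + (seg_int f x3 x1 - seg_int g x3 x1).
  have F z : S z -> isd (fun w => f p * w + q / 2 * (w - p) ^+ 2) z (fun u => g z * u).
    by move=> _; exact: isd_quad.
  rewrite /T /tri -/x1 -/x2 -/x3 !(@seg_int_FTC S _ g _ _ cS _ _ F) //; ring.
have i2' : rn (x2 - x1) + rn (x3 - x2) + rn (x1 - x3) = dn := i2.
have s1 := rn_ge0 (x2 - x1); have s2 := rn_ge0 (x3 - x2); have s3 := rn_ge0 (x1 - x3).
have cg z : S z -> {for z, continuous g}.
  move=> _; apply: differentiable_continuous; apply: isd_diff (_ : isd g z (fun u => q * u)).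
  split; first by move=> k u v; rewrite /GRing.scale /=; ring.
    by exists (rn q) => u; rewrite rnM.
  move=> e e0; exists 1 => // u _; rewrite /g.
  have -> : f p + q * (z + u - p) - (f p + q * (z - p)) - q * u = 0 by ring.
  by rewrite rn0 mulr_ge0 ?rn_ge0 // ltW.
have est u v : S u -> S v -> rn (u - x1) <= dn -> rn (v - u) <= dn ->
   rn (seg_int f u v - seg_int g u v) <= eta / (6 * D * D + 1) * (6 * dn) * rn (v - u).
  move=> Su Sv hu hv.
  have cu := ccont_seg cS cf Su Sv; have cgu := ccont_seg cS cg Su Sv.
  rewrite /seg_int -mulrBr rnM mulrC ler_wpM2r ?rn_ge0 // -int01B //; apply: int01_bound.
    move=> t t01; apply: rcontD; first exact: cu.
    move=> e e0; have [d' d0' hd'] := cgu t t01 e e0; exists d' => // s /hd'.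
    by rewrite -opprD rnN.
  move=> t t01; set z := u + (t%:C : K) *: (v - u).
  have zp : rn (z - p) <= 6 * dn.
    apply: le_trans (rn_tri x1 z p) _; rewrite rnC in pn.
    have : rn (z - x1) <= rn (u - x1) + rn (v - u).
      rewrite /z addrAC; apply: le_trans (rnD _ _) _; rewrite lerD2l rnZ rnR.
      have /andP[t0 t1] := t01; rewrite ger0_norm //.
      by rewrite -[leRHS]mul1r ler_wpM2r ?rn_ge0.
    by lra.
  have zd : rn (z - p) < d by move: n1 n2 => *; move: zp; rewrite /dn; lra.
  have := hd _ zd; rewrite [p + _]addrC subrK dE /g => h.
  rewrite opprD addrA; apply: le_trans h _.
  by rewrite ler_wpM2l // ltW.
apply: le_trans i3 _; rewrite triE.
have t31 : rn (x3 - x1) <= dn by rewrite rnC; lra.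
have e1 : rn (seg_int f x1 x2 - seg_int g x1 x2) <= eta / (6 * D * D + 1) * (6 * dn) * rn (x2 - x1).
  by apply: est => //; rewrite ?subrr ?rn0; lra.
have e2 : rn (seg_int f x2 x3 - seg_int g x2 x3) <= eta / (6 * D * D + 1) * (6 * dn) * rn (x3 - x2).
  by apply: est => //; lra.
have e3 : rn (seg_int f x3 x1 - seg_int g x3 x1) <= eta / (6 * D * D + 1) * (6 * dn) * rn (x1 - x3).
  by apply: est => //; lra.
have tot : rn (seg_int f x1 x2 - seg_int g x1 x2 + (seg_int f x2 x3 - seg_int g x2 x3)
   + (seg_int f x3 x1 - seg_int g x3 x1)) <= eta / (6 * D * D + 1) * (6 * dn) * dn.
  apply: le_trans (rnD _ _) _.
  apply: le_trans (lerD (le_trans (rnD _ _) (lerD e1 e2)) e3) _.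
  by rewrite -!mulrDr i2'.
have p4 : 0 <= (4 : R) ^+ n by rewrite exprn_ge0.
apply: le_trans (ler_wpM2l p4 tot) _.
have -> : 4 ^+ n * (eta / (6 * D * D + 1) * (6 * dn) * dn) = eta / (6 * D * D + 1) * (6 * D * D).
  rewrite /dn (_ : 4 = 2 * 2); last by ring.
  rewrite exprMn.
  have : (2 : R) ^+ n != 0 by rewrite expf_neq0 // pnatr_eq0.
  by move: (2 ^+ n) (eta / _) => w Q w0; field.
rewrite mulrAC ler_pdivrMr // ler_wpM2l //; first exact: ltW.
by rewrite lerDl.
Qed.

End Goursat.

(** * The mean value property on circles about the origin *)

Section MeanValue.
Variable R : realType.
Local Notation K := (C R).

Lemma ReD (a b : K) : complex.Re (a + b) = complex.Re a + complex.Re b.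
Proof. by case: a b => ? ? []. Qed.

Lemma ReB (a b : K) : complex.Re (a - b) = complex.Re a - complex.Re b.
Proof. by case: a b => ? ? []. Qed.

Lemma Re_line (a b : K) (t : R) :
  complex.Re (a + (t%:C : K) *: (b - a)) = (1 - t) * complex.Re a + t * complex.Re b.
Proof. by case: a b => a1 a2 [b1 b2] /=; ring. Qed.

(** The primitive is the integral from [-1]. Since [goursat] asks for a closed set, it is applied in
    a half-plane [Re w <= x], where [x < 0] is the largest real part of the three vertices. *)
Lemma half_plane_primitive (G : K -> K) :
  (forall w : K, complex.Re w < 0 -> differentiable G w) ->
  exists H : K -> K, forall w : K, complex.Re w < 0 -> isd H w (fun u => G w * u).
Proof.
move=> dG; exists (fun z => seg_int G (-1) z) => z z0.
pose S (x : R) (w : K) := complex.Re w <= x.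
have cS x : cvx (S x).
  move=> a b; rewrite /S => ha hb t /andP[t0 t1].
  by rewrite Re_line; nra.
have cont (w : K) : complex.Re w < 0 -> {for w, continuous G}.
  by move=> /dG; exact: differentiable_continuous.
have key (w : K) : complex.Re w < 0 -> seg_int G (-1) w - seg_int G (-1) z = seg_int G z w.
  move=> w0; pose x := Num.max (-1) (Num.max (complex.Re z) (complex.Re w)).
  have x0 : x < 0 by rewrite !gt_max z0 w0 andbT oppr_lt0 ltr01.
  have Sx v : S x v -> complex.Re v < 0 by move=> h; exact: le_lt_trans h x0.
  have Sz : S x z by rewrite /S /x !le_max lexx orbT.
  have Sw : S x w by rewrite /S /x !le_max lexx !orbT.
  have S1 : S x (-1) by rewrite /S /x !le_max lexx.
  have := @goursat R (S x) G (-1) z w (cS x) _ _ S1 Sz Sw.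
  rewrite /tri (@seg_int_rev R (S x) G (cS x) (fun v h => cont v (Sx v h)) _ _ S1 Sw).
  move=> h; have {}h := h _ (fun v hv => dG v (Sx v hv)).
  apply/eqP; rewrite -subr_eq0; apply/eqP; rewrite -oppr0 -[in RHS]h; first by ring.
  move=> p hp; rewrite /S; apply/ler_addgt0Pr => e e0; have [v Sv hv] := hp e e0.
  have := Re_le_rn (p - v); have := ler_norm (complex.Re (p - v)).
  by move: Sv; rewrite /S ReB => *; lra.
split.
- by move=> k u v; rewrite /GRing.scale /=; ring.
- by exists (rn (G z)) => u; rewrite rnM.
move=> e e0; have [d d0 hd] := proj1 (contE _ _) (cont z z0) e e0.
exists (Num.min d (- complex.Re z)); first by rewrite lt_min d0 oppr_gt0.
move=> u; rewrite lt_min => /andP[ud uz].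
have ball_neg (v : K) : rn v <= rn u -> complex.Re (z + v) < 0.
  move=> hv; have := Re_le_rn v; have := ler_norm (complex.Re v).
  by rewrite ReD => *; lra.
rewrite key; last exact: ball_neg.
have zu : z + u - z = u by rewrite addrC addKr.
pose x := Num.max (complex.Re z) (complex.Re (z + u)).
have x0 : x < 0 by rewrite gt_max z0 ball_neg.
have Sx v : S x v -> complex.Re v < 0 by move=> h; exact: le_lt_trans h x0.
have Sz : S x z by rewrite /S /x le_max lexx.
have Szu : S x (z + u) by rewrite /S /x le_max lexx orbT.
have := @seg_int_bound R (S x) G (cS x) (fun v h => cont v (Sx v h)) z (z + u) (G z) e Sz Szu.
rewrite zu; apply => t /andP[t0 t1]; apply: ltW; apply: hd.
rewrite [z + _]addrC addrK rnZ rnRge //; apply: le_lt_trans ud.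
by rewrite -[leRHS]mul1r ler_wpM2r ?rn_ge0.
Qed.

Definition cexp (w : K) : K :=
  (expR (complex.Re w))%:C * (cos (complex.Im w) +i* sin (complex.Im w)).

Lemma cexpD u v : cexp (u + v) = cexp u * cexp v.
Proof.
case: u v => a b [c d]; rewrite /cexp /= expRD cosD sinD.
by congr (_ +i* _); ring.
Qed.

Lemma rn_cexp w : rn (cexp w) = expR (complex.Re w).
Proof.
rewrite /cexp rnM rnRge ?expR_ge0 //.
suff -> : rn (cos (complex.Im w) +i* sin (complex.Im w) : K) = 1 by rewrite mulr1.
apply/eqP; rewrite -(@eqrXn2 _ 2) ?rn_ge0 //.
by rewrite rn_sqr /= cos2Dsin2 expr1n.
Qed.

Lemma cexp_small (e : R) : 0 < e -> exists2 d : R, 0 < d &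
  forall u, rn u < d -> rn (cexp u - 1 - u) <= e * rn u.
Proof.
(* The error terms below add up to at most [8 * e' * r], where [r] is the norm of [u]. *)
move=> e0; have [e' [e'0 e'1 e'e]] : exists e', [/\ 0 < e', e' <= 1 & 10 * e' <= e].
  exists (Num.min 1 (e / 10)); rewrite lt_min ltr01 divr_gt0 // ge_min lexx; split=> //.
  by rewrite mulrC -ler_pdivlMr // ge_min lexx orbT.
have [d1 d10 h1] := proj1 (der_epsP _ _ _) (is_derive_expR (0 : R)) e' e'0.
have [d2 d20 h2] := proj1 (der_epsP _ _ _) (is_derive_cos (0 : R)) e' e'0.
have [d3 d30 h3] := proj1 (der_epsP _ _ _) (is_derive_sin (0 : R)) e' e'0.
exists (Num.min e' (Num.min d1 (Num.min d2 d3))); first by rewrite !lt_min e'0 d10 d20.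
move=> u; rewrite !lt_min => /andP[ue /andP[u1 /andP[u2 u3]]].
have := Re_le_rn u; have := Im_le_rn u; have := rn_ge0 u.
move: (rn u) ue u1 u2 u3 => r re r1 r2 r3 r0.
case: u => x y /= yr xr.
have := h1 x (le_lt_trans xr r1); have := h2 y (le_lt_trans yr r2).
have := h3 y (le_lt_trans yr r3).
rewrite !add0r expR0 cos0 sin0 oppr0 !mulr0 !subr0 !addr0 !mulr1 => s1 s2 s3.
apply: le_trans (rn_le_ReIm _) _; rewrite /cexp /= !mul0r subr0 addr0 subr0.
set E := expR x in s3 *; set c := cos y in s2 *; set s := sin y in s1 *.
have -> : E * c - 1 - x = (E - 1 - x) * c + (1 + x) * (c - 1) by ring.
have -> : E * s - y = (E - 1) * s + (s - y) by ring.
have A1 : `|E - 1 - x| <= e' * r by apply: le_trans s3 _; rewrite ler_wpM2l // ltW.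
have A2 : `|c - 1| <= e' * r by apply: le_trans s2 _; rewrite ler_wpM2l // ltW.
have A3 : `|s - y| <= e' * r by apply: le_trans s1 _; rewrite ler_wpM2l // ltW.
have A4 : `|c| <= 1 by rewrite ler_norml cos_geN1 cos_le1.
have A5 : `|1 + x| <= 2 by apply: le_trans (ler_normD _ _) _; rewrite normr1; lra.
have A6 : `|E - 1| <= 2 * r.
  have -> : E - 1 = (E - 1 - x) + x by ring.
  by apply: le_trans (ler_normD _ _) _; nra.
have A7 : `|s| <= 2 * r.
  have -> : s = (s - y) + y by ring.
  by apply: le_trans (ler_normD _ _) _; nra.
have B1 : `|(E - 1 - x) * c| <= e' * r.
  by rewrite normrM -[leRHS]mulr1 ler_pM.
have B2 : `|(1 + x) * (c - 1)| <= 2 * (e' * r) by rewrite normrM ler_pM.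
have B3 : `|(E - 1) * s| <= (2 * r) * (2 * r) by rewrite normrM ler_pM.
apply: le_trans (lerD (ler_normD _ _) (ler_normD _ _)) _.
by nra.
Qed.

Lemma isd_cexp w : isd cexp w (fun u => cexp w * u).
Proof.
split.
- by move=> k u v; rewrite /GRing.scale /=; ring.
- by exists (rn (cexp w)) => u; rewrite rnM.
move=> e e0; have k0 : 0 < rn (cexp w) + 1 by rewrite ltr_wpDl ?rn_ge0.
have [d d0 hd] := cexp_small (divr_gt0 e0 k0).
exists d => // u /hd h; rewrite cexpD.
have -> : cexp w * cexp u - cexp w - cexp w * u = cexp w * (cexp u - 1 - u) by ring.
rewrite rnM; apply: le_trans (ler_wpM2l (rn_ge0 _) h) _.
rewrite mulrA ler_wpM2r ?rn_ge0 // mulrA ler_pdivrMr // mulrC ler_wpM2l ?lerDl //.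
exact: ltW.
Qed.

Definition twopii : K := 0 +i* (pi + pi).

Lemma twopii_neq0 : twopii != 0.
Proof. by rewrite eq_complex /= negb_and orbC gt_eqF // addr_gt0 // pi_gt0. Qed.

Lemma cexp_twopii w : cexp (w + twopii) = cexp w.
Proof.
case: w => a b; rewrite /cexp /= addr0 addrA cosDpi sinDpi cosDpi sinDpi.
by rewrite !opprK.
Qed.

Definition ei (t : R) : K := cexp ((t%:C : K) *: twopii).

Lemma rn_ei t : rn (ei t) = 1.
Proof. by rewrite /ei rn_cexp /= mulr0 mul0r subrr expR0. Qed.

Lemma isd_shift (f : K -> K) (x p : K) L : isd f (x + p) L -> isd (fun w => f (w + p)) x L.
Proof.
move=> [l b h]; split=> // e e0; have [d d0 hd] := h e e0; exists d => // u /hd.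
by rewrite (addrAC x p u).
Qed.

Lemma isdB (V W : normedModType K) (f g : V -> W) x L M : isd f x L -> isd g x M ->
  isd (fun z => f z - g z) x (fun u => L u - M u).
Proof.
move=> /isdP[df dL] /isdP[dg dM]; apply/isdP; split; first exact: differentiableB.
by rewrite -dL -dM; exact: diffB.
Qed.

(** The primitive [H] of [k o exp] on the half-plane changes by a constant under
    [w |-> w + 2 i pi]; this constant is read off as [Re w -> -oo]. *)
Lemma mean_value (k : K -> K) (r : R) : {for 0, continuous k} ->
  (forall s, 0 < rn s < 1 -> differentiable k s) -> 0 < r < 1 ->
  ccont (fun t => k ((r%:C : K) * ei t)) /\ int01 (fun t => k ((r%:C : K) * ei t)) = k 0.
Proof.
move=> ck dk /andP[r0 r1].
have cn (w : K) : complex.Re w < 0 -> 0 < rn (cexp w) < 1.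
  by move=> w0; rewrite rn_cexp expR_gt0 -expR0 ltr_expR.
pose G w := k (cexp w).
have dG (w : K) : complex.Re w < 0 -> differentiable G w.
  move=> w0; apply: (@differentiable_comp _ _ _ _ cexp k); first exact: isd_diff (isd_cexp w).
  exact: dk (cn _ w0).
have [H hH] := half_plane_primitive dG.
have shift w (t : R) : complex.Re (w + (t%:C : K) *: twopii) = complex.Re w.
  by case: w => a b /=; rewrite mulr0 mul0r subrr addr0.
have JG (w : K) : complex.Re w < 0 ->
  ccont (fun t : R => G (w + (t%:C : K) *: twopii)) /\
  int01 (fun t : R => G (w + (t%:C : K) *: twopii)) = twopii^-1 * (H (w + twopii) - H w).
  move=> w0.
  have hc : antider (fun t : R => G (w + (t%:C : K) *: twopii))
         (fun t : R => twopii^-1 * H (w + (t%:C : K) *: twopii)).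
    move=> t t01; have wt : complex.Re (w + (t%:C : K) *: twopii) < 0 by rewrite shift.
    apply: (@rder_val _ _ _ (twopii^-1 * (G (w + (t%:C : K) *: twopii) * twopii))).
      by rewrite mulrC mulfK // twopii_neq0.
    by apply: rderZ; have h := hH _ wt; have := rder_seg (isd_diff h); rewrite (isd_val h).
  split; last first.
    by rewrite (int01_val hc) rmorph1 rmorph0 scale1r scale0r addr0 mulrBr.
  move=> t t01; apply: rcont_seg; apply: differentiable_continuous.
  by apply: dG; rewrite shift.
have const (w v : K) : complex.Re w < 0 -> complex.Re v < 0 ->
    H (w + twopii) - H w = H (v + twopii) - H v.
  move=> w0 v0; apply/eqP; rewrite -subr_eq0; apply/eqP; apply: rn_le0.
  apply: (@mean_value_le_seg R _ (fun z => H (z + twopii) - H z) v w 0) => t t01.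
  set z := v + _; have z0 : complex.Re z < 0.
    by move: t01 => /andP[t0 t1]; rewrite /z Re_line; nra.
  have zp : complex.Re (z + twopii) < 0.
    by rewrite -[twopii]scale1r -[1](rmorph1 (real_complex R)) shift.
  have h1 := isd_shift (hH _ zp); have h2 := hH _ z0.
  have d := isdB h1 h2; split; first exact: isd_diff d.
  rewrite (isd_val d). rewrite /G cexp_twopii. by rewrite -mulrBl subrr mul0r rn0.
have JK (w : K) : complex.Re w < 0 -> int01 (fun t : R => G (w + (t%:C : K) *: twopii)) = k 0.
  move=> w0; apply/eqP; rewrite -subr_eq0; apply/eqP; apply: rn_le0.
  apply/ler_addgt0Pr => e e0; rewrite add0r.
  have [d d0 hd] := proj1 (contE _ _) ck e e0.
  (* Far enough to the left for the circle of radius [expR (Re v)] to lie within [d] of [0]; the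
     bound [2^-1] makes [Re v] negative. *)
  pose v : K := ((ln (Num.min d 2^-1) - 1)%:C).
  have m0 : 0 < Num.min d 2^-1 by rewrite lt_min d0 invr_gt0 ltr0n.
  have vd : expR (complex.Re v) < Num.min d 2^-1.
    by rewrite /v /= -[ltRHS]lnK ?posrE // ltr_expR; lra.
  have v0 : complex.Re v < 0.
    rewrite -ltr_expR expR0; apply: lt_le_trans vd _; rewrite ge_min; apply/orP; right.
    by lra.
  have [_ ->] := JG w w0; rewrite (const w v) // ; have [coord_vec <-] := JG v v0.
  rewrite -[k 0]int01_cst -int01B //; last by move=> t _; exact: rcont_cst.
  apply: int01_bound.
    move=> t t01; apply: rcontD; [exact: coord_vec|exact: rcont_cst].
  move=> t t01; apply: ltW; apply: hd; rewrite subr0 rn_cexp shift.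
  by apply: lt_le_trans vd _; rewrite ge_min lexx.
have lr0 : complex.Re ((ln r)%:C : K) < 0 by rewrite /= ln_lt0 // r0.
have E : (fun t => k ((r%:C : K) * ei t)) = (fun t : R => G (((ln r)%:C : K) + (t%:C : K) *: twopii)).
  apply: funext => t; rewrite /G cexpD; congr (k (_ * _)).
  by rewrite /cexp /= lnK ?posrE // cos0 sin0 /=; congr (_ +i* _); ring.
by rewrite E; split; [have [] := JG _ lr0|exact: JK].
Qed.

End MeanValue.

(** * Cauchy's formula and the identity theorem *)

Section Cauchy.
Variable R : realType.
Local Notation K := (C R).

Lemma isd_comp (U V W : normedModType K) (f : U -> V) (g : V -> W) x L M :
  isd f x L -> isd g (f x) M -> isd (fun z => g (f z)) x (fun u => M (L u)).
Proof.
move=> /isdP[df dL] /isdP[dg dM]; apply/isdP; split; first exact: differentiable_comp.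
by rewrite -dL -dM; exact: diff_comp.
Qed.

Lemma isd_line (V : normedModType K) (z v : V) (s : K) :
  isd (fun s : K => z + s *: v) s (fun t => t *: v).
Proof.
split; first by move=> k u w /=; rewrite scalerDl scalerA.
  by exists (rn v) => u; rewrite rnZ mulrC.
move=> e e0; exists 1 => // u _.
rewrite scalerDl addrA [_ + u *: v]addrC addrK subrr rn0.
by rewrite mulr_ge0 ?rn_ge0 // ltW.
Qed.

Lemma isd_translate (V W : normedModType K) (f : V -> W) (x p : V) L :
  isd f (p + x) L -> isd (fun w => f (p + w)) x L.
Proof.
move=> [l b h]; split=> // e e0; have [d d0 hd] := h e e0; exists d => // u /hd.
by rewrite (addrA p x u).
Qed.

Definition circ (t : R) : K := ((2^-1 : R)%:C : K) * ei t.

Lemma rn_circ t : rn (circ t) = 2^-1.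
Proof. by rewrite /circ rnM rn_ei mulr1 rnRge ?invr_ge0. Qed.

Lemma circ_neq0 t : circ t != 0.
Proof.
by apply/eqP => h; have := rn_circ t; rewrite h rn0 => /esym/eqP; rewrite invr_eq0 pnatr_eq0.
Qed.

Lemma rcont_circ t : rcont circ t.
Proof.
apply: rcontZ.
have -> : @ei R = (fun t : R => cexp (0 + (t%:C : K) *: twopii R)).
  by apply: funext => s; rewrite add0r.
by apply: rcont_seg; apply: differentiable_continuous; exact: isd_diff (isd_cexp _).
Qed.

Definition on_disc (P : K -> Prop) := forall s : K, rn s <= 2^-1 -> P s.

(** A continuous linear functional that computes [g'(0)] for [g] holomorphic in
    the unit disc, but makes sense for continuous [g]. *)
Definition cauchy_kernel (g : K -> K) (t : R) : K := (circ t)^-1 * (g (circ t) - g 0).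
Definition cauchy_fun (g : K -> K) : K := int01 (cauchy_kernel g).

Lemma ccont_kernel g : on_disc (fun s => {for s, continuous g}) -> ccont (cauchy_kernel g).
Proof.
move=> cg t _ e e0.
have c : {for circ t, continuous (fun s : K => s^-1 * (g s - g 0))}.
  apply: (@continuousM _ _ (fun s : K => s^-1) (fun s => g s - g 0)).
    by apply: inv_continuous; exact: circ_neq0.
  apply: (@continuousB _ _ _ g (fun=> g 0)); last exact: cst_continuous.
  by apply: cg; rewrite rn_circ.
have [d d0 hd] := proj1 (contE _ _) c e e0.
have [d' d'0 hd'] := @rcont_circ t d d0.
by exists d' => // s /hd' /hd.
Qed.

Lemma cauchy_funB f g : on_disc (fun s => {for s, continuous f}) ->
  on_disc (fun s => {for s, continuous g}) ->
  cauchy_fun (fun s => f s - g s) = cauchy_fun f - cauchy_fun g.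
Proof.
move=> cf cg; rewrite /cauchy_fun -(int01B (ccont_kernel cf) (ccont_kernel cg)).
by congr int01; apply: funext => t; rewrite /cauchy_kernel; move: (circ t) => c; ring.
Qed.

Lemma cauchy_funZD f g (k : K) : on_disc (fun s => {for s, continuous f}) ->
  on_disc (fun s => {for s, continuous g}) ->
  cauchy_fun (fun s => k * f s + g s) = k * cauchy_fun f + cauchy_fun g.
Proof.
move=> cf cg; rewrite /cauchy_fun -(int01Z k (ccont_kernel cf)) -(int01D (ccontZ k (ccont_kernel cf)) (ccont_kernel cg)).
by congr int01; apply: funext => t; rewrite /cauchy_kernel; move: (circ t) => c; ring.
Qed.

(** The circle has radius [2^-1]: a factor [2] comes from the inverse of [circ t], and [2 * M] from
    the difference. *)
Lemma cauchy_fun_bound g (M : R) : on_disc (fun s => {for s, continuous g}) ->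
  on_disc (fun s => rn (g s) <= M) -> rn (cauchy_fun g) <= 4 * M.
Proof.
move=> cg bg; apply: int01_bound; first exact: ccont_kernel.
move=> t _; rewrite /cauchy_kernel rnM rnV rn_circ invrK.
have h1 : rn (g (circ t)) <= M by apply: bg; rewrite rn_circ.
have h2 : rn (g 0) <= M by apply: bg; rewrite rn0 invr_ge0.
by have := rnB (g (circ t)) (g 0); lra.
Qed.

(** The difference quotient [k] is continuous at [0] and differentiable elsewhere in the disc. As
    [mean_value] asks for no more, no removable singularity has to be treated first. *)
Lemma cauchy_formula g : (forall s, rn s < 1 -> differentiable g s) ->
  cauchy_fun g = 'd g 0 1.
Proof.
move=> dg; pose k s := if s == 0 then 'd g 0 1 else s^-1 * (g s - g 0).
have dg0 : differentiable g 0 by apply: dg; rewrite rn0.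
have r01 : 0 < (2^-1 : R) < 1 by rewrite invr_gt0 ltr0n invf_lt1 ?ltr0n ?ltr1n.
have ck : {for 0, continuous k}.
  apply/contE => e e0; have e2 : 0 < e / 2 by rewrite divr_gt0.
  have [_ _ h] := diff_isd dg0; have [d d0 hd] := h _ e2.
  exists d => // s; rewrite subr0 => /hd; rewrite add0r /k eqxx.
  case: eqP => [_ _|/eqP s0 hs]; first by rewrite subrr rn0.
  have -> : s^-1 * (g s - g 0) - 'd g 0 1 = s^-1 * (g s - g 0 - 'd g 0 s).
    have -> : 'd g 0 s = s * 'd g 0 1 by rewrite -[in LHS](mulr1 s) -[s * 1]/(s *: 1) linearZ.
    by rewrite [RHS]mulrBr mulKf.
  have rs : 0 < rn s by rewrite lt_def rn_ge0 andbT; apply: contra_neq s0; exact: rn_eq0.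
  rewrite rnM rnV mulrC ltr_pdivrMr //; apply: le_lt_trans hs _.
  by rewrite ltr_pM2r // ltr_pdivrMr // ltr_pMr // ltr1n.
have dk s : 0 < rn s < 1 -> differentiable k s.
  move=> /andP[s0 s1]; apply: (@near_diff _ _ _ (fun s : K => s^-1 * (g s - g 0) : K)).
    apply/near_rnP; exists (rn s) => // z hz; rewrite /k.
    case: eqP => // z0; move: hz; rewrite z0 sub0r rnN ltxx //.
  have sn0 : s != 0 by apply: contraTneq s0 => ->; rewrite rn0 ltxx.
  apply: (@differentiableM _ _ (fun s : K => s^-1) (fun s => g s - g 0)).
    exact: differentiable_Rinv.
  apply: (@differentiableB _ _ _ g (fun=> g 0)); last exact: differentiable_cst.
  exact: dg.
have [_ kE] := mean_value ck dk r01.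
have -> : 'd g 0 1 = k 0 by rewrite /k eqxx.
rewrite -kE /cauchy_fun; congr int01; apply: funext => t.
by rewrite /cauchy_kernel /k -/(circ t) (negbTE (circ_neq0 t)).
Qed.

Section Dir.
Variable V : normedModType K.
Implicit Types (h : V -> K) (z a u v w : V).

Lemma isd_restrict_line h z v (s : K) : differentiable h (z + s *: v) ->
  isd (fun s : K => h (z + s *: v)) s (fun t => t * 'd h (z + s *: v) v).
Proof.
move=> /diff_isd dh; have := isd_comp (isd_line z v s) dh.
by congr isd; apply: funext => t; rewrite linearZ.
Qed.

Lemma cauchy_dir h z v : (forall s : K, rn s < 1 -> differentiable h (z + s *: v)) ->
  'd h z v = cauchy_fun (fun s => h (z + s *: v)).
Proof.
move=> dh; rewrite cauchy_formula.
  have d0 : differentiable h (z + (0 : K) *: v) by apply: dh; rewrite rn0.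
  by rewrite (isd_val (isd_restrict_line d0)) mul1r scale0r addr0.
by move=> s /dh/isd_restrict_line/isd_diff.
Qed.

Lemma linZ h z (k : K) v : 'd h z (k *: v) = k * 'd h z v.
Proof. by rewrite linearZ. Qed.

Lemma disc_lt1 (s : K) : rn s <= 2^-1 -> rn s < 1.
Proof. by move=> h; apply: le_lt_trans h _; rewrite invf_lt1 ?ltr0n ?ltr1n. Qed.

Lemma cauchy_estimate h z (r B : R) : 0 < r ->
  (forall w, rn (w - z) < r -> differentiable h w) ->
  (forall w, rn (w - z) < r -> rn (h w) <= B) ->
  forall v, rn ('d h z v) <= 4 * B / r * rn v.
Proof.
move=> r0 dh bh v.
have [/rn_eq0 ->|v0] := eqVneq (rn v) 0; first by rewrite linear0 !rn0 mulr0.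
have rv : 0 < rn v by rewrite lt_def v0 rn_ge0.
(* Rescales [v] to length [r], so that [z + s *: (k *: v)] stays in the ball for [rn s < 1]. *)
pose k : K := (r / rn v)%:C; have rk : rn k = r / rn v by rewrite rnRge // divr_ge0 // ltW.
have kn : k != 0 by apply/eqP => k0; move: rk; rewrite k0 rn0 => /esym/eqP; rewrite gt_eqF // divr_gt0.
have inb (s : K) : rn s < 1 -> rn (z + s *: (k *: v) - z) < r.
  move=> s1; rewrite [z + _]addrC addrK 2!rnZ rk divfK //.
  by rewrite -[ltRHS]mul1r ltr_pM2r.
have E : 'd h z v = k^-1 * 'd h z (k *: v) by rewrite linZ mulKf.
rewrite E rnM rnV rk invf_div cauchy_dir; last by move=> s /inb/dh.
have : rn (cauchy_fun (fun s => h (z + s *: (k *: v)))) <= 4 * B.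
  apply: cauchy_fun_bound => s /disc_lt1/inb hs; last exact: bh.
  apply: differentiable_continuous.
  exact: isd_diff (isd_restrict_line (dh _ hs)).
move=> hB; have q0 : 0 <= rn v / r by rewrite divr_ge0 // ltW.
apply: le_trans (ler_wpM2l q0 hB) _.
by rewrite le_eqVlt; apply/orP; left; apply/eqP; ring.
Qed.

Lemma ball_cvx a (r : R) z w (t : R) : rn (z - a) < r -> rn (w - a) < r -> 0 <= t <= 1 ->
  rn (z + (t%:C : K) *: (w - z) - a) < r.
Proof.
move=> hz hw /andP[t0 t1].
have -> : z + (t%:C : K) *: (w - z) - a = ((1 - t)%:C : K) *: (z - a) + (t%:C : K) *: (w - a).
  rewrite rmorphB rmorph1 scalerBl scale1r -[RHS]addrA [X in _ = _ + X]addrC -[X in _ = _ + X]scalerBr.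
  by rewrite opprB addrA subrK addrAC.
apply: le_lt_trans (rnD _ _) _; rewrite !rnZ !rnRge //.
  move: (rn (z - a)) (rn (w - a)) hz hw => x y hx hy.
  have hm : Num.max x y < r by rewrite gt_max hx.
  have h1 : (1 - t) * x <= (1 - t) * Num.max x y by rewrite ler_wpM2l ?le_max ?lexx // subr_ge0.
  have h2 : t * y <= t * Num.max x y by rewrite ler_wpM2l ?le_max ?lexx ?orbT.
  by lra.
by lra.
Qed.

Section Bounds.
Variables (h : V -> K) (a : V) (r B : R).
Hypotheses (r0 : (0 : R) < r) (dh : forall z, rn (z - a) < 4 * r -> differentiable h z)
  (bh : forall z, rn (z - a) < 4 * r -> rn (h z) <= B).
(** Each Cauchy estimate uses up a collar of width [r]: [h] is bounded within [4 * r] of [a], its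
    differential is bounded by [B1] within [3 * r], and it is [B2]-Lipschitz within [2 * r]. *)
Let B1 := 4 * B / r.
Let B2 := 4 * B1 / r.

Lemma B_ge0 : 0 <= B.
Proof.
have rr := r0.
have h4 : rn (a - a) < 4 * r by rewrite subrr rn0 mulr_gt0.
exact: le_trans (rn_ge0 _) (bh h4).
Qed.

Lemma B1_ge0 : 0 <= B1. Proof. by apply: divr_ge0; [apply: mulr_ge0 => //; exact: B_ge0|exact: ltW]. Qed.
Lemma B2_ge0 : 0 <= B2. Proof. by apply: divr_ge0; [apply: mulr_ge0 => //; exact: B1_ge0|exact: ltW]. Qed.

Lemma d_bound z v : rn (z - a) < 3 * r -> rn ('d h z v) <= B1 * rn v.
Proof.
have rr := r0.
move=> hz; apply: cauchy_estimate => // w hw; [apply: dh|apply: bh];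
  by apply: le_lt_trans (rn_tri z _ _) _; lra.
Qed.

Lemma h_lip z w : rn (z - a) < 3 * r -> rn (w - a) < 3 * r ->
  rn (h w - h z) <= B1 * rn (w - z).
Proof.
have rr := r0.
move=> hz hw; apply: mean_value_le_seg => t t01; have hb := ball_cvx hz hw t01.
by split; [apply: dh; lra | exact: d_bound].
Qed.

(** Cauchy's estimate for [x |-> h (z + x) - h (w + x)], which [h_lip] bounds by [B1 * rn (z - w)]
    when [rn x < r]. *)
Lemma d_lip z w v : rn (z - a) < 2 * r -> rn (w - a) < 2 * r ->
  rn ('d h z v - 'd h w v) <= B2 * rn (z - w) * rn v.
Proof.
have rr := r0.
move=> hz hw.
have sm (y x : V) (s : R) : rn (y - a) < s -> rn (x - 0) < r -> rn (y + x - a) < s + r.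
  by rewrite subr0 => h1 h2; rewrite addrAC; apply: le_lt_trans (rnD _ _) _; lra.
have D x : rn (x - 0) < r -> isd (fun x => h (z + x) - h (w + x)) x
    (fun u => 'd h (z + x) u - 'd h (w + x) u).
  by move=> hx; apply: isdB; apply: isd_translate; apply: diff_isd; apply: dh;
   [have := sm _ _ _ hz hx|have := sm _ _ _ hw hx]; lra.
have D0 : isd (fun x => h (z + x) - h (w + x)) 0 (fun u => 'd h z u - 'd h w u).
  have := D 0; rewrite !addr0; apply; by rewrite subr0 rn0.
have := @cauchy_estimate (fun x => h (z + x) - h (w + x)) 0 r (B1 * rn (z - w)) r0.
move=> ce; have := ce _ _ v; rewrite (isd_val D0) => ce'.
apply: le_trans (ce' _ _) _.
- by move=> x /D/isd_diff.
- move=> x hx; apply: le_trans (h_lip _ _) _.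
  + by have := sm _ _ _ hw hx; lra.
  + by have := sm _ _ _ hz hx; lra.
  by rewrite opprD addrACA subrr addr0.
by rewrite /B2 le_eqVlt; apply/orP; left; apply/eqP; ring.
Qed.

Lemma h_taylor z w : rn (z - a) < 2 * r -> rn (w - a) < 2 * r ->
  rn (h w - h z - 'd h z (w - z)) <= B2 * rn (w - z) ^+ 2.
Proof.
have rr := r0.
move=> hz hw.
have dz : differentiable h z by apply: dh; lra.
have D x : rn (x - a) < 2 * r -> isd (fun x => h x - 'd h z x) x
    (fun u => 'd h x u - 'd h z u).
  move=> hx; apply: isdB; first by apply: diff_isd; apply: dh; lra.
  have [l b _] := diff_isd dz; split=> // e e0; exists 1 => // u _.
  have -> : 'd h z (x + u) - 'd h z x - 'd h z u = 0.
    by rewrite linearD /=; move: ('d h z x) ('d h z u) => p q; ring.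
  by rewrite rn0 mulr_ge0 ?rn_ge0 // ltW.
have -> : h w - h z - 'd h z (w - z) = (h w - 'd h z w) - (h z - 'd h z z).
  by rewrite linearB /=; move: ('d h z w) ('d h z z) (h w) (h z) => p q p' q'; ring.
apply: (@mean_value_le_seg _ _ (fun x => h x - 'd h z x)) => t t01.
have hb := ball_cvx hz hw t01; have Dx := D _ hb.
split; first exact: isd_diff Dx.
rewrite (isd_val Dx); apply: le_trans (d_lip _ hb hz) _.
rewrite expr2 [leRHS]mulrA ler_wpM2r ?rn_ge0 // ler_wpM2l ?B2_ge0 //.
rewrite [z + _]addrC addrK rnZ; case/andP: t01 => t0 t1; rewrite rnRge //.
by rewrite -[leRHS]mul1r ler_wpM2r ?rn_ge0.
Qed.

(** By [cauchy_dir], ['d h z v] is [cauchy_fun] of [h] along [s |-> z + s *: v]. Taylor's estimate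
    is uniform on the disc, so differentiation passes under the functional. A short [v] keeps the
    disc in the domain; [isd_d_any] reaches all [v] by homogeneity. *)
Lemma isd_d_small z v : rn (z - a) < r -> rn v < r ->
  isd (fun z => 'd h z v) z (fun u => cauchy_fun (fun s => 'd h (z + s *: v) u)).
Proof.
have rr := r0.
move=> hz hv.
have inb y (s : K) : rn (y - a) < 3 / 2 * r -> rn s <= 2^-1 -> rn (y + s *: v - a) < 2 * r.
  move=> hy hs; rewrite addrAC; apply: le_lt_trans (rnD _ _) _; rewrite rnZ.
  have : rn s * rn v <= 2^-1 * r by apply: ler_pM; rewrite ?rn_ge0 // ltW.
  by lra.
have inb1 y (s : K) : rn (y - a) < 3 / 2 * r -> rn s < 1 -> rn (y + s *: v - a) < 4 * r.
  move=> hy hs; rewrite addrAC; apply: le_lt_trans (rnD _ _) _; rewrite rnZ.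
  have : rn s * rn v <= 1 * r by apply: ler_pM; rewrite ?rn_ge0 // ltW.
  by lra.
have hz2 : rn (z - a) < 3 / 2 * r by lra.
have cd u : on_disc (fun s => {for s, continuous (fun s : K => 'd h (z + s *: v) u)}).
  move=> s hs; apply/contE => e e0.
  pose c := B2 * rn v * rn u + 1.
  have c0 : 0 < c.
    by apply: ltr_wpDl => //; do 2 (apply: mulr_ge0; last exact: rn_ge0); exact: B2_ge0.
  have [d d0 hd] : exists2 d : R, 0 < d & forall s', rn (s' - s) < d -> rn (z + s' *: v - a) < 2 * r.
    have := inb _ _ hz2 hs; rewrite -subr_gt0 => pos.
    have cl := differentiable_continuous (isd_diff (isd_line z v s)).
    have [d d0 hd] := proj1 (contE _ _) cl _ pos.
    exists d => // s' /hd h1; apply: le_lt_trans (rn_tri (z + s *: v) _ _) _; lra.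
  exists (Num.min d (e / c)); first by rewrite lt_min d0 divr_gt0.
  move=> s'; rewrite lt_min ltr_pdivlMr // => /andP[h1 h2].
  apply: le_lt_trans (d_lip u (hd _ h1) (inb _ _ hz2 hs)) _.
  rewrite opprD addrACA subrr add0r -scalerBl rnZ.
  apply: le_lt_trans h2; rewrite /c.
  by have := rn_ge0 (s' - s); nra.
have ch y : rn (y - a) < 3 / 2 * r -> on_disc (fun s => {for s, continuous (fun s : K => h (y + s *: v))}).
  move=> hy s hs; apply: differentiable_continuous.
  by apply: isd_diff (isd_restrict_line _); apply: dh; have := inb _ _ hy hs; lra.
split.
- move=> k u w; rewrite /= -cauchy_funZD //.
  by congr cauchy_fun; apply: funext => s; rewrite linearP.
- exists (4 * B1) => u; rewrite -mulrA; apply: cauchy_fun_bound => // s hs.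
  by apply: d_bound; have := inb _ _ hz2 hs; lra.
move=> e e0; pose c := 4 * B2 + 1.
have c0 : 0 < c by have := B2_ge0; rewrite /c; lra.
exists (Num.min (r / 2) (e / c)); first by rewrite lt_min !divr_gt0.
move=> u; rewrite lt_min => /andP[u1]; rewrite ltr_pdivlMr // => u2.
have hzu : rn (z + u - a) < 3 / 2 * r.
  by rewrite addrAC; apply: le_lt_trans (rnD _ _) _; lra.
rewrite !cauchy_dir; [|by move=> s hs; apply: dh; exact: inb1..].
have cB : on_disc (fun s => {for s, continuous (fun s : K => h (z + u + s *: v) - h (z + s *: v))}).
  by move=> s hs; apply: continuousB; [exact: (ch _ hzu s hs)|exact: (ch _ hz2 s hs)].
rewrite -(cauchy_funB (ch _ hzu) (ch _ hz2)) -(cauchy_funB cB (cd u)).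
apply: le_trans (_ : 4 * (B2 * rn u ^+ 2) <= _); last first.
  have hu : rn u * (rn u * c) <= rn u * e by apply: ler_wpM2l; [exact: rn_ge0|exact: ltW].
  apply: le_trans (_ : rn u * (rn u * c) <= _); last by rewrite [e * _]mulrC.
  have -> : rn u * (rn u * c) = 4 * (B2 * rn u ^+ 2) + rn u ^+ 2 by rewrite /c; ring.
  by rewrite lerDl sqr_ge0.
apply: cauchy_fun_bound => s hs.
  by apply: continuousB; [exact: cB|exact: cd].
have := h_taylor (inb _ _ hz2 hs) (inb _ _ hzu hs).
by rewrite opprD addrACA subrr addr0 [z + u]addrC addrK.
Qed.

Lemma isd_d_any z v : rn (z - a) < r ->
  exists k : K, [/\ k != 0, rn (k *: v) < r & differentiable (fun z => 'd h z v) z].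
Proof.
have rr := r0.
move=> hz; have v0 : 0 < rn v + 1 by rewrite ltr_wpDl ?rn_ge0.
pose k : K := (r / 2 / (rn v + 1))%:C.
have k0 : 0 < r / 2 / (rn v + 1) by rewrite !divr_gt0.
have rk : rn k = r / 2 / (rn v + 1) by rewrite rnRge // ltW.
have kn : k != 0 by apply/eqP => kk; move: k0; rewrite -rk kk rn0 ltxx.
have kv : rn (k *: v) < r.
  rewrite rnZ rk mulrAC ltr_pdivrMr // -mulrA ltr_pM2l //.
  by have := rn_ge0 v; lra.
exists k; split=> //.
have -> : (fun z => 'd h z v) = (fun z => k^-1 * 'd h z (k *: v)).
  by apply: funext => y; rewrite linZ mulKf.
apply: (@differentiableM _ _ (fun=> k^-1) (fun z => 'd h z (k *: v))).
  exact: differentiable_cst.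
exact: isd_diff (isd_d_small hz kv).
Qed.

(** Both sides are [cauchy_fun] of [s |-> 'd h (a + s *: v) u]: the left one by differentiation
    under the functional, the right one by [cauchy_dir]. *)
Lemma d_sym_small u v : rn v < r ->
  'd (fun z => 'd h z v) a u = 'd (fun z => 'd h z u) a v.
Proof.
have rr := r0 => hv; have ha : rn (a - a) < r by rewrite subrr rn0.
apply: etrans (congr1 (fun L : V -> K => L u) (isd_val (isd_d_small ha hv))) _; symmetry.
apply: (@cauchy_dir (fun z => 'd h z u)) => s s1.
have hs : rn (a + s *: v - a) < r.
  rewrite [a + _]addrC addrK rnZ; apply: le_lt_trans hv.
  by rewrite -[leRHS]mul1r ler_wpM2r ?rn_ge0 // ltW.
by have [k []] := isd_d_any u hs.
Qed.

End Bounds.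

Definition holo h a := \forall z \near a, differentiable h z.

Lemma holo_bound h a : holo h a -> exists r B : R, [/\ 0 < r,
  forall z, rn (z - a) < 4 * r -> differentiable h z &
  forall z, rn (z - a) < 4 * r -> rn (h z) <= B].
Proof.
move=> /near_rnP[d d0 hd].
have ca : {for a, continuous h}.
  by apply: differentiable_continuous; apply: hd; rewrite subrr rn0.
have [d' d'0 hd'] := proj1 (contE _ _) ca 1 ltr01.
have E : 4 * (Num.min d d' / 4) = Num.min d d' by rewrite mulrC divfK // pnatr_eq0.
exists (Num.min d d' / 4), (rn (h a) + 1); rewrite E; split.
- by rewrite divr_gt0 ?lt_min ?d0.
- by move=> z; rewrite lt_min => /andP[+ _]; exact: hd.
move=> z; rewrite lt_min => /andP[_ /hd' h1].
by rewrite -[h z](subrK (h a)); apply: le_trans (rnD _ _) _; lra.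
Qed.

Lemma holo_d h a v : holo h a -> holo (fun z => 'd h z v) a.
Proof.
move=> /holo_bound[r [B [r0 dh bh]]]; apply/near_rnP; exists r => // z hz.
by have [k []] := isd_d_any r0 dh bh v hz.
Qed.

Lemma isdZ h x (k : K) L : isd h x L -> isd (fun z => k * h z) x (fun u => k * L u).
Proof.
move=> /isdP[dh dL]; apply/isdP; split; first exact: (@differentiableZ _ _ _ h).
by rewrite -dL; exact: (@diffZ _ _ _ h).
Qed.

Lemma d_sym h a u v : holo h a ->
  'd (fun z => 'd h z v) a u = 'd (fun z => 'd h z u) a v.
Proof.
move=> /holo_bound[r [B [r0 dh bh]]].
have ha : rn (a - a) < r by rewrite subrr rn0.
have [k [kn kv dv]] := isd_d_any r0 dh bh v ha.
have E1 := d_sym_small r0 dh bh u kv.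
have E2 : (fun z => 'd h z (k *: v)) = (fun z => k * 'd h z v).
  by apply: funext => z; rewrite linZ.
have E3 := congr1 (fun L : V -> K => L u) (isd_val (isdZ k (diff_isd dv))).
apply: (mulfI kn); apply: etrans (esym E3) _.
by rewrite -E2; apply: etrans E1 _; exact: linZ.
Qed.

Lemma holo_taylor h a : holo h a -> exists r B : R, [/\ 0 < r, 0 <= B,
  (forall z, rn (z - a) < r -> differentiable h z),
  (forall z w v, rn (z - a) < r -> rn (w - a) < r ->
    rn ('d h z v - 'd h w v) <= B * rn (z - w) * rn v) &
  (forall z w, rn (z - a) < r -> rn (w - a) < r ->
    rn (h w - h z - 'd h z (w - z)) <= B * rn (w - z) ^+ 2)].
Proof.
move=> /holo_bound[r [B [r0 dh bh]]].
exists r, (4 * (4 * B / r) / r); split=> //; first exact: (B2_ge0 r0 bh).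
- by move=> z hz; apply: dh; lra.
- by move=> z w v hz hw; apply: (d_lip r0 dh bh); lra.
by move=> z w hz hw; apply: (h_taylor r0 dh bh); lra.
Qed.

End Dir.
End Cauchy.

(** * Row vectors with the supremum norm *)

Section RowNorm.
Variable R : realType.
Local Notation K := (C R).

Lemma rn_row_lt n (v : 'rV[K]_n) (e : R) : 0 < e ->
  rn v < e <-> forall i, rn (v 0 i) < e.
Proof.
move=> e0; have e0' : 0 < (e%:C : K) by rewrite ltcR.
have bE : rn v < e <-> ball (0 : 'rV[K]_n) (e%:C : K) v.
  by rewrite mx_norm_ball /ball_ /= sub0r normrN -ltcR -normE.
have bE1 (k : K) : rn k < e <-> ball (0 : K) (e%:C : K) k.
  by rewrite -ball_normE /= sub0r normrN -ltcR -normE.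
rewrite bE; split=> [h i|h].
  by apply/bE1; have := h.2 0 i; rewrite mxE.
by split=> // i j; rewrite ord1 mxE; apply/bE1.
Qed.

Lemma rn_coord n (v : 'rV[K]_n) i : rn (v 0 i) <= rn v.
Proof.
apply/ler_addgt0Pr => e e0; apply: ltW; apply: (proj1 (rn_row_lt _ _)); last by rewrite ltrDl.
by rewrite ltr_wpDl ?rn_ge0.
Qed.

Lemma rn_row_le n (v : 'rV[K]_n) (M : R) : 0 <= M -> (forall i, rn (v 0 i) <= M) -> rn v <= M.
Proof.
move=> M0 h; apply/ler_addgt0Pr => e e0; apply: ltW.
apply: (proj2 (rn_row_lt v (_ : 0 < M + e))); first by rewrite ltr_wpDl.
by move=> i; apply: le_lt_trans (h i) _; rewrite ltrDl.
Qed.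

Lemma isd_row (V : normedModType K) n (F : V -> 'rV[K]_n) x (L : 'I_n -> V -> K) :
  (forall i, isd (fun z => F z 0 i) x (L i)) -> isd F x (fun u => \row_i L i u).
Proof.
move=> h; split.
- by move=> k u v; apply/rowP => i; have [l _ _] := h i; rewrite !mxE l.
- have /choice[M hM] : forall i, exists M : R, forall u, rn (L i u) <= M * rn u.
    by move=> i; have [_ [M hM] _] := h i; exists M.
  exists (\sum_i `|M i|) => u; have S0 : 0 <= \sum_i `|M i| by apply: sumr_ge0.
  apply: rn_row_le; first by rewrite mulr_ge0 ?rn_ge0.
  move=> i; rewrite mxE; apply: le_trans (hM i u) _; rewrite ler_wpM2r ?rn_ge0 //.
  apply: le_trans (ler_norm _) _; rewrite (bigD1 i) //= lerDl; exact: sumr_ge0.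
move=> e e0.
have /choice[d hd] : forall i, exists d : R, 0 < d /\ forall u, rn u < d ->
   rn (F (x + u) 0 i - F x 0 i - L i u) <= e * rn u.
  by move=> i; have [_ _ k] := h i; have [d] := k e e0; exists d.
have [m m0 hm] : exists2 m : R, 0 < m & forall i, m <= d i.
  have H (s : seq 'I_n) : exists2 m : R, 0 < m & forall i, i \in s -> m <= d i.
    elim: s => [|j s [m m0 IH]]; first by exists 1.
    exists (Num.min m (d j)); first by rewrite lt_min m0; have [] := hd j.
    move=> i; rewrite inE ge_min => /predU1P[->|/IH ->//]; rewrite lexx orbT //.
  by have [m m0 hm] := H (enum 'I_n); exists m => // i; apply: hm; rewrite mem_enum.
exists m => // u um; apply: rn_row_le; first by rewrite mulr_ge0 ?rn_ge0 // ltW.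
move=> i; rewrite !mxE; have [_] := hd i; apply; exact: lt_le_trans um (hm i).
Qed.

Lemma isd_coord n (x : 'rV[K]_n) i : isd (fun z : 'rV[K]_n => z 0 i) x (fun u => u 0 i).
Proof.
split; first by move=> k u v; rewrite !mxE.
  by exists 1 => u; rewrite mul1r rn_coord.
move=> e e0; exists 1 => // u _; rewrite !mxE [_ + u 0 i]addrC addrK subrr rn0.
by rewrite mulr_ge0 ?rn_ge0 // ltW.
Qed.

Lemma isd_row_coord (V : normedModType K) n (F : V -> 'rV[K]_n) x L i :
  isd F x L -> isd (fun z => F z 0 i) x (fun u => L u 0 i).
Proof. by move=> h; have := isd_comp h (isd_coord (F x) i). Qed.

Lemma isd_bounded (V W : normedModType K) (x : V) (L : V -> W) :
  linear L -> (exists M : R, forall u, rn (L u) <= M * rn u) -> isd L x L.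
Proof.
move=> l [M h]; split=> //; first by exists M.
move=> e e0; exists 1 => // u _.
have -> : L (x + u) = L u + L x by have := l 1 x u; rewrite !scale1r [RHS]addrC.
by rewrite addrK subrr rn0 mulr_ge0 ?rn_ge0 // ltW.
Qed.

Lemma mulmx_bound m n (A : 'M[K]_(m, n)) : exists2 M : R, 0 < M &
  forall u : 'rV[K]_m, rn (u *m A) <= M * rn u.
Proof.
exists (1 + \sum_j \sum_i rn (A i j)).
  by rewrite ltr_pwDl // sumr_ge0 // => j _; apply: sumr_ge0 => i _; exact: rn_ge0.
have S0 : 0 <= \sum_j \sum_i rn (A i j).
  by apply: sumr_ge0 => j _; apply: sumr_ge0 => i _; exact: rn_ge0.
move=> u; apply: rn_row_le; first by rewrite mulr_ge0 ?rn_ge0 // addr_ge0.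
move=> j; rewrite mxE; apply: le_trans (rn_sum _ _ _) _.
apply: le_trans (_ : \sum_i rn (A i j) * rn u <= _).
  by apply: ler_sum => i _; rewrite rnM mulrC ler_wpM2l ?rn_ge0 // rn_coord.
rewrite -mulr_suml ler_wpM2r ?rn_ge0 // (bigD1 j) //=.
rewrite addrCA lerDl addr_ge0 // sumr_ge0 // => k _; apply: sumr_ge0 => i _; exact: rn_ge0.
Qed.

Lemma isd_mulmx m n (A : 'M[K]_(m, n)) (x : 'rV[K]_m) :
  isd (fun u : 'rV[K]_m => u *m A) x (fun u => u *m A).
Proof.
apply: isd_bounded; first by move=> k u v; rewrite mulmxDl scalemxAl.
by have [M _ h] := mulmx_bound A; exists M.
Qed.

Lemma row_geom_lim n (u : nat -> 'rV[K]_n) (M : R) :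
  (forall k, rn (u k.+1 - u k) <= M / 2 ^+ k) ->
  exists l, forall k, rn (l - u k) <= 4 * M / 2 ^+ k.
Proof.
move=> h; have M0 : 0 <= M by have := le_trans (rn_ge0 _) (h 0%N); rewrite expr0 divr1.
have /choice[l hl] : forall i, exists l : K, forall k, rn (l - u k 0 i) <= 4 * M / 2 ^+ k.
  move=> i; apply: geom_lim => k; apply: le_trans (h k).
  by have := rn_coord (u k.+1 - u k) i; rewrite !mxE.
exists (\row_i l i) => k; apply: rn_row_le.
  by rewrite divr_ge0 ?mulr_ge0 // exprn_ge0.
by move=> i; rewrite !mxE.
Qed.

End RowNorm.

(** * Operations on holomorphic functions and maps *)

Section Holo.
Variable R : realType.
Local Notation K := (C R).
Variable V : normedModType K.
Implicit Types (f g : V -> K) (a : V).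

Lemma isdD f g x L M : isd f x L -> isd g x M ->
  isd (fun z => f z + g z) x (fun u => L u + M u).
Proof.
move=> /isdP[df dL] /isdP[dg dM]; apply/isdP; split; first exact: differentiableD.
by rewrite -dL -dM; exact: diffD.
Qed.

Lemma isdM f g x L M : isd f x L -> isd g x M ->
  isd (fun z => f z * g z) x (fun u => f x * M u + g x * L u).
Proof.
move=> /isdP[df dL] /isdP[dg dM]; apply/isdP; split; first exact: differentiableM.
by rewrite -dL -dM; exact: diffM.
Qed.

Lemma isd_cst (k : K) (x : V) : isd (fun=> k) x (fun=> 0).
Proof.
split; first by move=> ? ? ?; rewrite scaler0 addr0.
  by exists 0 => u; rewrite rn0 mul0r.
by move=> e e0; exists 1 => // u _; rewrite subrr subr0 rn0 mulr_ge0 ?rn_ge0 // ltW.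
Qed.

Lemma holo_diff f a : holo f a -> differentiable f a.
Proof. exact: near_self. Qed.

Lemma holo_isd f a : holo f a -> isd f a ('d f a).
Proof. by move=> h; apply: diff_isd; exact: holo_diff. Qed.

Lemma holo_cont f a : holo f a -> {for a, continuous f}.
Proof. by move=> h; apply: differentiable_continuous; exact: holo_diff. Qed.

Lemma holoD f g a : holo f a -> holo g a -> holo (fun z => f z + g z) a.
Proof. by move=> hf hg; apply: filterS2 hf hg => z; exact: differentiableD. Qed.

Lemma holoM f g a : holo f a -> holo g a -> holo (fun z => f z * g z) a.
Proof. by move=> hf hg; apply: filterS2 hf hg => z; exact: differentiableM. Qed.

Lemma holo_cst (k : K) a : holo (fun=> k) a.
Proof. by apply/near_rnP; exists 1 => // z _; exact: isd_diff (isd_cst k z). Qed.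

Lemma holoB f g a : holo f a -> holo g a -> holo (fun z => f z - g z) a.
Proof. by move=> hf hg; apply: filterS2 hf hg => z; exact: differentiableB. Qed.

Lemma holo_sum (I : Type) (r : seq I) (P : pred I) (F : I -> V -> K) a :
  (forall i, holo (F i) a) -> holo (fun z => \sum_(i <- r | P i) F i z) a.
Proof.
move=> h; elim: r => [|i r IH].
  have -> : (fun z => \sum_(i <- [::] | P i) F i z) = (fun=> 0) by apply: funext => z; rewrite big_nil.
  exact: holo_cst.
have [Pi|nPi] := boolP (P i).
  have -> : (fun z => \sum_(i <- i :: r | P i) F i z) = (fun z => F i z + \sum_(i <- r | P i) F i z).
    by apply: funext => z; rewrite big_cons Pi.
  exact: holoD.
have -> // : (fun z => \sum_(i <- i :: r | P i) F i z) = (fun z => \sum_(i <- r | P i) F i z).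
by apply: funext => z; rewrite big_cons (negbTE nPi).
Qed.

Lemma holo_prod (I : Type) (r : seq I) (P : pred I) (F : I -> V -> K) a :
  (forall i, holo (F i) a) -> holo (fun z => \prod_(i <- r | P i) F i z) a.
Proof.
move=> h; elim: r => [|i r IH].
  have -> : (fun z => \prod_(i <- [::] | P i) F i z) = (fun=> 1) by apply: funext => z; rewrite big_nil.
  exact: holo_cst.
have [Pi|nPi] := boolP (P i).
  have -> : (fun z => \prod_(i <- i :: r | P i) F i z) = (fun z => F i z * \prod_(i <- r | P i) F i z).
    by apply: funext => z; rewrite big_cons Pi.
  exact: holoM.
have -> // : (fun z => \prod_(i <- i :: r | P i) F i z) = (fun z => \prod_(i <- r | P i) F i z).
by apply: funext => z; rewrite big_cons (negbTE nPi).
Qed.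

Lemma holo_det n (A : V -> 'M[K]_n) a : (forall i j, holo (fun z => A z i j) a) ->
  holo (fun z => \det (A z)) a.
Proof.
move=> h; rewrite /determinant; apply: holo_sum => s; apply: holoM; first exact: holo_cst.
by apply: holo_prod => i; exact: h.
Qed.

Lemma holo_near_eq f g a : (\forall z \near a, f z = g z) -> holo f a -> holo g a.
Proof.
move=> e h; have ee := nbhs_interior e; apply: filterS2 ee h => z; exact: near_diff.
Qed.

Definition holo_map n (F : V -> 'rV[K]_n) a := forall i, holo (fun z => F z 0 i) a.

Lemma holo_map_isd n (F : V -> 'rV[K]_n) a : holo_map F a -> isd F a ('d F a).
Proof.
move=> h; have := isd_row (fun i => holo_isd (h i)) => hh.
by apply: diff_isd; exact: isd_diff hh.
Qed.

Lemma holo_map_cont n (F : V -> 'rV[K]_n) a : holo_map F a -> {for a, continuous F}.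
Proof. by move=> h; apply: differentiable_continuous; exact: isd_diff (holo_map_isd h). Qed.

Lemma holo_map_d n (F : V -> 'rV[K]_n) a u i : holo_map F a ->
  ('d F a u) 0 i = 'd (fun z => F z 0 i) a u.
Proof.
move=> h; have := isd_row_coord i (holo_map_isd h) => /isd_val E.
exact: esym (congr1 (fun L : V -> K => L u) E).
Qed.

Lemma near_comp n (F : V -> 'rV[K]_n) a (P : 'rV[K]_n -> Prop) :
  {for a, continuous F} -> (\forall w \near F a, P w) -> \forall z \near a, P (F z).
Proof. by move=> c h; exact: c P h. Qed.

End Holo.

Section HoloRow.
Variable R : realType.
Local Notation K := (C R).

Lemma near_all (V : normedModType K) n (P : 'I_n -> V -> Prop) (a : V) :
  (forall i, \forall z \near a, P i z) -> \forall z \near a, forall i, P i z.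
Proof.
move=> h; apply/near_rnP.
have H (s : seq 'I_n) : exists2 e : R, 0 < e & forall z, rn (z - a) < e ->
    forall i, i \in s -> P i z.
  elim: s => [|j s [e e0 IH]]; first by exists 1.
  have [d d0 hd] := proj1 (near_rnP _ _) (h j).
  exists (Num.min e d); first by rewrite lt_min e0.
  move=> z; rewrite lt_min => /andP[/IH h1 /hd h2] i; rewrite inE => /predU1P[->//|].
  exact: h1.
by have [e e0 he] := H (enum 'I_n); exists e => // z /he k i; apply: k; rewrite mem_enum.
Qed.

Lemma holo_comp (V : normedModType K) n (F : V -> 'rV[K]_n) (g : 'rV[K]_n -> K) a :
  holo_map F a -> holo g (F a) -> holo (fun z => g (F z)) a.
Proof.
move=> hF hg; have c := holo_map_cont hF.
have hF' : \forall z \near a, forall i, differentiable (fun z => F z 0 i) z.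
  exact: near_all hF.
apply: filterS2 hF' (near_comp c hg) => z h1 h2.
exact: (@differentiable_comp _ _ _ _ F g z (isd_diff (isd_row (fun i => diff_isd (h1 i)))) h2).
Qed.

Lemma holo_coord n (a : 'rV[K]_n) i : holo (fun z : 'rV[K]_n => z 0 i) a.
Proof. by apply/near_rnP; exists 1 => // z _; exact: isd_diff (isd_coord z i). Qed.

Lemma holo_map_comp (V : normedModType K) n m (F : V -> 'rV[K]_n) (G : 'rV[K]_n -> 'rV[K]_m) a :
  holo_map F a -> holo_map G (F a) -> holo_map (fun z => G (F z)) a.
Proof. by move=> hF hG i; apply: (holo_comp hF (hG i)). Qed.

Lemma holo_map_mulmx (V : normedModType K) n m (F : V -> 'rV[K]_n) (A : 'M[K]_(n, m)) a :
  holo_map F a -> holo_map (fun z => F z *m A) a.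
Proof.
move=> hF; apply: (holo_map_comp (G := fun u => u *m A) hF) => i; apply/near_rnP; exists 1 => // z _.
exact: isd_diff (isd_row_coord i (isd_mulmx A z)).
Qed.

Lemma holo_map_aff n (a b : 'rV[K]_n) : holo_map (fun z => z + b) a.
Proof.
move=> i.
have -> : (fun z : 'rV[K]_n => (z + b) 0 i) = (fun z => z 0 i + b 0 i).
  by apply: funext => z; rewrite mxE.
by apply: holoD; [exact: holo_coord|exact: holo_cst].
Qed.

End HoloRow.

(** * The identity theorem *)

Section Identity.
Variable R : realType.
Local Notation K := (C R).

Lemma nat_le_pow3 m : (m%:R : R) <= 3 ^+ m.
Proof.
elim: m => [|m IH]; first by rewrite expr0 ler01.
have h : 1 <= (3 : R) ^+ m by rewrite exprn_ege1 // ler1n.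
by rewrite exprS -[m.+1]addn1 natrD; lra.
Qed.

Lemma pow_third (x B : R) : 0 <= x -> (forall m : nat, x <= B / 3 ^+ m) -> x <= 0.
Proof.
move=> x0 h; have B0 : 0 <= B by have := h 0%N; rewrite expr0 divr1; exact: le_trans.
rewrite leNgt; apply/negP => xp.
have k0 : 0 < x / (B + 1) by rewrite divr_gt0 // ltr_wpDl.
have := h (Num.truncn (x / (B + 1))^-1).+1; set m := (Num.truncn _).+1 => hm.
have : (x / (B + 1))^-1 < 3 ^+ m.
  exact: lt_le_trans (truncnS_gt _) (nat_le_pow3 m).
rewrite invf_div => h3.
have p3 : 0 < (3 : R) ^+ m by rewrite exprn_gt0.
move: hm h3; rewrite ler_pdivlMr // ltr_pdivrMr // [_ * x]mulrC => h1 h2.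
by have := le_lt_trans h1 (_ : B < B + 1); lra.
Qed.

Lemma diff_expr m (s : K) : differentiable (fun s : K => s ^+ m) s.
Proof.
elim: m => [|m IH].
  have -> : (fun s : K => s ^+ 0) = (fun=> 1) by apply: funext => z; rewrite expr0.
  exact: isd_diff (isd_cst _ _).
have -> : (fun s : K => s ^+ m.+1) = (fun s => s * s ^+ m) by apply: funext => z; rewrite exprS.
exact: isd_diff (isdM (isd_id s) (diff_isd IH)).
Qed.

(** If [g] vanishes near [0], then [g / s ^ m] is holomorphic for all [m]; the
    mean value property on a circle of radius [1/2] about [z] bounds [g z] by
    [B / 3 ^ m]. *)
Lemma vanish_disc (g : K -> K) (B : R) (z : K) :
  (forall s, rn s < 1 -> differentiable g s) -> (forall s, rn s < 1 -> rn (g s) <= B) ->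
  (\forall s \near 0, g s = 0) -> rn z <= 8^-1 -> g z = 0.
Proof.
move=> dg bg /near_rnP[d d0 hd] hz.
have B0 : 0 <= B by apply: le_trans (bg 0 _); rewrite ?rn_ge0 // rn0.
have z1 : rn z < 1 by apply: le_lt_trans hz _; rewrite invf_lt1 ?ltr0n ?ltr1n.
have [->|zn] := eqVneq z 0; first by apply: hd; rewrite subrr rn0.
pose k m (s : K) := (s ^+ m)^-1 * g s.
have dk m s : rn s < 1 -> differentiable (k m) s.
  move=> s1; have [->|sn] := eqVneq s 0.
    apply: (@near_diff _ _ _ (fun=> 0 : K)); last exact: isd_diff (isd_cst _ _).
    by apply/near_rnP; exists d => // w /hd h; rewrite /k h mulr0.
  apply: (@differentiableM _ _ (fun s : K => (s ^+ m)^-1) g); last exact: dg.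
  apply: (@differentiableV _ _ (fun s : K => s ^+ m)); last by rewrite expf_neq0.
  exact: diff_expr.
(* The circle of radius [1/2] about [z] is written [z + q * c] with [q = 3/4] and [rn c = 2/3]:
   [mean_value] needs a radius below [1], and [z + q * s] must stay in the unit disc for
   [rn s < 1]. *)
have r34 : 0 < (3 / 4 : R) by lra.
have r23 : 0 < (2 / 3 : R) < 1 by lra.
pose q : K := (3 / 4 : R)%:C.
have inb s : rn s < 1 -> rn (z + q * s) < 1.
  move=> s1; apply: le_lt_trans (rnD _ _) _; rewrite rnM /q rnRge ?ltW //.
  by have := rn_ge0 s; lra.
have kz m : rn (k m z) <= B * (8 / 3) ^+ m.
  pose f s := k m (z + q * s).
  have df s : rn s < 1 -> differentiable f s.
    move=> s1; have dq : isd (fun s : K => z + q * s) s (fun u => q * u).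
      by have := isdD (isd_cst z s) (isdZ q (isd_id s)); congr isd; apply: funext => u; rewrite add0r.
    exact: isd_diff (isd_comp dq (diff_isd (dk m _ (inb s s1)))).
  have f0 : {for 0, continuous f} by apply: differentiable_continuous; apply: df; rewrite rn0.
  have [cc] := mean_value f0 (fun s h => df s (proj2 (andP h))) r23.
  have -> : f 0 = k m z by rewrite /f mulr0 addr0.
  move=> <-; apply: int01_bound => // t _; rewrite /f /k.
  move: (ei t) (rn_ei t) => e e1.
  have [c cE] : exists c : K, c = ((2 / 3 : R)%:C : K) * e by eexists.
  rewrite -cE; have c23 : rn c = 2 / 3 by rewrite cE rnM e1 mulr1 rnRge //; lra.
  have c1 : rn c < 1 by rewrite c23; lra.
  have qc : rn (q * c) = 2^-1 by rewrite rnM c23 /q rnRge; lra.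
  rewrite rnM rnV rnX mulrC; apply: ler_pM; rewrite ?rn_ge0 ?invr_ge0 ?exprn_ge0 ?rn_ge0 //.
    exact: bg (inb _ c1).
  (* Here [3/8 = 1/2 - 1/8] is three times the bound on [rn z], whence the ratio [3]. *)
  have lo : 3 / 8 <= rn (z + q * c).
    have := rnB (z + q * c) z; rewrite [z + _]addrC addrK qc.
    by lra.
  rewrite -exprVn lerXn2r ?nnegrE ?invr_ge0 ?rn_ge0 //; first by lra.
  rewrite -[8 / 3]invrK lef_pV2 ?posrE ?invr_gt0; lra.
apply: rn_le0; apply: (@pow_third _ B); first exact: rn_ge0.
move=> m; have -> : g z = z ^+ m * k m z by rewrite /k mulVKf // expf_neq0.
rewrite rnM rnX; apply: le_trans (ler_wpM2l _ (kz m)) _; first by rewrite exprn_ge0 // rn_ge0.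
rewrite mulrCA -exprMn ler_wpM2l // -exprVn lerXn2r ?nnegrE ?invr_ge0 //.
  by rewrite mulr_ge0 ?rn_ge0 // divr_ge0.
have := rn_ge0 z; lra.
Qed.

(** The radius does not depend on [c], so that zeros propagate to [p] from points tending to it. The
    complex line through [c] and [z] is parametrised with [z] at [8^-1], within reach of
    [vanish_disc]; [r / 20] keeps the image of the unit disc where [h] is bounded. *)
Lemma identity_near (V : normedModType K) (h : V -> K) p : holo h p ->
  exists2 d : R, 0 < d & forall c, rn (c - p) < d -> (\forall z \near c, h z = 0) ->
    forall z, rn (z - p) < d -> h z = 0.
Proof.
move=> /holo_bound[r [B [r0 dh bh]]]; exists (r / 20); first by rewrite divr_gt0.
move=> c hc /near_rnP[e e0 he] z hz.
pose g (s : K) := h (c + s *: (8 *: (z - c))).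
have hzc : rn (z - c) < r / 10.
  by apply: le_lt_trans (rn_tri p _ _) _; rewrite [rn (p - c)]rnC; lra.
have r8 : rn (8 : K) = 8.
  by rewrite -(rmorph_nat (real_complex R)) rnRge.
have inb (s : K) : rn s < 1 -> rn (c + s *: (8 *: (z - c)) - p) < 4 * r.
  move=> s1; rewrite addrAC; apply: le_lt_trans (rnD _ _) _.
  rewrite !rnZ r8; have := rn_ge0 s; have := rn_ge0 (z - c).
  by move: (rn (z - c)) (rn s) (rn (c - p)) hzc s1 hc => x y w *; nra.
have g18 : g 8^-1 = h z.
  by rewrite /g scalerA mulVf ?pnatr_eq0 // scale1r [c + _]addrC subrK.
rewrite -g18; apply: (@vanish_disc g B).
- by move=> s /inb/dh/isd_restrict_line/isd_diff.
- by move=> s /inb/bh.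
- have k0 : 0 < 8 * rn (z - c) + 1 by have := rn_ge0 (z - c); lra.
  apply/near_rnP; exists (e / (8 * rn (z - c) + 1)); first by rewrite divr_gt0.
  move=> s; rewrite subr0 ltr_pdivlMr // => hs; apply: he.
  rewrite [c + _]addrC addrK !rnZ r8; apply: le_lt_trans hs.
  by rewrite ler_wpM2l ?rn_ge0 // lerDl.
by rewrite rnV r8.
Qed.

End Identity.

(** * Hadamard's lemma *)

Section Hadamard.
Variable R : realType.
Local Notation K := (C R).

Lemma rcontM (p q : R -> K) t : rcont p t -> rcont q t -> rcont (fun t => p t * q t) t.
Proof.
move=> hp hq e e0; have k0 : 0 < rn (p t) + rn (q t) + 1.
  by have := rn_ge0 (p t); have := rn_ge0 (q t); lra.
have [m [m0 m1 me]] : exists m : R, [/\ 0 < m, m <= 1 & m * (rn (p t) + rn (q t) + 1) <= e].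
  exists (Num.min 1 (e / (rn (p t) + rn (q t) + 1))).
  rewrite lt_min ltr01 divr_gt0 // ge_min lexx; split=> //.
  by rewrite -ler_pdivlMr // ge_min lexx orbT.
have [d1 d10 h1] := hp _ m0; have [d2 d20 h2] := hq _ m0.
exists (Num.min d1 d2); first by rewrite lt_min d10.
move=> s; rewrite lt_min => /andP[/h1 k1 /h2 k2].
have -> : p s * q s - p t * q t = (p s - p t) * (q s - q t) + (p s - p t) * q t + p t * (q s - q t).
  by ring.
apply: lt_le_trans me.
apply: le_lt_trans (rnD _ _) _; apply: le_lt_trans (lerD (rnD _ _) (lexx _)) _.
rewrite !rnM; have := rn_ge0 (p t); have := rn_ge0 (q t).
have := rn_ge0 (p s - p t); have := rn_ge0 (q s - q t).
move: (rn (p s - p t)) (rn (q s - q t)) (rn (p t)) (rn (q t)) k1 k2 => x y a b xm ym y0 x0 b0 a0.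
have e1 : x * y <= x by rewrite -[leRHS]mulr1 ler_wpM2l //; lra.
have e2 : x * b <= m * b by rewrite ler_wpM2r // ltW.
have e3 : a * y <= a * m by rewrite ler_wpM2l // ltW.
by lra.
Qed.

(** Differentiation under the integral sign, justified by the Taylor estimate of [holo_taylor],
    which is uniform along the segment. *)
Lemma holo_int01 (V : normedModType K) (h : V -> K) a : holo h a ->
  holo (fun z => int01 (fun t : R => h (a + (t%:C : K) *: (z - a)))) a /\
  \forall z \near a, ccont (fun t : R => h (a + (t%:C : K) *: (z - a))).
Proof.
move=> /holo_taylor[r [B [r0 B0 dh dl tl]]].
have aa : rn (a - a) < r by rewrite subrr rn0.
have inb z t : rn (z - a) < r -> 0 <= t <= 1 -> rn (a + (t%:C : K) *: (z - a) - a) < r.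
  by move=> hz t01; exact: ball_cvx.
have cc z : rn (z - a) < r -> ccont (fun t : R => h (a + (t%:C : K) *: (z - a))).
  move=> hz t t01; apply: rcont_seg; apply: differentiable_continuous; apply: dh; exact: inb.
have cd z u : rn (z - a) < r -> ccont (fun t : R => (t%:C : K) * 'd h (a + (t%:C : K) *: (z - a)) u).
  move=> hz t t01.
  have Hh : holo h (a + (t%:C : K) *: (z - a)).
    apply/near_rnP; exists (r - rn (a + (t%:C : K) *: (z - a) - a)).
      by rewrite subr_gt0; exact: inb.
    move=> w hw; apply: dh; apply: le_lt_trans (rn_tri (a + (t%:C : K) *: (z - a)) _ _) _; lra.
  have H := holo_cont (holo_d u Hh).
  have H1 := rcont_seg H.
  have H2 : rcont (fun t : R => (t%:C : K)) t.
    by move=> e' e'0; exists e' => // s; rewrite -rmorphB rnR.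
  exact: (rcontM H2 H1).
split; last by apply/near_rnP; exists r.
apply/near_rnP; exists r => // z hz.
apply: (@isd_diff _ _ _ _ _ (fun u => int01 (fun t : R => (t%:C : K) * 'd h (a + (t%:C : K) *: (z - a)) u))).
split.
- move=> k u v; rewrite /GRing.scale /= -(int01Z k (cd z u hz)) -(int01D (ccontZ k (cd z u hz)) (cd z v hz)).
  congr int01; apply: funext => t; rewrite linearD linZ.
  by move: ('d h _ u) ('d h _ v) => x y; ring.
- have [M hM] : exists M : R, forall t u, 0 <= t <= 1 -> rn ('d h (a + (t%:C : K) *: (z - a)) u) <= M * rn u.
    have [_ [M hM] _] := diff_isd (dh _ aa).
    exists (M + B * r) => t u t01.
    have := dl _ a u (inb z t hz t01) aa.
    set w := a + _; move=> h1.
    have := rnD ('d h w u - 'd h a u) ('d h a u); rewrite subrK => h2.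
    have h3 : B * rn (w - a) * rn u <= B * r * rn u.
      by rewrite ler_wpM2r ?rn_ge0 // ler_wpM2l // ltW //; exact: inb.
    by have := hM u; rewrite mulrDl; lra.
  exists M => u; apply: int01_bound; first exact: cd.
  move=> t t01; rewrite rnM rnR; case/andP: (t01) => t0 t1; rewrite ger0_norm //.
  apply: le_trans (hM t u t01); rewrite -[leRHS]mul1r ler_wpM2r ?rn_ge0 //.
move=> e e0; have k0 : 0 < B + 1 by lra.
exists (Num.min (r - rn (z - a)) (e / (B + 1))).
  by rewrite lt_min subr_gt0 hz divr_gt0.
move=> u; rewrite lt_min => /andP[u1]; rewrite ltr_pdivlMr // => u2.
have hzu : rn (z + u - a) < r.
  by rewrite addrAC; apply: le_lt_trans (rnD _ _) _; lra.
have cB : ccont (fun t : R => h (a + (t%:C : K) *: (z + u - a)) - h (a + (t%:C : K) *: (z - a))).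
  move=> t t01; apply: rcontD; first exact: (cc _ hzu).
  have E : (fun t : R => - h (a + (t%:C : K) *: (z - a))) = (fun t : R => (-1) * h (a + (t%:C : K) *: (z - a))).
    by apply: funext => s; rewrite mulN1r.
  by rewrite E; apply: rcontZ; exact: (cc _ hz).
rewrite -(int01B (cc _ hzu) (cc _ hz)) -(int01B cB (cd z u hz)).
apply: int01_bound.
  move=> t t01; apply: rcontD; first exact: cB.
  have E : (fun t : R => - ((t%:C : K) * 'd h (a + (t%:C : K) *: (z - a)) u)) = (fun t : R => (-1) * ((t%:C : K) * 'd h (a + (t%:C : K) *: (z - a)) u)).
    by apply: funext => s; rewrite mulN1r.
  by rewrite E; apply: rcontZ; exact: (cd z u hz).
move=> t t01; have := tl _ _ (inb z t hz t01) (inb (z + u) t hzu t01).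
have -> : a + (t%:C : K) *: (z + u - a) - (a + (t%:C : K) *: (z - a)) = (t%:C : K) *: u.
  by rewrite opprD addrACA subrr add0r -scalerBr opprB addrA subrK [z + u]addrC addrK.
rewrite linZ => h1; apply: le_trans h1 _.
case/andP: t01 => t0 t1; rewrite rnZ rnRge // expr2.
have := rn_ge0 u; move: u2; move: (rn u) => x hx x0.
have h5 : x * (B + 1) * x <= e * x by rewrite ler_wpM2r // ltW.
apply: le_trans h5; rewrite mulrC [x * (B + 1)]mulrC -!mulrA.
have h6 : t * (x * (t * x)) <= x * x.
  have h7 : t * x <= x by rewrite -[leRHS]mul1r ler_wpM2r.
  by rewrite mulrA ler_pM // ?mulr_ge0.
have : 0 <= x * x by rewrite mulr_ge0.
by nra.
Qed.

(** [h z - h a] is the integral of the derivative along the segment from [a]. *)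
Lemma hadamard n (h : 'rV[K]_n -> K) a : holo h a ->
  exists k : 'I_n -> 'rV[K]_n -> K, (forall i, holo (k i) a) /\
    \forall z \near a, h z = h a + \sum_i (z 0 i - a 0 i) * k i z.
Proof.
move=> hh; pose k i z := int01 (fun t : R => 'd h (a + (t%:C : K) *: (z - a)) (delta_mx 0 i)).
have hk i := holo_int01 (holo_d (delta_mx 0 i) hh).
exists k; split=> [i|]; first by have [] := hk i.
have [r r0 dr] := proj1 (near_rnP _ _) hh.
have cck : \forall z \near a, forall i, ccont (fun t : R => 'd h (a + (t%:C : K) *: (z - a)) (delta_mx 0 i)).
  by apply: (near_all (P := fun i z => ccont (fun t : R => 'd h (a + (t%:C : K) *: (z - a)) (delta_mx 0 i)))) => i; have [] := hk i.
have [r1 r10 hr1] := proj1 (near_rnP _ _) cck.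
apply/near_rnP; exists (Num.min r1 r); first by rewrite lt_min r10.
move=> z; rewrite lt_min => /andP[/hr1 ck hz].
have aa : rn (a - a) < r by rewrite subrr rn0.
have : antider (fun t : R => 'd h (a + (t%:C : K) *: (z - a)) (z - a)) (fun t : R => h (a + (t%:C : K) *: (z - a))).
  move=> t t01; apply: rder_seg; apply: dr; exact: ball_cvx.
move=> /int01_val; rewrite rmorph1 rmorph0 scale1r scale0r addr0 [a + _]addrC subrK => E.
apply: (@addrI _ (- h a)); rewrite addKr addrC -E.
have E2 : forall t : R, 'd h (a + (t%:C : K) *: (z - a)) (z - a) =
    \sum_i (z 0 i - a 0 i) * 'd h (a + (t%:C : K) *: (z - a)) (delta_mx 0 i).
  move=> t; rewrite [X in 'd h _ X]row_sum_delta linear_sum /=.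
  by apply: eq_bigr => i _; rewrite linZ !mxE.
have -> : (fun t : R => 'd h (a + (t%:C : K) *: (z - a)) (z - a)) = (fun t : R => 
    \sum_i (z 0 i - a 0 i) * 'd h (a + (t%:C : K) *: (z - a)) (delta_mx 0 i)) by apply: funext.
have H (s : seq 'I_n) : ccont (fun t : R => \sum_(i <- s) (z 0 i - a 0 i) * 'd h (a + (t%:C : K) *: (z - a)) (delta_mx 0 i)) /\
   int01 (fun t : R => \sum_(i <- s) (z 0 i - a 0 i) * 'd h (a + (t%:C : K) *: (z - a)) (delta_mx 0 i))
   = \sum_(i <- s) (z 0 i - a 0 i) * k i z.
  elim: s => [|i s [c1 c2]].
    rewrite big_nil; have -> : (fun t : R => \sum_(i <- [::]) (z 0 i - a 0 i) * 'd h (a + (t%:C : K) *: (z - a)) (delta_mx 0 i)) = (fun=> 0).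
      by apply: funext => t; rewrite big_nil.
    by split; [move=> t _; exact: rcont_cst|exact: int01_cst].
  have -> : (fun t : R => \sum_(i <- i :: s) (z 0 i - a 0 i) * 'd h (a + (t%:C : K) *: (z - a)) (delta_mx 0 i)) =
     (fun t : R => (z 0 i - a 0 i) * 'd h (a + (t%:C : K) *: (z - a)) (delta_mx 0 i) + \sum_(i <- s) (z 0 i - a 0 i) * 'd h (a + (t%:C : K) *: (z - a)) (delta_mx 0 i)).
    by apply: funext => t; rewrite big_cons.
  split; first exact: ccontD (ccontZ _ (ck i)) c1.
  by rewrite (int01D (ccontZ _ (ck i)) c1) (int01Z _ (ck i)) c2 big_cons.
by have [_ ->] := H (index_enum 'I_n).
Qed.

End Hadamard.

(** * Inverse function and constant rank theorems *)

Ltac lra_nonorm :=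
  repeat match goal with H : is_true ?b |- _ =>
    lazymatch b with context [@rn] => clear H end end; lra.

Section Inverse.
Variable R : realType.
Local Notation K := (C R).

Lemma pow_half (x B : R) : (forall m : nat, x <= B / 2 ^+ m) -> x <= 0.
Proof.
move=> h; rewrite leNgt; apply/negP => xp.
have le2 m : (m%:R : R) <= 2 ^+ m.
  elim: m => [|m IH]; first by rewrite expr0 ler01.
  have h1 : 1 <= (2 : R) ^+ m by rewrite exprn_ege1 // ler1n.
  by rewrite exprS -[m.+1]addn1 natrD; lra.
have := h (Num.truncn (B / x)).+1; set m := (Num.truncn _).+1 => hm.
have h3 : B / x < 2 ^+ m := lt_le_trans (truncnS_gt _) (le2 m).
have p3 : 0 < (2 : R) ^+ m by rewrite exprn_gt0.
move: hm h3; rewrite ler_pdivlMr // ltr_pdivrMr // [_ * x]mulrC => h1 h2.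
by have := le_lt_trans h1 h2; rewrite ltxx.
Qed.

Lemma lin_inv n (L : 'rV[K]_n -> 'rV[K]_n) : linear L ->
  (forall u, L u = 0 -> u = 0) ->
  exists A : 'M[K]_n, [/\ forall u, L u *m A = u, forall u, L (u *m A) = u &
    exists B : 'M[K]_n, [/\ A *m B = 1%:M, B *m A = 1%:M & forall u, L u = u *m B]].
Proof.
move=> l inj; pose lM := GRing.isLinear.Build _ _ _ _ L l.
pose LL : {linear 'rV[K]_n -> 'rV[K]_n} := HB.pack L lM.
have E u : u *m lin1_mx LL = L u by rewrite (mul_rV_lin1 LL).
have U : lin1_mx LL \in unitmx.
  rewrite -row_free_unit; apply: inj_row_free => v; rewrite E; exact: inj.
exists (invmx (lin1_mx LL)); split.
- by move=> u; rewrite -E mulmxK.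
- by move=> u; rewrite -E mulmxKV.
by exists (lin1_mx LL); rewrite mulmxV // mulVmx //; split.
Qed.

Section NearIdentity.
Variables (n : nat) (T : 'rV[K]_n -> 'rV[K]_n) (a : 'rV[K]_n) (r : R).
Hypotheses (r0 : 0 < r) (dT : forall z, rn (z - a) < r -> differentiable T z)
  (nT : forall z u, rn (z - a) < r -> rn ('d T z u - u) <= 2^-1 * rn u).

(** By coordinates, as the mean value inequality is for scalar functions; nothing is lost, because
    rows carry the supremum norm. *)
Lemma pert_lip z w : rn (z - a) < r -> rn (w - a) < r ->
  rn ((T w - w) - (T z - z)) <= 2^-1 * rn (w - z).
Proof.
move=> hz hw; apply: rn_row_le; first by rewrite mulr_ge0 ?rn_ge0 // invr_ge0.
move=> i.
have -> : ((T w - w) - (T z - z)) 0 i = (fun x => T x 0 i - x 0 i) w - (fun x => T x 0 i - x 0 i) z.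
  by rewrite !mxE.
apply: (@mean_value_le_seg _ _ (fun x : 'rV[K]_n => T x 0 i - x 0 i : K)) => t t01; have hb := ball_cvx hz hw t01.
have D := isdB (isd_row_coord i (diff_isd (dT hb))) (isd_coord (z + (t%:C : K) *: (w - z)) i).
split; first exact: isd_diff D.
rewrite (isd_val D); apply: le_trans (nT (w - z) hb).
by have := rn_coord ('d T (z + (t%:C : K) *: (w - z)) (w - z) - (w - z)) i; rewrite !mxE.
Qed.

Lemma T_expand z w : rn (z - a) < r -> rn (w - a) < r -> rn (w - z) <= 2 * rn (T w - T z).
Proof.
move=> hz hw; have := pert_lip hz hw.
have -> : T w - w - (T z - z) = (T w - T z) - (w - z).
  by apply/rowP => i; rewrite !mxE; ring.
have := rnB (T w - T z) ((T w - T z) - (w - z)).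
rewrite opprB [X in rn X]addrC subrK.
move: (rn (T w - T z - (w - z))) (rn (w - z)) (rn (T w - T z)) (rn_ge0 (T w - T z)) => x y z' *; lra.
Qed.

Lemma T_onto y : rn (y - T a) < r / 8 -> exists2 w, rn (w - a) < r & T w = y.
Proof.
have rr := r0; move=> hy.
(* Successive approximations: the residual [y - T (u k)] is the next step, and it is halved each
   time because [T - id] is a contraction of ratio [1/2]. *)
have [u [u0 uSS]] : exists u : nat -> 'rV[K]_n, u 0%N = a /\ forall k, u k.+1 = u k + (y - T (u k)).
  by exists (fix u k := if k is k'.+1 then u k' + (y - T (u k')) else a).
have uS k : u k.+1 - u k = y - T (u k) by rewrite uSS [u k + _]addrC addrK.
set D := rn (y - T a) in hy *; have D0 : 0 <= D by exact: rn_ge0.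
have geo k : rn (u k - a) <= 2 * D - 2 * D / 2 ^+ k /\ rn (y - T (u k)) <= D / 2 ^+ k.
  elim: k => [|k [h1 h2]]; first by rewrite u0 expr0 divr1 !subrr rn0 divr1.
  have p : 0 < (2 ^+ k : R)^-1 by rewrite invr_gt0 exprn_gt0.
  have e2 : D / 2 ^+ k.+1 = D / 2 ^+ k / 2 by rewrite exprS invfM; ring.
  have e3 : 2 * D / 2 ^+ k.+1 = D / 2 ^+ k by rewrite -mulrA e2 mulrC divfK // pnatr_eq0.
  have q0 : 0 <= D / 2 ^+ k by rewrite mulr_ge0 // ltW.
  have e4 : 2 * D / 2 ^+ k = 2 * (D / 2 ^+ k) by rewrite mulrA.
  have h3 : rn (u k.+1 - a) <= 2 * D - 2 * D / 2 ^+ k.+1.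
    apply: le_trans (rn_tri (u k) _ _) _; rewrite uS e3.
    by apply: le_trans (lerD h2 h1) _; rewrite e4; lra_nonorm.
  split=> //.
  have b1 : rn (u k - a) < r by apply: le_lt_trans h1 _; rewrite e4; lra_nonorm.
  have b2 : rn (u k.+1 - a) < r by apply: le_lt_trans h3 _; rewrite e3; lra_nonorm.
  have := pert_lip b1 b2; rewrite uS.
  have -> : T (u k.+1) - u k.+1 - (T (u k) - u k) = - (y - T (u k.+1)).
    rewrite uSS; move: (T (u k + (y - T (u k)))) => Tv; move: (T (u k)) => Tu.
    by apply/rowP => i; rewrite !mxE; ring.
  rewrite rnN e2 => h5; apply: le_trans h5 _.
  by rewrite [leRHS]mulrC ler_wpM2l // invr_ge0.
have [k|w hw] := @row_geom_lim R n u D; first by rewrite uS; have [] := geo k.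
have wa : rn (w - a) < r.
  by have := hw 0%N; rewrite u0 expr0 divr1 => h0; apply: le_lt_trans h0 _; lra_nonorm.
exists w => //; apply/eqP; rewrite -subr_eq0; apply/eqP; apply: rn_le0.
(* [7 = 4 / 2 + 4 + 1], from the three terms of the decomposition of [T w - y] below. *)
apply: (@pow_half _ (7 * D)) => k.
have p : 0 < (2 ^+ k : R)^-1 by rewrite invr_gt0 exprn_gt0.
have q0 : 0 <= D / 2 ^+ k by rewrite mulr_ge0 // ltW.
have [g1 g2] := geo k; have hwk := hw k.
have e4 : 2 * D / 2 ^+ k = 2 * (D / 2 ^+ k) by rewrite mulrA.
have b1 : rn (u k - a) < r by apply: le_lt_trans g1 _; rewrite e4; lra_nonorm.
have h := pert_lip b1 wa.
have -> : T w - y = (T w - w - (T (u k) - u k)) + (w - u k) - (y - T (u k)).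
  by move: (T w) (T (u k)) => Tw Tu; apply/rowP => i; rewrite !mxE; ring.
have i2 : 0 <= (2^-1 : R) by rewrite invr_ge0.
apply: le_trans (rnB _ _) _; apply: le_trans (lerD (rnD _ _) (lexx _)) _.
apply: le_trans (lerD (lerD (le_trans h (ler_wpM2l i2 hwk)) hwk) g2) _.
have e5 : 4 * D / 2 ^+ k = 4 * (D / 2 ^+ k) by rewrite mulrA.
have e6 : 7 * D / 2 ^+ k = 7 * (D / 2 ^+ k) by rewrite mulrA.
by rewrite e5 e6; lra_nonorm.
Qed.

Lemma near_id_inverse : exists Xi : 'rV[K]_n -> 'rV[K]_n,
  [/\ forall y, rn (y - T a) < r / 8 -> [/\ rn (Xi y - a) < r, T (Xi y) = y & holo_map Xi y] &
      forall w, rn (w - a) < r -> rn (T w - T a) < r / 8 -> Xi (T w) = w].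
Proof.
have rr := r0.
have /choice[Xi hXi] : forall y, exists w, rn (y - T a) < r / 8 -> rn (w - a) < r /\ T w = y.
  move=> y; have [h|h] := pselect (rn (y - T a) < r / 8); last by exists a.
  by have [w w1 w2] := T_onto h; exists w.
have inj z w : rn (z - a) < r -> rn (w - a) < r -> T z = T w -> z = w.
  move=> hz hw E; apply/eqP; rewrite -subr_eq0; apply/eqP; apply: rn_le0.
  by apply: le_trans (T_expand hw hz) _; rewrite E subrr rn0 mulr0.
have dXi y : rn (y - T a) < r / 8 -> differentiable Xi y.
  move=> hy; have [w1 w2] := hXi y hy; set w := Xi y in w1 w2 *.
  have [lL _ hL] := diff_isd (dT w1).
  have [u|A [A1 A2 _]] := lin_inv lL.
    move=> h; apply: rn_le0; have := nT u w1; rewrite h sub0r rnN; have := rn_ge0 u; lra.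
  have [M M0 hM] := mulmx_bound A.
  apply: (@isd_diff _ _ _ _ _ (fun u => u *m A)); split.
  - by move=> k u v; rewrite mulmxDl scalemxAl.
  - by exists M.
  move=> e e0; have e1 : 0 < e / (2 * M) by rewrite divr_gt0 // mulr_gt0.
  have [d d0 hd] := hL _ e1.
  exists (Num.min (d / 2) (r / 8 - rn (y - T a))); first by rewrite lt_min divr_gt0 // subr_gt0.
  move=> u; rewrite lt_min => /andP[u1 u2].
  have hyu : rn (y + u - T a) < r / 8.
    by rewrite addrAC; apply: le_lt_trans (rnD _ _) _; lra.
  have [v1 v2] := hXi _ hyu; set v := Xi (y + u) in v1 v2 *.
  have uE : u = T v - T w by rewrite v2 w2 [y + u]addrC addrK.
  have h1 := T_expand w1 v1; rewrite -uE in h1.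
  have /hd : rn (v - w) < d by apply: le_lt_trans h1 _; rewrite mulrC -ltr_pdivlMr.
  rewrite [w + _]addrC subrK -uE => h2.
  have -> : v - w - u *m A = - ((u - 'd T w (v - w)) *m A).
    by rewrite mulmxBl A1 opprB.
  rewrite rnN; apply: le_trans (hM _) _.
  apply: le_trans (ler_wpM2l (ltW M0) h2) _.
  have -> : M * (e / (2 * M) * rn (v - w)) = e / 2 * rn (v - w) by field; exact: lt0r_neq0.
  have h3 : e / 2 * rn (v - w) <= e / 2 * (2 * rn u) by rewrite ler_wpM2l // ltW // divr_gt0.
  by apply: le_trans h3 _; rewrite mulrA divfK // pnatr_eq0.
exists Xi; split.
  move=> y hy; have [w1 w2] := hXi y hy; split=> // i.
  apply/near_rnP; exists (r / 8 - rn (y - T a)); first by rewrite subr_gt0.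
  move=> z hz; apply: isd_diff (isd_row_coord i (diff_isd (dXi z _))).
  by apply: le_lt_trans (rn_tri y _ _) _; lra.
by move=> w w1 w2; have [v1 v2] := hXi _ w2; exact: inj.
Qed.

End NearIdentity.

(** Multiplying by the inverse [A] of the differential gives a map [G] whose differential at [a] is
    the identity; the Lipschitz bounds of [holo_taylor] keep it within [1/2] of the identity on a
    small ball. The parameter [r1] lets the ball be shrunk at will. *)
Theorem inverse_function n (T : 'rV[K]_n -> 'rV[K]_n) (a : 'rV[K]_n) : holo_map T a ->
  (forall u, 'd T a u = 0 -> u = 0) ->
  forall r1 : R, 0 < r1 -> exists (r p : R) (Xi : 'rV[K]_n -> 'rV[K]_n),
  [/\ 0 < r, r <= r1, 0 < p,
    forall y, rn (y - T a) < p -> [/\ rn (Xi y - a) < r, T (Xi y) = y & holo_map Xi y] &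
    forall w, rn (w - a) < r -> rn (T w - T a) < p -> Xi (T w) = w].
Proof.
move=> hT inj r1 r10; have [lL _ _] := holo_map_isd hT.
have [A [A1 A2 [B [AB BA EB]]]] := lin_inv lL inj.
pose G w := T w *m A.
have hG : holo_map G a by exact: holo_map_mulmx.
have dG0 u : 'd G a u = u.
  have := isd_comp (holo_map_isd hT) (isd_mulmx A (T a)) => /isd_val E.
  by apply: etrans (congr1 (fun L : 'rV[K]_n -> 'rV[K]_n => L u) E) _; exact: A1.
have /choice[rr hrr] : forall i, exists rB : R * R, [/\ 0 < rB.1, 0 <= rB.2,
    (forall z, rn (z - a) < rB.1 -> differentiable (fun z => G z 0 i) z) &
    (forall z w v, rn (z - a) < rB.1 -> rn (w - a) < rB.1 ->
      rn ('d (fun z => G z 0 i) z v - 'd (fun z => G z 0 i) w v) <= rB.2 * rn (z - w) * rn v)].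
  by move=> i; have [r [b [h1 h2 h3 h4 _]]] := holo_taylor (hG i); exists (r, b).
pose S := \sum_i (rr i).2.
have S0 : 0 <= S by apply: sumr_ge0 => i _; have [] := hrr i.
have [m m0 hm] : exists2 m : R, 0 < m & forall i, m <= (rr i).1.
  have H (s : seq 'I_n) : exists2 m : R, 0 < m & forall i, i \in s -> m <= (rr i).1.
    elim: s => [|j s [m m0 IH]]; first by exists 1.
    exists (Num.min m (rr j).1); first by rewrite lt_min m0; have [] := hrr j.
    move=> i; rewrite inE ge_min => /predU1P[->|/IH ->//]; rewrite lexx orbT //.
  by have [m m0 hm] := H (enum 'I_n); exists m => // i; apply: hm; rewrite mem_enum.
have S1 : 0 < 2 * S + 1 by lra.
pose r := Num.min r1 (Num.min m (2 * S + 1)^-1).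
have r0 : 0 < r by rewrite !lt_min r10 m0 invr_gt0.
have rm : r <= m by rewrite /r !ge_min lexx orbT.
have rS : S * r <= 2^-1.
  have : r <= (2 * S + 1)^-1 by rewrite /r !ge_min lexx !orbT.
  move=> h; apply: le_trans (ler_wpM2l S0 h) _.
  by rewrite ler_pdivrMr //; lra.
have dG z : rn (z - a) < r -> forall i, differentiable (fun z => G z 0 i) z.
  move=> hz i; have [_ _ h _] := hrr i; apply: h.
  by apply: lt_le_trans hz (le_trans rm (hm i)).
have dGz z : rn (z - a) < r -> differentiable G z.
  by move=> hz; apply: isd_diff (isd_row (fun i => diff_isd (dG z hz i))).
have aa : rn (a - a) < r by rewrite subrr rn0.
have nG z u : rn (z - a) < r -> rn ('d G z u - u) <= 2^-1 * rn u.
  move=> hz; apply: rn_row_le; first by rewrite mulr_ge0 ?rn_ge0 // invr_ge0.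
  move=> i; rewrite -[X in _ - X](dG0 u).
  have coordE w : rn (w - a) < r -> 'd G w u 0 i = 'd (fun z => G z 0 i) w u.
    move=> hw; have /isd_val E := isd_row_coord i (diff_isd (dGz w hw)).
    exact: esym (congr1 (fun L : 'rV[K]_n -> K => L u) E).
  have [b1 b2 _ h] := hrr i.
  have := h z a u (lt_le_trans hz (le_trans rm (hm i))) (lt_le_trans aa (le_trans rm (hm i))).
  move=> h3; have E : ('d G z u - 'd G a u) 0 i = 'd (fun z => G z 0 i) z u - 'd (fun z => G z 0 i) a u.
    by rewrite mxE [X in _ + X]mxE; congr (_ - _); exact: coordE.
  rewrite E; apply: le_trans h3 _.
  rewrite ler_wpM2r ?rn_ge0 //; apply: le_trans rS.
  apply: ler_pM; rewrite ?rn_ge0 //; last exact: ltW.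
  by rewrite /S (bigD1 i) //= lerDl; apply: sumr_ge0 => j _; have [] := hrr j.
have [Xi [X1 X2]] := near_id_inverse r0 dGz nG.
have [M M0 hM] := mulmx_bound A.
have sm y : rn (y - T a) < r / 8 / M -> rn (y *m A - G a) < r / 8.
  rewrite /G -mulmxBl ltr_pdivlMr // mulrC => h; exact: le_lt_trans (hM _) h.
exists r, (r / 8 / M), (fun y => Xi (y *m A)); split=> //.
- by rewrite /r ge_min lexx.
- by rewrite !divr_gt0.
- move=> y /sm hy; have [h1 h2 h3] := X1 _ hy; split=> //.
    by have := congr1 (mulmx^~ B) h2; rewrite /G -!mulmxA AB !mulmx1.
  apply: (holo_map_comp (F := fun y : 'rV[K]_n => y *m A)) => //.
  by apply: (@holo_map_mulmx _ _ _ _ id) => i; exact: holo_coord.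
by move=> w hw /sm hy; apply: X2.
Qed.

End Inverse.

(** * Rank, determinants and kernels of matrices *)

Section RankAlgebra.
Variable F : fieldType.

(** Determinants of compressions [U *m M *m V] stand in for minors, so that semicontinuity of the
    rank needs no choice of rows and columns. *)
Lemma rank_ge_det n k (M : 'M[F]_(n, k)) r (U : 'M_(r, n)) (V : 'M_(k, r)) :
  \det (U *m M *m V) != 0 -> (r <= \rank M)%N.
Proof.
move=> h; have u : U *m M *m V \in unitmx by rewrite unitmxE unitfE.
rewrite -{1}(mxrank_unit u); apply: leq_trans (mxrankM_maxl _ _) _.
exact: mxrankM_maxr.
Qed.

Lemma det_rank_ge n k (M : 'M[F]_(n, k)) r : (r <= \rank M)%N ->
  exists (U : 'M_(r, n)) (V : 'M_(k, r)), \det (U *m M *m V) != 0.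
Proof.
move=> h.
pose a : 'M[F]_(r, n) := pid_mx r; pose b : 'M[F]_(k, r) := pid_mx r.
exists (a *m invmx (col_ebase M)), (invmx (row_ebase M) *m b).
have E : invmx (col_ebase M) *m M *m invmx (row_ebase M) = pid_mx (\rank M).
  rewrite -[X in _ *m X *m _]mulmx_ebase !mulmxA mulVmx ?col_ebase_unit // mul1mx.
  by rewrite mulmxK ?row_ebase_unit.
have -> : a *m invmx (col_ebase M) *m M *m (invmx (row_ebase M) *m b)
    = a *m (invmx (col_ebase M) *m M *m invmx (row_ebase M)) *m b by rewrite !mulmxA.
rewrite E /a /b !mul_pid_mx.
have -> : minn k (minn (minn n (minn r (\rank M))) r) = r.
  rewrite (minn_idPl h) (minn_idPr (leq_trans h (rank_leq_row M))) minnn.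
  exact/minn_idPr/(leq_trans h (rank_leq_col M)).
rewrite pid_mx_1.
by rewrite det1 oner_neq0.
Qed.

(** The left kernel of [M] is contained in that of [M *m S], and the assumption on ranks makes their
    dimensions equal. *)
Lemma kernel_of_rank n k m (M : 'M[F]_(n, k)) (S : 'M_(k, m)) (u : 'rV_n) :
  (\rank M <= \rank (M *m S))%N -> u *m (M *m S) = 0 -> u *m M = 0.
Proof.
move=> h u0; have sub : (kermx M <= kermx (M *m S))%MS.
  by apply/sub_kermxP; rewrite mulmxA mulmx_ker mul0mx.
have [_ e] := mxrank_leqif_sup sub.
have : \rank (kermx M) == \rank (kermx (M *m S)).
  by rewrite !mxrank_ker eqn_leq !leq_sub2l // mxrankM_maxl.
rewrite e => s2; apply/sub_kermxP; apply: submx_trans s2.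
exact/sub_kermxP.
Qed.

End RankAlgebra.

(** * The constant rank theorem on a reduced zero set *)

Section ConstRank.
Variable R : realType.
Local Notation K := (C R).
Variables (n k : nat) (D : set 'rV[K]_n) (F : 'I_k -> 'rV[K]_n -> K).
Hypotheses (oD : open D) (dF : forall j z, D z -> differentiable (F j) z).
Let A := [set z | D z /\ forall j, F j z = 0].
Hypothesis rad : forall a (h : 'rV[K]_n -> K), A a ->
  (\forall z \near a, differentiable h z) -> (\forall z \near a, A z -> h z = 0) ->
  exists c : 'I_k -> 'rV[K]_n -> K,
    (forall j, \forall z \near a, differentiable (c j) z) /\
    \forall z \near a, h z = \sum_j c j z * F j z.

(** The transposed Jacobian matrix. *)
Definition jac (z : 'rV[K]_n) : 'M[K]_(n, k) := \matrix_(i, j) 'd (F j) z (delta_mx 0 i).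

Lemma holo_F j z : D z -> holo (F j) z.
Proof.
move=> Dz; have [e e0 he] := proj1 (open_rnP _) oD z Dz.
by apply/near_rnP; exists e => // w /he; exact: dF.
Qed.

Lemma jacE z (u : 'rV[K]_n) j : (u *m jac z) 0 j = 'd (F j) z u.
Proof.
rewrite mxE [in RHS](row_sum_delta u) linear_sum /=.
by apply: eq_bigr => i _; rewrite !mxE linZ.
Qed.

Lemma holo_jac i j z : D z -> holo (fun z => jac z i j) z.
Proof.
move=> Dz; have -> : (fun z => jac z i j) = (fun z => 'd (F j) z (delta_mx 0 i)).
  by apply: funext => w; rewrite mxE.
exact: holo_d (holo_F j Dz).
Qed.

Lemma holo_minor m r (S : 'M[K]_(k, m)) (U : 'M_(r, n)) (V : 'M_(m, r)) z : D z ->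
  holo (fun z => \det (U *m (jac z *m S) *m V)) z.
Proof.
move=> Dz; apply: holo_det => i j.
have -> : (fun z => (U *m (jac z *m S) *m V) i j) = (fun z =>
    \sum_a (\sum_b U i b * \sum_c jac z b c * S c a) * V a j).
  apply: funext => w; rewrite mxE; apply: eq_bigr => a _; rewrite mxE; congr (_ * _).
  by apply: eq_bigr => b _; rewrite mxE.
apply: holo_sum => a; apply: holoM; last exact: holo_cst.
apply: holo_sum => b; apply: holoM; first exact: holo_cst.
by apply: holo_sum => c; apply: holoM; [exact: holo_jac|exact: holo_cst].
Qed.

Lemma near_neq0 (h : 'rV[K]_n -> K) z : holo h z -> h z != 0 -> \forall w \near z, h w != 0.
Proof.
move=> /holo_cont/contE hc hz.
have p : 0 < rn (h z) by rewrite lt_def rn_ge0 andbT; apply: contra_neq hz; exact: rn_eq0.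
have [d d0 hd] := hc _ p; apply/near_rnP; exists d => // w /hd.
by apply: contraTneq => ->; rewrite sub0r rnN ltxx.
Qed.

Lemma rank_lower m (S : 'M[K]_(k, m)) z : D z ->
  \forall w \near z, (\rank (jac z *m S) <= \rank (jac w *m S))%N.
Proof.
move=> Dz; have [U [V h]] := det_rank_ge (leqnn (\rank (jac z *m S))).
apply: filterS (near_neq0 (holo_minor S U V Dz) h) => w; exact: rank_ge_det.
Qed.

Variable z0 : 'rV[K]_n.
Hypotheses (Az0 : A z0)
  (crk : \forall w \near z0, A w -> (\rank (jac w) <= \rank (jac z0))%N).

Let r := \rank (jac z0).
Let L := col_ebase (jac z0).
Let S : 'M[K]_k := invmx (row_ebase (jac z0)).
Let Cn : 'M[K]_n := copid_mx r.
Let d := \rank Cn.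
Let Iq : 'M[K]_(d, n) := row_base Cn.
Let Pm : 'M[K]_(n, d) := col_base Cn.
Let Fv (w : 'rV[K]_n) : 'rV[K]_k := \row_j F j w.
(** Since [jac z0 *m S = L *m pid_mx r], the matrix [S *m pid_mx r] selects [r] combinations of the
    equations. They are the first [r] coordinates of [Theta], the others being those of
    [(w - z0) *m L]; the differential at [z0] is then multiplication by the invertible [L]. [P] is
    the second group of coordinates, cut down to length [d] by the factorisation [Cn = Pm *m Iq]. *)
Let Theta (w : 'rV[K]_n) : 'rV[K]_n := Fv w *m (S *m pid_mx r) + (w - z0) *m (L *m Cn).
Let P (w : 'rV[K]_n) : 'rV[K]_d := (w - z0) *m (L *m Pm).

Lemma r_le_n : (r <= n)%N. Proof. exact: rank_leq_row. Qed.
Lemma r_le_k : (r <= k)%N. Proof. exact: rank_leq_col. Qed.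

Lemma PmIq : Pm *m Iq = Cn. Proof. exact: mulmx_base. Qed.

Lemma IqPm : Iq *m Pm = 1%:M.
Proof.
have := copid_mx_id K r_le_n; rewrite -/Cn -PmIq => h.
have inj1 := row_full_inj (col_base_full Cn); have inj2 := row_free_inj (row_base_free Cn).
apply: inj2; apply: inj1; rewrite mul1mx.
by rewrite -[RHS]h !mulmxA.
Qed.

Lemma jacL : jac z0 *m S = L *m pid_mx r.
Proof. by rewrite /S -{1}(mulmx_ebase (jac z0)) mulmxK ?row_ebase_unit. Qed.

Lemma holo_Fv w : D w -> holo_map Fv w.
Proof.
move=> Dw j; have -> : (fun z => Fv z 0 j) = F j by apply: funext => z; rewrite mxE.
exact: holo_F.
Qed.

Lemma holo_Theta w : D w -> holo_map Theta w.
Proof.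
move=> Dw i; have -> : (fun z => Theta z 0 i) = (fun z => (Fv z *m (S *m pid_mx r)) 0 i + ((z - z0) *m (L *m Cn)) 0 i).
  by apply: funext => z; rewrite mxE.
apply: holoD.
  exact: (@holo_map_mulmx _ _ _ _ Fv _ _ (holo_Fv Dw) i).
exact: (@holo_map_mulmx _ _ _ _ (fun z => z - z0) _ _ (holo_map_aff w (- z0)) i).
Qed.

Lemma holo_P w : holo_map P w.
Proof. exact: (@holo_map_mulmx _ _ _ _ (fun z => z - z0) _ _ (holo_map_aff w (- z0))). Qed.

Lemma Fv0 w : A w -> Fv w = 0.
Proof. by move=> [_ h]; apply/rowP => j; rewrite !mxE h. Qed.

Lemma Theta_A w : A w -> Theta w = P w *m Iq.
Proof.
by move=> /Fv0 h; rewrite /Theta h mul0mx add0r /P -[RHS]mulmxA -(mulmxA L Pm Iq) PmIq.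
Qed.

Lemma P_z0 : P z0 = 0. Proof. by rewrite /P subrr mul0mx. Qed.

Lemma Theta_z0 : Theta z0 = 0. Proof. by rewrite Theta_A // P_z0 mul0mx. Qed.

Lemma d_Fv w (u : 'rV[K]_n) : D w -> 'd Fv w u = u *m jac w.
Proof.
move=> Dw; apply/rowP => j; rewrite jacE (holo_map_d u j (holo_Fv Dw)).
by congr ('d _ w u); apply: funext => z; rewrite mxE.
Qed.

Lemma d_Theta_inj u : 'd Theta z0 u = 0 -> u = 0.
Proof.
have Dz := Az0.1.
have dT : 'd Theta z0 u = u *m L.
  have h1 := isd_comp (holo_map_isd (holo_Fv Dz)) (isd_mulmx (S *m pid_mx r : 'M_(k, n)) (Fv z0)).
  have h2 : isd (fun w => w - z0) z0 id.
    split=> //; first by exists 1 => v; rewrite mul1r.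
    move=> e e0; exists 1 => // v _.
    have -> : z0 + v - z0 - (z0 - z0) - v = 0 by rewrite subrr subr0 [z0 + v]addrC addrK subrr.
    by rewrite rn0 mulr_ge0 ?rn_ge0 // ltW.
  have h3 := isd_comp h2 (isd_mulmx (L *m Cn) (z0 - z0)).
  apply/rowP => i; rewrite (holo_map_d u i (holo_Theta Dz)).
  have h4 := isdD (isd_row_coord i h1) (isd_row_coord i h3).
  have E : (fun z => Theta z 0 i) = (fun z => (Fv z *m (S *m pid_mx r)) 0 i + ((z - z0) *m (L *m Cn)) 0 i).
    by apply: funext => z; rewrite mxE.
  rewrite E; apply: etrans (congr1 (fun f : 'rV[K]_n -> K => f u) (isd_val h4)) _.
  have E2 : u *m jac z0 *m (S *m pid_mx r : 'M_(k, n)) + u *m (L *m Cn) = u *m L.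
    rewrite -[X in X + _]mulmxA (mulmxA (jac z0)) jacL -(mulmxA L) pid_mx_id ?r_le_k //.
    by rewrite -mulmxDr -mulmxDr /Cn /copid_mx addrC subrK mulmx1.
  by rewrite -[RHS](congr1 (fun v : 'rV[K]_n => v 0 i) E2) [RHS]mxE /= (d_Fv _ Dz).
rewrite dT => h; have uL : L \in unitmx by exact: col_ebase_unit.
by rewrite -(mulmxK uL u) h mul0mx.
Qed.

(** The selected combinations of the equations have rank [r] at [z0], hence at least [r] nearby,
    whereas on [A] the whole Jacobian has rank at most [r]. So both have the same kernel there. *)
Lemma jac_kernel : \forall a \near z0, A a ->
  forall u : 'rV[K]_n, u *m (jac a *m (S *m (pid_mx r : 'M_k))) = 0 -> u *m jac a = 0.
Proof.
have Dz := Az0.1.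
have h0 : \rank (jac z0 *m (S *m (pid_mx r : 'M_k))) = r.
  rewrite mulmxA jacL -mulmxA pid_mx_id ?r_le_k //.
  have -> : \rank (L *m (pid_mx r : 'M_(n, k))) = \rank (jac z0 *m S) by rewrite jacL.
  by rewrite mxrankMfree // row_free_unit unitmx_inv row_ebase_unit.
apply: filterS2 (rank_lower (S *m (pid_mx r : 'M_k)) Dz) crk => a g1 g2 Aa u.
apply: kernel_of_rank; exact: leq_trans (g2 Aa) (leq_trans (eq_leq (esym h0)) g1).
Qed.

Lemma IqCn : Iq *m Cn = Iq.
Proof. by rewrite -[X in _ *m X]PmIq mulmxA IqPm mul1mx. Qed.

Lemma Theta_Cn w : Theta w *m Cn = P w *m Iq.
Proof.
have E1 : (pid_mx r : 'M[K]_(k, n)) *m Cn = 0 by rewrite /Cn mul_pid_mx_copid // r_le_n.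
have E2 : Cn *m Cn = Cn by rewrite /Cn copid_mx_id // r_le_n.
rewrite /Theta mulmxDl -(mulmxA (Fv w)) -(mulmxA S) E1 !mulmx0 add0r.
by rewrite -(mulmxA (w - z0)) -(mulmxA L) E2 /P -[RHS]mulmxA -(mulmxA L Pm Iq) PmIq.
Qed.

Lemma Theta_pid w : Theta w *m (pid_mx r : 'M_(n, k)) = Fv w *m (S *m (pid_mx r : 'M_k)).
Proof.
have E1 : Cn *m (pid_mx r : 'M[K]_(n, k)) = 0 by rewrite /Cn mul_copid_mx_pid // r_le_n.
have E2 : (pid_mx r : 'M[K]_(k, n)) *m (pid_mx r : 'M_(n, k)) = pid_mx r.
  by rewrite pid_mx_id // r_le_n.
rewrite /Theta mulmxDl -(mulmxA (Fv w)) -(mulmxA S) E2.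
by rewrite -(mulmxA (w - z0)) -(mulmxA L) E1 !mulmx0 addr0.
Qed.

Lemma Iq_pid : Iq *m (pid_mx r : 'M_(n, k)) = 0.
Proof.
have E1 : Cn *m (pid_mx r : 'M[K]_(n, k)) = 0 by rewrite /Cn mul_copid_mx_pid // r_le_n.
by rewrite -IqCn -mulmxA E1 mulmx0.
Qed.

(** [Q t] inverts [Theta] on the slice of the points [t *m Iq]: it parametrises the zeros of the
    selected combinations of the equations. These could a priori be more than the points of [A];
    [const_rank] shows that they are not. *)
Lemma local_section : exists (e1 r1 : R) (Q : 'rV[K]_d -> 'rV[K]_n),
  [/\ 0 < e1, 0 < r1,
     forall w, rn (w - z0) < r1 -> D w,
     forall t, rn t < e1 -> [/\ rn (Q t - z0) < r1, P (Q t) = t, holo_map Q t,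
        Fv (Q t) *m (S *m (pid_mx r : 'M_k)) = 0 &
        A (Q t) -> forall u : 'rV[K]_n, u *m (jac (Q t) *m (S *m (pid_mx r : 'M_k))) = 0 -> u *m jac (Q t) = 0] &
     forall w, A w -> rn (w - z0) < r1 -> rn (P w) < e1 -> Q (P w) = w].
Proof.
have Dz := Az0.1; have [a a0 ha] := proj1 (open_rnP _) oD z0 Dz.
have [b b0 hb] := proj1 (near_rnP _ _) jac_kernel.
have ab0 : 0 < Num.min a b by rewrite lt_min a0.
have [r1 [p [Xi [r10 r1ab p0 X1 X2]]]] := inverse_function (holo_Theta Dz) d_Theta_inj ab0.
rewrite Theta_z0 in X1 X2.
have [M M0 hM] := mulmx_bound Iq.
have sm (t : 'rV[K]_d) : rn t < p / M -> rn (t *m Iq - 0) < p.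
  by move=> h; rewrite subr0; apply: le_lt_trans (hM t) _; rewrite mulrC -ltr_pdivlMr.
exists (p / M), r1, (fun t => Xi (t *m Iq)); split=> //.
- exact: divr_gt0.
- by move=> w hw; apply: ha; apply: lt_le_trans hw (le_trans r1ab _); rewrite ge_min lexx.
- move=> t /sm ht; have [h1 h2 h3] := X1 _ ht; split=> //.
  + have := congr1 (mulmx^~ Cn) h2; rewrite Theta_Cn -(mulmxA t) IqCn.
    by move=> /(congr1 (mulmx^~ Pm)); rewrite -(mulmxA _ Iq Pm) -(mulmxA t Iq Pm) IqPm !mulmx1.
  + apply: (holo_map_comp (F := fun t : 'rV[K]_d => t *m Iq)) => //.
    by apply: (@holo_map_mulmx _ _ _ _ id) => i; exact: holo_coord.
  + by rewrite -Theta_pid h2 -mulmxA Iq_pid mulmx0.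
  + move=> AQ; apply: hb => //; apply: lt_le_trans h1 (le_trans r1ab _).
    by rewrite ge_min lexx orbT.
move=> w Aw hw hP; rewrite -(Theta_A Aw); apply: X2 => //.
by rewrite (Theta_A Aw); exact: sm.
Qed.

(** A linear differential inequality with zero initial value: on a ball of radius [e] with
    [m * k * C0 * e <= 1/2], the mean value inequality along rays halves every common bound on the
    [G j]. *)
Lemma gronwall (e1 C0 : R) (m : nat) (G : 'I_k -> 'rV[K]_m -> K) : 0 < e1 -> 0 <= C0 ->
  (forall j, holo (G j) 0) -> (forall j, G j 0 = 0) ->
  (forall t, rn t < e1 -> forall j (l : 'I_m), exists c : 'I_k -> K,
     (forall i, rn (c i) <= C0) /\ 'd (G j) t (delta_mx 0 l) = \sum_i c i * G i t) ->
  exists2 e : R, 0 < e & forall t, rn t < e -> forall j, G j t = 0.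
Proof.
move=> e10 C00 hG G0 hd.
have [a a0 ha] : exists2 a : R, 0 < a & forall t, rn (t - 0) < a -> forall j,
    differentiable (G j) t /\ rn (G j t) <= 1.
  apply/near_rnP; apply: (near_all (P := fun j t => differentiable (G j) t /\ rn (G j t) <= 1)) => j.
  have [b b0 hb] := proj1 (near_rnP _ _) (hG j).
  have [c c0 hc] := proj1 (contE _ _) (holo_cont (hG j)) 1 ltr01.
  apply/near_rnP; exists (Num.min b c); first by rewrite lt_min b0.
  move=> t; rewrite lt_min => /andP[/hb h1 /hc h2]; split; first exact: h1.
  by move: h2; rewrite G0 subr0; exact: ltW.
pose N := m%:R * (k%:R * C0) : R.
have N0 : 0 <= N by rewrite !mulr_ge0.
have N1 : 0 < 2 * N + 1 by rewrite ltr_wpDl // mulr_ge0.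
pose e := Num.min (Num.min e1 a) (2 * N + 1)^-1.
have ee : e <= (2 * N + 1)^-1 by rewrite ge_min lexx orbT.
have Ne : N * e <= 2^-1.
  apply: le_trans (ler_wpM2l N0 ee) _; rewrite ler_pdivrMr //.
  by move: (N) => x; lra.
exists e; first by rewrite !lt_min e10 a0 invr_gt0.
have step (i : nat) t : rn t < e -> forall j, rn (G j t) <= 1 / 2 ^+ i.
  elim: i t => [|i IH] t ht j.
    rewrite expr0 divr1; have [] := ha t _ j => //; rewrite subr0.
    by apply: lt_le_trans ht _; rewrite !ge_min lexx orbT.
  rewrite -[G j t]subr0 -(G0 j); apply: mean_value_le_seg => s s01; rewrite add0r subr0.
  set v := _ *: t; have hv : rn v <= rn t.
    rewrite rnZ; case/andP: s01 => s0 s1; rewrite rnRge //.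
    by rewrite -[leRHS]mul1r ler_wpM2r ?rn_ge0.
  have ve : rn v < e := le_lt_trans hv ht.
  have va : rn (v - 0) < a by rewrite subr0; apply: lt_le_trans ve _; rewrite !ge_min lexx orbT.
  have ve1 : rn v < e1 by apply: lt_le_trans ve _; rewrite !ge_min lexx.
  split; first by have [] := ha v va j.
  rewrite [X in 'd _ _ X](row_sum_delta t) linear_sum.
  apply: le_trans (rn_sum _ _ _) _.
  apply: le_trans (_ : \sum_(l < m) (e * (k%:R * (C0 * (1 / 2 ^+ i)))) <= _).
    apply: ler_sum => l _; rewrite linearZ rnZ.
    apply: ler_pM; rewrite ?rn_ge0 //; first exact: le_trans (rn_coord t l) (ltW ht).
    have [c [c1 ->]] := hd v ve1 j l.
    apply: le_trans (rn_sum _ _ _) _.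
    apply: le_trans (_ : \sum_(i0 < k) (C0 * (1 / 2 ^+ i)) <= _).
      by apply: ler_sum => i0 _; rewrite rnM; apply: ler_pM; rewrite ?rn_ge0 ?c1 // IH.
    by rewrite sumr_const card_ord [leRHS]mulr_natl.
  rewrite sumr_const card_ord -[leLHS]mulr_natl.
  have -> : m%:R * (e * (k%:R * (C0 * (1 / 2 ^+ i)))) = N * e * (1 / 2 ^+ i) by rewrite /N; ring.
  have -> : 1 / 2 ^+ i.+1 = 2^-1 * (1 / 2 ^+ i) :> R by rewrite exprS !div1r invfM.
  by rewrite ler_wpM2r // divr_ge0 // exprn_ge0.
move=> t ht j; apply: rn_le0; apply: (@pow_half _ _ 1) => i; exact: step.
Qed.

(** The differential of [G j = F j o Q] is only known to vanish at the [t] with [Q t] in [A]. Hence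
    [w |-> 'd (G j) (P w)] vanishes on [A] near [z0], and by reducedness it is a combination of the
    equations. Composed with [Q], this expresses the partial derivatives of the [G j] through the
    [G i] themselves, and [gronwall] yields [G j = 0]: [Q] takes its values in [A]. *)
Theorem const_rank : exists (d : nat) (P : 'rV[K]_n -> 'rV[K]_d) (Q : 'rV[K]_d -> 'rV[K]_n)
    (e del : R),
  [/\ 0 < e /\ 0 < del, P z0 = 0, forall w, holo_map P w,
    forall t, rn t < e -> [/\ rn (Q t - z0) < del, A (Q t), P (Q t) = t & holo_map Q t] &
    forall w, A w -> rn (w - z0) < del -> Q (P w) = w].
Proof.
have Dz := Az0.1.
have [e1 [r1 [Q [e10 r10 hD hQ hP]]]] := local_section.
have Q0 : Q 0 = z0 by rewrite -P_z0; apply: hP; rewrite ?subrr ?P_z0 ?rn0.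
have e1_0 : rn (0 : 'rV[K]_d) < e1 by rewrite rn0.
pose G j t := F j (Q t).
have hG j t : rn t < e1 -> holo (G j) t.
  by move=> /hQ[q1 q2 q3 q4 q5]; apply: (holo_comp (F := Q)) => //; apply: holo_F; exact: hD.
have dG j t v : rn t < e1 -> A (Q t) -> 'd (G j) t v = 0.
  move=> ht AQ; have [q1 q2 q3 q4 q5] := hQ t ht.
  have DQ : D (Q t) by exact: hD.
  set u := 'd Q t v.
  have -> : 'd (G j) t v = (u *m jac (Q t)) 0 j.
    have h := isd_comp (holo_map_isd q3) (holo_isd (holo_F j DQ)).
    by rewrite jacE; exact: (congr1 (fun L : 'rV[K]_d -> K => L v) (isd_val h)).
  rewrite q5 ?mxE //.
  have h1 := isd_comp (isd_comp (holo_map_isd q3) (holo_map_isd (holo_Fv DQ)))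
     (isd_mulmx (S *m (pid_mx r : 'M_k)) (Fv (Q t))).
  have h2 : isd (fun t => Fv (Q t) *m (S *m (pid_mx r : 'M_k))) t (fun=> 0).
    apply: (@isd_near _ _ _ (fun=> 0)).
      apply/near_rnP; exists (e1 - rn t); first by rewrite subr_gt0.
      move=> s hs; have hs' : rn s < e1.
        by rewrite -[s](subrK t); apply: le_lt_trans (rnD _ _) _; rewrite -ltrBrDr.
      by have [_ _ _ -> _] := hQ s hs'.
    split; first by move=> ? ? ?; rewrite scaler0 addr0.
      by exists 0 => x; rewrite rn0 mul0r.
    by move=> eps eps0; exists 1 => // x _; rewrite subrr subr0 rn0 mulr_ge0 ?rn_ge0 // ltW.
  have := congr1 (fun L : 'rV[K]_d -> 'rV[K]_k => L v) (isd_val h2).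
  have -> := congr1 (fun L : 'rV[K]_d -> 'rV[K]_k => L v) (isd_val h1).
  by rewrite /= (d_Fv _ DQ) -mulmxA.
have del : exists2 del : R, 0 < del & forall w, rn (w - z0) < del -> rn (w - z0) < r1 /\ rn (P w) < e1.
  have [b b0 hb] := proj1 (contE _ _) (holo_map_cont (holo_P z0)) _ e10.
  exists (Num.min r1 b); first by rewrite lt_min r10.
  by move=> w; rewrite lt_min => /andP[-> /hb]; rewrite P_z0 subr0.
have {del}[del del0 hdel] := del.
have QP w : A w -> rn (w - z0) < del -> Q (P w) = w.
  by move=> Aw /hdel[h1 h2]; exact: hP.
pose h (jl : 'I_k * 'I_d) w := 'd (G jl.1) (P w) (delta_mx 0 jl.2).
have hh jl : holo (h jl) z0.
  apply: (holo_comp (F := P) (g := fun t => 'd (G jl.1) t (delta_mx 0 jl.2)) (@holo_P z0)).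
  by rewrite P_z0; apply: holo_d; exact: hG.
have /choice[c hc] : forall jl, exists c : 'I_k -> 'rV[K]_n -> K,
   (forall i, holo (c i) z0) /\ \forall z \near z0, h jl z = \sum_i c i z * F i z.
  move=> jl; apply: rad => //; first exact: hh.
  apply/near_rnP; exists del => // w hw Aw; have [h1 h2] := hdel w hw.
  by apply: dG => //; rewrite QP.
have /choice[B hB] : forall jli : 'I_k * 'I_d * 'I_k, exists B : R,
    \forall z \near z0, rn (c jli.1 jli.2 z) <= B.
  move=> jli; have [h1 _] := hc jli.1.
  have [b b0 hb] := proj1 (contE _ _) (holo_cont (h1 jli.2)) 1 ltr01.
  exists (1 + rn (c jli.1 jli.2 z0)); apply/near_rnP; exists b => // z /hb hz.
  rewrite -[c _ _ z](subrK (c jli.1 jli.2 z0)); apply: le_trans (rnD _ _) _.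
  by rewrite lerD2r ltW.
pose C0 := \sum_jli `|B jli|.
have C00 : 0 <= C0 by apply: sumr_ge0.
have [b b0 hb] : exists2 b : R, 0 < b & forall z, rn (z - z0) < b -> forall (j : 'I_k) (l : 'I_d),
    h (j, l) z = \sum_i c (j, l) i z * F i z /\ forall i, rn (c (j, l) i z) <= C0.
  apply/near_rnP.
  apply: (near_all (P := fun j z => forall l : 'I_d, h (j, l) z = \sum_i c (j, l) i z * F i z /\
    forall i, rn (c (j, l) i z) <= C0)) => j.
  apply: (near_all (P := fun l z => h (j, l) z = \sum_i c (j, l) i z * F i z /\
    forall i, rn (c (j, l) i z) <= C0)) => l.
  have h2 : \forall z \near z0, forall i, rn (c (j, l) i z) <= C0.
    apply: (near_all (P := fun i z => rn (c (j, l) i z) <= C0)) => i.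
    apply: filterS (hB (j, l, i)) => z /= hz; apply: le_trans hz _.
    apply: le_trans (ler_norm _) _; rewrite /C0 (bigD1 (j, l, i)) //= lerDl.
    exact: sumr_ge0.
  by have [_ h1] := hc (j, l); apply: filterS2 h1 h2 => z.
have [a a0 ha] : exists2 a : R, 0 < a & forall t, rn t < a ->
    rn t < e1 /\ rn (Q t - z0) < Num.min b del.
  have [q1 q2 q3 q4 q5] := hQ 0 e1_0.
  have m0 : 0 < Num.min b del by rewrite lt_min b0.
  have [a a0 ha] := proj1 (contE _ _) (holo_map_cont q3) _ m0.
  exists (Num.min a e1); first by rewrite lt_min a0.
  move=> t; rewrite lt_min => /andP[t1 t2]; split=> //.
  by have := ha t; rewrite subr0 Q0; apply.
have [e e0 he] : exists2 e : R, 0 < e & forall t, rn t < e -> forall j, G j t = 0.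
  apply: (@gronwall a C0) => //.
  - by move=> j; exact: hG.
  - by move=> j; rewrite /G Q0; exact: Az0.2.
  move=> t /ha[t1 t2] j l; exists (fun i => c (j, l) i (Q t)).
  have [_ q2 _ _ _] := hQ t t1.
  move: t2; rewrite lt_min => /andP[t2 _]; have [h1 h2] := hb _ t2 j l.
  have E : h (j, l) (Q t) = 'd (G j) t (delta_mx 0 l) by rewrite /h q2.
  split; first exact: h2.
  exact: etrans (esym E) h1.
exists d, P, Q, (Num.min e a), del; split=> //.
- by rewrite lt_min e0.
- exact: P_z0.
- exact: holo_P.
move=> t; rewrite lt_min => /andP[/he t1 /ha[t2 t3]].
have [q1 q2 q3 q4 q5] := hQ t t2; split=> //.
  by move: t3; rewrite lt_min => /andP[].
by split; [exact: hD|].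
Qed.

End ConstRank.

(** * Regular and singular points of complex spaces *)

Lemma near_open (T : topologicalType) (x : T) (P : T -> Prop) : (\forall y \near x, P y) ->
  exists B : set T, [/\ open B, B x & forall y, B y -> P y].
Proof.
move=> h; have : nbhs x [set y | P y] := h.
by rewrite nbhsE => -[B [oB Bx] BP]; exists B; split.
Qed.

Lemma dense_near (T : topologicalType) (S : set T) (x : T) (P : T -> Prop) : dense S ->
  (\forall y \near x, P y) -> exists y, P y /\ S y.
Proof.
move=> dS /near_open[B [oB Bx BP]].
by have [y [By Sy]] := dS B (ex_intro _ x Bx) oB; exists y; split; [exact: BP|].
Qed.

Section Charts.
Variable R : realType.
Local Notation K := (C R).

Section OneChart.
Variables (X : complexSpace R) (n : nat) (N : set X) (A : set 'rV[K]_n)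
  (phi : X -> 'rV[K]_n) (psi : 'rV[K]_n -> X).
Hypothesis ch : is_chart (@hol R X) N A phi psi.

Lemma chart_near x : N x -> \forall y \near x, N y.
Proof. by move=> Nx; apply: open_nbhs_nbhs; split; [exact: chart_open ch|]. Qed.

Lemma chart_near_to x (P : 'rV[K]_n -> Prop) : N x -> (\forall w \near phi x, P w) ->
  \forall y \near x, P (phi y).
Proof. by move=> Nx h; exact: (chart_to_cont ch Nx h). Qed.

Lemma chart_near_of w (P : X -> Prop) : A w -> (\forall y \near psi w, P y) ->
  \forall v \near w, A v -> P (psi v).
Proof.
move=> Aw h; have := proj1 (subspace_continuousP A psi) (chart_of_cont ch) w Aw.
by move=> /(_ P h).
Qed.

Lemma chart_near_of' x (P : X -> Prop) : N x -> (\forall y \near x, P y) ->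
  \forall v \near phi x, A v -> P (psi v).
Proof.
move=> Nx h; apply: chart_near_of; first exact: chart_to ch _ Nx.
by rewrite (chart_toK ch Nx).
Qed.

Lemma hol_chart x (h : 'rV[K]_n -> K) : N x -> holo h (phi x) -> hol x (fun y => h (phi y)).
Proof.
move=> Nx hh; apply: (proj2 (chart_hol ch _ Nx)); exists h; split=> //.
exact: filterE.
Qed.

Lemma reg_of_section x d (P : 'rV[K]_n -> 'rV[K]_d) (Q : 'rV[K]_d -> 'rV[K]_n) (e del : R) :
  N x -> 0 < e -> 0 < del -> P (phi x) = 0 -> (forall w, holo_map P w) ->
  (forall t, rn t < e -> [/\ rn (Q t - phi x) < del, A (Q t), P (Q t) = t & holo_map Q t]) ->
  (forall w, A w -> rn (w - phi x) < del -> Q (P w) = w) -> reg X x.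
Proof.
move=> Nx e0 del0 P0 hP hQ hPQ.
pose N' : set X := [set y | [/\ N y, rn (phi y - phi x) < del & rn (P (phi y)) < e]].
pose D' : set 'rV[K]_d := [set t | rn t < e].
have nearP y : N' y -> \forall w \near phi y, rn (w - phi x) < del /\ rn (P w) < e.
  move=> [Ny h1 h2].
  have c1 : \forall w \near phi y, rn (w - phi x) < del.
    apply/near_rnP; exists (del - rn (phi y - phi x)); first by rewrite subr_gt0.
    by move=> w hw; apply: le_lt_trans (rn_tri (phi y) _ _) _; rewrite -ltrBrDr.
  have c2 : \forall w \near phi y, rn (P w) < e.
    have pos : 0 < e - rn (P (phi y)) by rewrite subr_gt0.
    have [b b0 hb] := proj1 (contE _ _) (holo_map_cont (hP (phi y))) _ pos.
    apply/near_rnP; exists b => // w /hb hw.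
    by rewrite -[P w](subrK (P (phi y))); apply: le_lt_trans (rnD _ _) _; rewrite -ltrBrDr.
  by apply: filterS2 c1 c2.
have nearN' y : N' y -> \forall y' \near y, N' y'.
  move=> hy; have [Ny _ _] := hy.
  by apply: filterS2 (chart_near Ny) (chart_near_to Ny (nearP y hy)) => y' h1 [h2 h3].
exists d, N', D', (fun y => P (phi y)), (fun t => psi (Q t)); split.
- apply/open_rnP => t ht; exists (e - rn t); first by rewrite subr_gt0.
  move=> s hs; rewrite /D' /= -[s](subrK t); apply: le_lt_trans (rnD _ _) _.
  by rewrite -ltrBrDr.
- split.
  + by rewrite openE => y; exact: nearN'.
  + by move=> y [].
  + move=> t ht; have [q1 q2 q3 q4] := hQ t ht; split.
    * exact: chart_of ch _ q2.
    * by rewrite (chart_ofK ch q2).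
    * by rewrite (chart_ofK ch q2) q3.
  + move=> y [Ny h1 h2]; rewrite hPQ //; first exact: chart_toK ch _ Ny.
    exact: chart_to ch _ Ny.
  + by move=> t ht; have [q1 q2 q3 q4] := hQ t ht; rewrite (chart_ofK ch q2).
  + move=> y [Ny h1 h2]; apply: (@continuous_comp _ _ _ phi P).
      exact: chart_to_cont ch _ Ny.
    exact: holo_map_cont.
  + apply/subspace_continuousP => t ht O hO; have [q1 q2 q3 q4] := hQ t ht.
    have := near_comp (holo_map_cont q4) (chart_near_of q2 hO).
    move=> h; apply: filterS h => s h Ds; apply: h.
    by have [] := hQ s Ds.
  move=> y g N'y; have [Ny h1 h2] := N'y.
  have Ay : A (phi y) by exact: chart_to ch _ Ny.
  have E := hPQ _ Ay h1.
  split.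
    move=> /(chart_hol ch _ Ny)[h [hh gh]]; exists (fun t => h (Q t)); split.
      apply: (holo_comp (F := Q)); last by rewrite E.
      by have [] := hQ _ h2.
    apply: filterS2 gh (nearN' y N'y) => y' -> [Ny' h1' h2'].
    by rewrite hPQ //; exact: chart_to ch _ Ny'.
  move=> [h [hh gh]]; apply: (proj2 (chart_hol ch _ Ny)); exists (fun w => h (P w)); split=> //.
  exact: (holo_comp (F := P)).
by split; rewrite ?subrr ?P0 ?rn0.
Qed.

End OneChart.

Lemma open_reg (X : complexSpace R) : open (reg X).
Proof.
rewrite openE => x [n [N [D [phi [psi [oD ch Nx]]]]]].
apply: filterS (chart_near ch Nx) => y Ny.
by exists n, N, D, phi, psi.
Qed.

Record model_data n (A : set 'rV[K]_n) (D : set 'rV[K]_n) k (F : 'I_k -> 'rV[K]_n -> K) : Prop :=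
  ModelData {
  md_open : open D;
  md_diff : forall j z, D z -> differentiable (F j) z;
  md_eq : A = [set z | D z /\ forall j, F j z = 0];
  md_rad : forall a (h : 'rV[K]_n -> K), A a ->
        (\forall z \near a, differentiable h z) ->
        (\forall z \near a, A z -> h z = 0) ->
        exists c : 'I_k -> 'rV[K]_n -> K,
          (forall j, \forall z \near a, differentiable (c j) z) /\
          \forall z \near a, h z = \sum_j c j z * F j z }.

Lemma model_ex n (A : set 'rV[K]_n) : is_model A -> exists D k F, @model_data n A D k F.
Proof. by move=> [D [k [F [h1 h2 h3 h4]]]]; exists D, k, F; split. Qed.

(** With no equation at all, so that charts of the regular part fall under the same results as
    models. *)
Lemma model_open n (D : set 'rV[K]_n) : open D -> @model_data n D D 0 (fun _ _ => 0).
Proof.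
move=> oD; split=> [//|[]//||a h Da hh h0].
  by apply/seteqP; split=> z; [move=> Dz; split=> // -[] | case].
exists (fun _ _ => 0); split; first by move=> [].
have := open_nbhs_nbhs (conj oD Da); apply: filterS2 h0 => z h1 /h1 ->.
by rewrite big_ord0.
Qed.

Section Model.
Variables (n : nat) (A D : set 'rV[K]_n) (k : nat) (F : 'I_k -> 'rV[K]_n -> K).
Hypothesis md : model_data A D F.

Lemma model_holo j z : A z -> holo (F j) z.
Proof.
move=> Az; apply: (holo_F (md_open md) (md_diff md)).
by move: Az; rewrite (md_eq md) => -[].
Qed.

Lemma model_D z : A z -> D z.
Proof. by rewrite (md_eq md) => -[]. Qed.

Lemma model_0 j z : A z -> F j z = 0.
Proof. by rewrite (md_eq md) => -[]. Qed.

(** The infinitesimal form of reducedness: as [h] is [\sum_j c j * F j] near [a] and [F j a = 0],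
    only [\sum_j c j a * 'd (F j) a] remains. *)
Lemma model_d0 a (h : 'rV[K]_n -> K) (u : 'rV[K]_n) : A a -> holo h a ->
  (\forall z \near a, A z -> h z = 0) -> u *m jac F a = 0 -> 'd h a u = 0.
Proof.
move=> Aa hh h0 u0; have [c [hc hE]] := md_rad md Aa hh h0.
have I (s : seq 'I_k) : isd (fun z => \sum_(j <- s) c j z * F j z) a (fun u => \sum_(j <- s) c j a * 'd (F j) a u).
  elim: s => [|j s IH].
    have -> : (fun z => \sum_(j <- [::]) c j z * F j z) = (fun=> 0) by apply: funext => z; rewrite big_nil.
    by have := isd_cst 0 a; congr isd; apply: funext => z; rewrite big_nil.
  have -> : (fun z => \sum_(j <- j :: s) c j z * F j z) = (fun z => c j z * F j z + \sum_(j <- s) c j z * F j z).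
    by apply: funext => z; rewrite big_cons.
  have := isdD (isdM (holo_isd (hc j)) (holo_isd (model_holo j Aa))) IH.
  by congr isd; apply: funext => v; rewrite big_cons (model_0 j Aa) mul0r addr0.
have hE' : \forall z \near a, \sum_j c j z * F j z = h z by apply: filterS hE => z ->.
have /isd_val E := isd_near hE' (I (index_enum 'I_k)).
apply: etrans (congr1 (fun L : 'rV[K]_n -> K => L u) E) _.
by rewrite big1 // => j _; rewrite -jacE u0 mxE mulr0.
Qed.

Lemma model_const_rank (X : complexSpace R) (N : set X) phi psi x : is_chart (@hol R X) N A phi psi -> N x ->
  (\forall w \near phi x, A w -> (\rank (jac F w) <= \rank (jac F (phi x)))%N) -> reg X x.
Proof.
move=> ch Nx crk; have Ax := chart_to ch Nx.
have AE := md_eq md.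
have := @const_rank R n k D F (md_open md) (md_diff md).
rewrite -AE => /(_ (md_rad md) (phi x) Ax crk).
move=> [d [P [Q [e [del [[e0 d0] P0 hP hQ hPQ]]]]]].
exact: (@reg_of_section X n N A phi psi ch x d P Q e del).
Qed.

End Model.

Section TwoCharts.
Variables (X : complexSpace R) (x : X).
Variables (n1 : nat) (N1 : set X) (A1 D1 : set 'rV[K]_n1) (phi1 : X -> 'rV[K]_n1)
  (psi1 : 'rV[K]_n1 -> X) (k1 : nat) (F1 : 'I_k1 -> 'rV[K]_n1 -> K).
Variables (n2 : nat) (N2 : set X) (A2 D2 : set 'rV[K]_n2) (phi2 : X -> 'rV[K]_n2)
  (psi2 : 'rV[K]_n2 -> X) (k2 : nat) (F2 : 'I_k2 -> 'rV[K]_n2 -> K).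
Hypotheses (ch1 : is_chart (@hol R X) N1 A1 phi1 psi1) (md1 : model_data A1 D1 F1) (N1x : N1 x).
Hypotheses (ch2 : is_chart (@hol R X) N2 A2 phi2 psi2) (md2 : model_data A2 D2 F2) (N2x : N2 x).

Lemma transition_map : exists H : 'rV[K]_n1 -> 'rV[K]_n2,
  holo_map H (phi1 x) /\ \forall y \near x, phi2 y = H (phi1 y).
Proof.
have /choice[h hh] : forall l : 'I_n2, exists h : 'rV[K]_n1 -> K,
    holo h (phi1 x) /\ \forall y \near x, phi2 y 0 l = h (phi1 y).
  move=> l; apply: (proj1 (chart_hol ch1 (fun y => phi2 y 0 l) N1x)).
  apply: (hol_chart ch2 (h := fun w => w 0 l) N2x); exact: holo_coord.
exists (fun w => \row_l h l w); split.
  move=> l; have [h1 _] := hh l; apply: holo_near_eq h1.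
  by apply: filterE => w; rewrite mxE.
have H (s : seq 'I_n2) : \forall y \near x, forall l, l \in s -> phi2 y 0 l = h l (phi1 y).
  elim: s => [|l s IH]; first exact: filterE.
  have [_ h2] := hh l; apply: filterS2 IH h2 => y i1 i2 l'.
  by rewrite inE => /predU1P[->|/i1].
apply: filterS (H (enum 'I_n2)) => y hy; apply/rowP => l; rewrite mxE; apply: hy.
by rewrite mem_enum.
Qed.
End TwoCharts.

Section KerDim.
Variables (X : complexSpace R) (x : X).
Variables (n1 : nat) (N1 : set X) (A1 D1 : set 'rV[K]_n1) (phi1 : X -> 'rV[K]_n1)
  (psi1 : 'rV[K]_n1 -> X) (k1 : nat) (F1 : 'I_k1 -> 'rV[K]_n1 -> K).
Variables (n2 : nat) (N2 : set X) (A2 D2 : set 'rV[K]_n2) (phi2 : X -> 'rV[K]_n2)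
  (psi2 : 'rV[K]_n2 -> X) (k2 : nat) (F2 : 'I_k2 -> 'rV[K]_n2 -> K).
Hypotheses (ch1 : is_chart (@hol R X) N1 A1 phi1 psi1) (md1 : model_data A1 D1 F1) (N1x : N1 x).
Hypotheses (ch2 : is_chart (@hol R X) N2 A2 phi2 psi2) (md2 : model_data A2 D2 F2) (N2x : N2 x).

(** The transition maps are inverse to each other on the models only, so their differentials need
    not compose to the identity. By [model_d0] they do so on the kernel of the Jacobian, which is
    the Zariski tangent space, and they map kernel to kernel. *)
Lemma ker_dim_le :
  (\rank (kermx (jac F1 (phi1 x))) <= \rank (kermx (jac F2 (phi2 x))))%N.
Proof.
have [H [hH HE]] := transition_map ch1 N1x ch2 N2x.
have [H' [hH' HE']] := transition_map ch2 N2x ch1 N1x.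
have A1x := chart_to ch1 N1x; have A2x := chart_to ch2 N2x.
have Hx : H (phi1 x) = phi2 x by rewrite (nbhs_singleton HE).
have dH := holo_map_isd hH; have dH' := holo_map_isd hH'.
pose L := 'd H (phi1 x); pose L' := 'd H' (phi2 x).
have hH'x : holo_map H' (H (phi1 x)) by rewrite Hx.
have dH'x : isd H' (H (phi1 x)) L' by rewrite Hx.
have a1 u : u *m jac F1 (phi1 x) = 0 -> L' (L u) = u.
  move=> u0; apply/rowP => i.
  pose h w := H' (H w) 0 i - w 0 i.
  have hcomp : holo_map (fun w => H' (H w)) (phi1 x).
    exact: holo_map_comp hH hH'x.
  have hh : holo h (phi1 x) by apply: holoB; [exact: hcomp|exact: holo_coord].
  have h0 : \forall w \near phi1 x, A1 w -> h w = 0.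
    have e1 : \forall y \near x, phi2 y = H (phi1 y) /\ phi1 y = H' (phi2 y) by apply: filterS2 HE HE'.
    have := chart_near_of' ch1 N1x e1; apply: filterS => w hw Aw; have [p1 p2] := hw Aw.
    move: p1 p2; rewrite (chart_ofK ch1 Aw) => p1 p2.
    by rewrite /h -p1 -p2 subrr.
  have := model_d0 md1 A1x hh h0 u0.
  have dc : isd (fun w => H' (H w)) (phi1 x) (fun u => L' (L u)).
    exact: isd_comp dH dH'x.
  have := isd_val (isdB (isd_row_coord i dc) (isd_coord (phi1 x) i)).
  move=> /(congr1 (fun L : 'rV[K]_n1 -> K => L u)) E E'.
  by apply/eqP; rewrite -subr_eq0; apply/eqP; apply: etrans (esym E) E'.
have a2 u : u *m jac F1 (phi1 x) = 0 -> L u *m jac F2 (phi2 x) = 0.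
  move=> u0; apply/rowP => j; rewrite jacE mxE.
  pose h w := F2 j (H w).
  have hF : holo (F2 j) (H (phi1 x)) by rewrite Hx; exact: model_holo md2 j _ A2x.
  have hh : holo h (phi1 x) by apply: (holo_comp (F := H)).
  have h0 : \forall w \near phi1 x, A1 w -> h w = 0.
    have e1 : \forall y \near x, phi2 y = H (phi1 y) /\ N2 y by apply: filterS2 HE (chart_near ch2 N2x).
    have := chart_near_of' ch1 N1x e1; apply: filterS => w hw Aw; have [p1 p2] := hw Aw.
    move: p1; rewrite (chart_ofK ch1 Aw) => p1.
    by rewrite /h -p1; apply: (model_0 md2); exact: chart_to ch2 _ p2.
  have := model_d0 md1 A1x hh h0 u0.
  have := isd_val (isd_comp dH (holo_isd hF)).
  move=> /(congr1 (fun L : 'rV[K]_n1 -> K => L u)) E E'.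
  by rewrite -Hx; apply: etrans (esym E) E'.
pose LL := lin1_mx ('d H (phi1 x)); pose LL' := lin1_mx ('d H' (phi2 x)).
have E u : u *m LL = L u by rewrite /LL mul_rV_lin1.
have E' u : u *m LL' = L' u by rewrite /LL' mul_rV_lin1.
set K1 := kermx _.
have rK i : row i K1 *m jac F1 (phi1 x) = 0.
  by rewrite -row_mul mulmx_ker row0.
have s1 : (K1 *m LL <= kermx (jac F2 (phi2 x)))%MS.
  apply/sub_kermxP/row_matrixP => i; rewrite row_mul row_mul E row0; apply: a2; exact: rK.
have s2 : K1 *m LL *m LL' = K1.
  apply/row_matrixP => i; rewrite row_mul row_mul E E'; apply: a1; exact: rK.
by rewrite -s2; apply: leq_trans (mxrankM_maxl _ _) (mxrankS s1).
Qed.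
End KerDim.

(** [tdim x m]: the Zariski tangent space of [X] at [x] has dimension [m]. *)
Definition tdim (X : complexSpace R) (x : X) (m : nat) : Prop :=
  exists n (N : set X) (A : set 'rV[K]_n) phi psi D k (F : 'I_k -> 'rV[K]_n -> K),
    [/\ is_chart (@hol R X) N A phi psi, model_data A D F, N x &
        m = \rank (kermx (jac F (phi x)))].

Lemma tdim_uniq (X : complexSpace R) (x : X) m m' : tdim x m -> tdim x m' -> m = m'.
Proof.
move=> [n [N [A [phi [psi [D [k [F [c md Nx ->]]]]]]]]].
move=> [n' [N' [A' [phi' [psi' [D' [k' [F' [c' md' Nx' ->]]]]]]]]].
apply/eqP; rewrite eqn_leq.
by rewrite (ker_dim_le c md Nx c' md' Nx') (ker_dim_le c' md' Nx' c md Nx).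
Qed.

Lemma tdim_reg_chart (X : complexSpace R) n (N : set X) (D : set 'rV[K]_n) phi psi x :
  open D -> is_chart (@hol R X) N D phi psi -> N x -> tdim x n.
Proof.
move=> oD ch Nx; exists n, N, D, phi, psi, D, 0%N, (fun _ _ => 0); split=> //.
  exact: model_open.
rewrite mxrank_ker; have := rank_leq_col (jac (fun (_ : 'I_0) (_ : 'rV[K]_n) => 0 : K) (phi x)).
by rewrite leqn0 => /eqP ->; rewrite subn0.
Qed.

(** The rank of the Jacobian is at most [n], so it has a maximum on the part of the open set in the
    chart. Where it is attained, the constant rank theorem applies. *)
Lemma reg_dense (X : complexSpace R) : dense (reg X).
Proof.
move=> O [x Ox] oO.
have [n [N [A [phi [psi [mod ch Nx]]]]]] := complexSpace_charts x.
have [D [k [F md]]] := model_ex mod.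
pose P m := `[< exists y, [/\ N y, O y & \rank (jac F (phi y)) = m] >].
have exP : exists m, P m by exists (\rank (jac F (phi x))); apply/asboolP; exists x.
have bP m : P m -> (m <= n)%N by move=> /asboolP[y [_ _ <-]]; exact: rank_leq_row.
case: (ex_maxnP exP bP) => m /asboolP[y [Ny Oy rm]] mmax.
exists y; split=> //; apply: (model_const_rank md ch Ny).
have e1 : \forall y' \near y, N y' /\ O y'.
  by apply: filterS2 (chart_near ch Ny) (open_nbhs_nbhs (conj oO Oy)).
apply: filterS (chart_near_of' ch Ny e1) => w hw Aw; have [h1 h2] := hw Aw.
apply: leq_trans (mmax (\rank (jac F w)) _) (eq_leq (esym rm)).
apply/asboolP; exists (psi w); split; [exact: h1|exact: h2|].
by rewrite (chart_ofK ch Aw).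
Qed.

(** The points with a regular chart in dimension [m] form an open set [U m]; these sets are disjoint
    by [tdim_uniq], and connectedness leaves only one. *)
Lemma irreducible_dim (X : complexSpace R) : irreducible X ->
  exists d, forall x : X, reg X x -> tdim x d.
Proof.
move=> [[x0 rx0] con].
have [d [N0 [D0 [phi0 [psi0 [oD0 ch0 Nx0]]]]]] := rx0.
pose U m : set X := [set x | exists (N : set X) (D : set 'rV[K]_m) phi psi,
  [/\ open D, is_chart (@hol R X) N D phi psi & N x]].
have oU m : open (U m).
  rewrite openE => x [N [D [phi [psi [oD ch Nx]]]]].
  by apply: filterS (chart_near ch Nx) => y Ny; exists N, D, phi, psi.
have Ut m x : U m x -> tdim x m.
  by move=> [N [D [phi [psi [oD ch Nx]]]]]; exact: tdim_reg_chart oD ch Nx.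
have B0 : reg X `&` U d = reg X.
  apply: con.
  - by exists x0; split=> //; exists N0, D0, phi0, psi0.
  - by exists (U d).
  exists (~` \bigcup_(m in [set m | m != d]) U m).
    by apply: open_closedC; apply: bigcup_open => m _; exact: oU.
  apply/seteqP; split=> x [rx hx]; split=> //.
    by move=> [m /= /eqP md /Ut hm]; apply: md; exact: tdim_uniq hm (Ut _ _ hx).
  have [m [N [D [phi [psi hr]]]]] := rx.
  have Um : U m x by exists N, D, phi, psi.
  have [<- //|md] := eqVneq m d.
  by exfalso; apply: hx; exists m.
by exists d => x rx; apply: Ut; move: rx; rewrite -{1}B0 => -[].
Qed.

(** Genuine minors this time: their index functions are finite in number, as the finite list of
    equations in [sing_locus] demands. *)
Lemma det_rowsub_neq0 (F : fieldType) n k (M : 'M[F]_(n, k)) r : \rank M = r ->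
  exists (f : {ffun 'I_r -> 'I_n}) (g : {ffun 'I_r -> 'I_k}),
    \det (rowsub f 1%:M *m M *m colsub g 1%:M) != 0.
Proof.
move=> <-; pose f := maxrankfun M.
have fB : row_full (rowsub f M)^T by rewrite /row_full mxrank_tr; exact: maxrowsub_free M.
exists (finfun f), (finfun (fullrankfun fB)).
have -> : rowsub (finfun f) 1%:M = rowsub f 1%:M :> 'M[F]_(_, n).
  by apply/matrixP => i j; rewrite !mxE ffunE.
have -> : colsub (finfun (fullrankfun fB)) 1%:M = colsub (fullrankfun fB) 1%:M :> 'M[F]_(k, _).
  by apply/matrixP => i j; rewrite !mxE ffunE.
rewrite -rowsubE mulmx_colsub mulmx1.
have := fullrowsub_unit fB; rewrite -trmx_mxsub unitmx_tr unitmxE unitfE.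
by congr (\det _ != 0).
Qed.

(** With [d] the dimension of [X], the regular points are those where the Jacobian
    has rank [n - d], so the minors of this size are equations of [sing X]. *)
Lemma sing_locus (X : complexSpace R) (x : X) : irreducible X ->
  exists (N : set X) (m : nat) (g : 'I_m -> X -> K),
    [/\ open N, N x, forall i, hol_on N (g i) &
        forall y, N y -> (sing X y <-> forall i, g i y = 0)].
Proof.
move=> irr; have [d hd] := irreducible_dim irr.
have [n [N [A [phi [psi [mod ch Nx]]]]]] := complexSpace_charts x.
have [D [k [F md]]] := model_ex mod.
have rk y : N y -> reg X y -> (n - \rank (jac F (phi y)))%N = d /\ (d <= n)%N.
  move=> Ny ry; have t1 : tdim y (\rank (kermx (jac F (phi y)))).
    by exists n, N, A, phi, psi, D, k, F.
  by rewrite (tdim_uniq (hd y ry) t1) mxrank_ker leq_subr.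
pose r := (n - d)%N.
have regE y : N y -> (reg X y <-> (r <= \rank (jac F (phi y)))%N).
  move=> Ny; split=> [ry|hr].
    have [E _] := rk y Ny ry; rewrite /r -E subKn ?leqnn //; exact: rank_leq_row.
  apply: (model_const_rank md ch Ny); have Ay := chart_to ch Ny.
  apply: filterS (chart_near_of' ch Ny (chart_near ch Ny)) => w hw Aw; have Nw := hw Aw.
  (* A rank above [r] would persist in a neighbourhood, which contains a regular point, and there
     the rank is [r]. *)
  apply: leq_trans hr; rewrite leqNgt; apply/negP => lt.
  have Dw := model_D md Aw.
  have low := rank_lower (md_open md) (md_diff md) (1%:M : 'M[K]_k) Dw.
  have phiw := chart_ofK ch Aw.
  have low' : \forall y' \near psi w, N y' /\ (r < \rank (jac F (phi y')))%N.
    have low2 : \forall v \near phi (psi w), (r < \rank (jac F v))%N.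
      rewrite phiw.
      apply: filterS low => v.
      have e1 v' : \rank (jac F v' *m (1%:M : 'M[K]_k)) = \rank (jac F v') by exact: (congr1 (fun M : 'M[K]_(n, k) => \rank M) (mulmx1 (jac F v'))).
      move=> h; exact: leq_trans (leq_trans lt (eq_leq (esym (e1 w)))) (leq_trans h (eq_leq (e1 v))).
    have low3 := chart_near_to ch Nw low2.
    by apply: filterS2 (chart_near ch Nw) low3 => y' h1 h2; split; [exact: h1|exact: h2].
  have [y' [[Ny' lt'] ry']] : exists y', (N y' /\ (r < \rank (jac F (phi y')))%N) /\ reg X y'.
    by have [y' [h1 h2]] := dense_near (@reg_dense X) low'; exists y'.
  have [e1 e2] := rk y' Ny' ry'.
  by move: lt'; rewrite /r -e1 subKn ?ltnn //; exact: rank_leq_row.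
pose fg (e : 'I_#|{: {ffun 'I_r -> 'I_n} * {ffun 'I_r -> 'I_k}}|) := enum_val e.
pose U e : 'M[K]_(r, n) := rowsub (fg e).1 1%:M; pose V e : 'M[K]_(k, r) := colsub (fg e).2 1%:M.
exists N, _, (fun e y => \det (U e *m (jac F (phi y) *m 1%:M) *m V e)); split=> //.
- exact: chart_open ch.
- move=> e y Ny; have Dy := model_D md (chart_to ch Ny).
  exact: (hol_chart ch (h := fun w => \det (U e *m (jac F w *m 1%:M) *m V e)) Ny
    (holo_minor (md_open md) (md_diff md) 1%:M (U e) (V e) Dy)).
move=> y Ny; split.
  move=> sy e; apply/eqP/negPn/negP => h; apply: sy; apply/(regE y Ny).
  by apply: (rank_ge_det (U := U e) (V := V e)); move: h; rewrite /= mulmx1.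
move=> h ry; have [e1 e2] := rk y Ny ry.
have rkr : \rank (jac F (phi y)) = r by rewrite /r -e1 subKn //; exact: rank_leq_row.
have [f [g]] := det_rowsub_neq0 rkr; apply/negP/negPn/eqP.
by have := h (enum_rank (f, g)); rewrite /= mulmx1 /U /V /fg enum_rankK.
Qed.

End Charts.

(** * Density of the regular points with regular image *)

Section Density.
Variable R : realType.
Local Notation K := (C R).

Section RegChart.
Variables (X : complexSpace R) (n : nat) (N : set X) (D : set 'rV[K]_n)
  (phi : X -> 'rV[K]_n) (psi : 'rV[K]_n -> X).
Hypotheses (ch : is_chart (@hol R X) N D phi psi) (oD : open D).

Lemma rchart_near_of w (P : X -> Prop) : D w -> (\forall y \near psi w, P y) ->
  \forall v \near w, P (psi v).
Proof.
move=> Dw h; have Dv := open_nbhs_nbhs (conj oD Dw).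
by apply: filterS2 (chart_near_of ch Dw h) Dv => v hv; exact: hv.
Qed.

Lemma rchart_reg y : N y -> reg X y.
Proof. by move=> Ny; exists n, N, D, phi, psi. Qed.

Lemma rchart_holo w g : D w -> hol (psi w) g -> holo (fun v => g (psi v)) w.
Proof.
move=> Dw; have Nw := chart_of ch Dw.
move=> /(chart_hol ch _ Nw)[h]; rewrite (chart_ofK ch Dw) => -[hh gh].
apply: holo_near_eq hh; have Dv := open_nbhs_nbhs (conj oD Dw).
have e1 := rchart_near_of Dw gh.
apply: filterS2 e1 Dv => v -> Dv'; by rewrite (chart_ofK ch Dv').
Qed.

End RegChart.

Lemma holomorphic_near (X Y : complexSpace R) (f : X -> Y) x (P : Y -> Prop) : holomorphic f ->
  (\forall y \near f x, P y) -> \forall y \near x, P (f y).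
Proof. by move=> hf h; have [c _] := hf x I; exact: (c _ h). Qed.

(** The set of regular points near which [f] takes singular values is closed in the
    regular part, by the identity theorem applied to equations of [sing Y]. *)
Lemma dense_regular_preimage (X Y : complexSpace R) (f : X -> Y) :
  irreducible X -> irreducible Y -> holomorphic f -> ~ (range f `<=` sing Y) ->
  dense (reg X `&` f @^-1` reg Y).
Proof.
move=> irX irY hf nsing O O0 oO.
have oG : open (f @^-1` reg Y).
  rewrite openE => x fx; apply: (holomorphic_near (f := f)) => //.
  exact: open_nbhs_nbhs (conj (open_reg Y) fx).
(* The point [x1] will be the one that refutes [B = reg X]. *)
have [x1 [f1 r1]] : exists x, reg Y (f x) /\ reg X x.
  have [x0 hx0] : exists x, reg Y (f x).
    apply: contrapT => h; apply: nsing => _ [x _ <-] ry; apply: h; by exists x.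
  have [x [h1 h2]] := reg_dense (ex_intro _ x0 hx0 : (f @^-1` reg Y) !=set0) oG.
  by exists x.
apply: contrapT => nO.
have [x0 [Ox0 rx0]] := reg_dense O0 oO.
pose S : set X := [set y | reg X y -> sing Y (f y)].
pose B : set X := reg X `&` S°.
have Bx0 : B x0.
  split=> //; apply: filterS (open_nbhs_nbhs (conj oO Ox0)) => y Oy ry fy.
  by apply: nO; exists y.
have BX : B = reg X.
  have [_ con] := irX; apply: con; first by exists x0.
    by exists S°; first exact: open_interior.
  exists (closure B); first exact: closed_closure.
  apply/seteqP; split=> x; first by move=> Bx; split; [case: Bx|exact: subset_closure].
  move=> [rx cx]; split=> //.
  have [N' [m [g [oN' N'fx hg sg]]]] := sing_locus (f x) irY.
  have [n [N [D [phi [psi [oD ch Nx]]]]]] := rx.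
  have Dx := chart_to ch Nx; have psix := chart_toK ch Nx.
  have /choice[h hh] : forall i, exists h, [/\ holo h (phi x) & \forall y \near x, g i (f y) = h (phi y)].
    move=> i; have [_ hfx] := hf x I.
    by have [h [h1 h2]] := proj1 (chart_hol ch (g i \o f) Nx) (hfx _ (hg i _ N'fx)); exists h.
  have hz i : \forall w \near phi x, h i w = 0.
    have [h1 h2] := hh i.
    (* The radius is fixed before the point [b] of [B] is chosen close to [x]. *)
    have [d d0 hd] := identity_near h1.
    have nd : \forall w \near phi x, rn (w - phi x) < d by apply/near_rnP; exists d.
    have nQ : \forall y \near x, [/\ g i (f y) = h i (phi y), rn (phi y - phi x) < d, N y & N' (f y)].
      have q1 := chart_near_to ch Nx nd; have q2 := chart_near ch Nx.
      have q3 : \forall y \near x, N' (f y).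
        by apply: holomorphic_near => //; exact: open_nbhs_nbhs (conj oN' N'fx).
      near=> y; split; near: y; [exact: h2|exact: q1|exact: q2|exact: q3].
    have [Q [oQ Qx hQ]] := near_open nQ.
    have [b [[rb Sb] Qb]] := cx Q (open_nbhs_nbhs (conj oQ Qx)).
    have [e1 e2 Nb e4] := hQ b Qb.
    have Db := chart_to ch Nb.
    have zc : \forall v \near phi b, h i v = 0.
      have t0 : \forall y \near b, Q y /\ S y.
        by apply: filterS2 (open_nbhs_nbhs (conj oQ Qb)) Sb.
      rewrite -(chart_toK ch Nb) in t0.
      have t1 := rchart_near_of ch oD Db t0.
      apply: filterS2 t1 (open_nbhs_nbhs (conj oD Db)) => v [Qv Sv] Dv.
      have [u1 u2 u3 u4] := hQ _ Qv.
      have := Sv (rchart_reg ch oD u3); move=> /(sg _ u4)/(_ i).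
      by rewrite u1 (chart_ofK ch Dv).
    by apply: filterS nd => w; exact: hd zc _.
  have a3 : \forall y \near x, forall i, g i (f y) = 0.
    have b1 i : \forall w \near phi x, g i (f (psi w)) = 0.
      have [_ h2] := hh i.
      rewrite -[in (\near x, _)]psix in h2.
      have c1 := rchart_near_of ch oD Dx h2.
      have c2 := open_nbhs_nbhs (conj oD Dx).
      near=> w; have -> : g i (f (psi w)) = h i (phi (psi w)) by near: w.
      have Dw : D w by near: w.
      rewrite (chart_ofK ch Dw); near: w; exact: hz.
    have b2 := chart_near_to ch Nx (near_all b1).
    apply: filterS2 b2 (chart_near ch Nx) => y hy Ny i.
    by have := hy i; rewrite (chart_toK ch Ny).
  have a4 : \forall y \near x, N' (f y).
    by apply: holomorphic_near => //; exact: open_nbhs_nbhs (conj oN' N'fx).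
  by apply: filterS2 a3 a4 => y hy Ny _; apply/(sg _ Ny).
have : B x1 by rewrite BX.
by move=> [_ /nbhs_singleton]; apply.
Unshelve. all: by end_near.
Qed.

End Density.

(** * Holomorphic forms *)

Section Cartan.
Variable R : realType.
Local Notation K := (C R).
Variable V : normedModType K.

Lemma isd_sum (I : Type) (r : seq I) (F L : I -> V -> K) a : (forall i, isd (F i) a (L i)) ->
  isd (fun z => \sum_(i <- r) F i z) a (fun u => \sum_(i <- r) L i u).
Proof.
move=> h; elim: r => [|i r IH].
  have -> : (fun z => \sum_(i <- [::]) F i z) = (fun=> 0) by apply: funext => z; rewrite big_nil.
  by have := isd_cst 0 a; congr isd; apply: funext => z; rewrite big_nil.
have -> : (fun z => \sum_(i <- i :: r) F i z) = (fun z => F i z + \sum_(i <- r) F i z).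
  by apply: funext => z; rewrite big_cons.
by have := isdD (h i) IH; congr isd; apply: funext => u; rewrite big_cons.
Qed.

Lemma isd_prod q (F L : 'I_q -> V -> K) a : (forall i, isd (F i) a (L i)) ->
  isd (fun z => \prod_i F i z) a
      (fun u => \sum_j \prod_k (if k == j then L k u else F k a)).
Proof.
elim: q F L => [|q IH] F L h.
  have -> : (fun z => \prod_i F i z) = (fun=> 1) by apply: funext => z; rewrite big_ord0.
  by have := isd_cst 1 a; congr isd; apply: funext => z; rewrite big_ord0.
have -> : (fun z => \prod_i F i z) = (fun z => F ord0 z * \prod_(i < q) F (lift ord0 i) z).
  by apply: funext => z; rewrite big_ord_recl.
have := isdM (h ord0) (IH (fun i => F (lift ord0 i)) (fun i => L (lift ord0 i)) (fun i => h _)).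
congr isd; apply: funext => u; rewrite big_ord_recl big_ord_recl eqxx mulr_sumr addrC; congr (_ + _).
  by rewrite mulrC.
by apply: eq_bigr => j _; rewrite big_ord_recl eq_liftF.
Qed.

(** For each [j], composing [w] with the transposition of [ord0] and [lift ord0 j] changes the sign
    and exchanges the two vectors in the second derivative of [h j]. By symmetry of that derivative
    the sum is its own opposite. *)
Lemma alternating_d2 q (h : 'I_q -> V -> K) a (xi : 'I_q.+1 -> V) : (forall i, holo (h i) a) ->
  \sum_(w : 'S_q.+1) (-1) ^+ w * (\sum_j \prod_k
    (if k == j then 'd (fun t => 'd (h k) t (xi (w (lift ord0 k)))) a (xi (w ord0))
     else 'd (h k) a (xi (w (lift ord0 k))))) = 0 :> K.
Proof.
move=> hh; under eq_bigr do rewrite mulr_sumr.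
rewrite exchange_big big1 // => j _; apply/eqP; rewrite -eqNr; apply/eqP.
rewrite [RHS](reindex_inj (mulgI (tperm ord0 (lift ord0 j)))) /= -sumrN.
apply: eq_bigr => w _; rewrite odd_mul_tperm neq_lift signr_addb expr1 mulN1r mulNr; congr (- (_ * _)).
apply: eq_bigr => k _; rewrite !permM tpermL; case: (k =P j) => [->|/eqP kj].
  by rewrite tpermR; exact: (d_sym (xi (w ord0)) (xi (w (lift ord0 j))) (hh j)).
by rewrite tpermD // ?neq_lift // (inj_eq lift_inj) eq_sym.
Qed.

(** [d] on constant vector fields: the second derivatives of the [h j] cancel in
    pairs. *)
Lemma det_d_alternating q (g : V -> K) (h : 'I_q -> V -> K) a (xi : 'I_q.+1 -> V) :
  holo g a -> (forall i, holo (h i) a) ->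
  \sum_(w : 'S_q.+1) (-1) ^+ w *
    'd (fun t => g t * \det (\matrix_(i < q, j < q) 'd (h j) t (xi (w (lift ord0 i))))) a (xi (w ord0))
  = q`!%:R * \det (\matrix_(i < q.+1, j < q.+1)
      'd (if unlift ord0 j is Some j' then h j' else g) a (xi i)) :> K.
Proof.
move=> hg hh.
pose G w u := \prod_k 'd (h k) a (xi (w (lift ord0 k))) * 'd g a u + g a * (\sum_j \prod_k
    (if k == j then 'd (fun t => 'd (h k) t (xi (w (lift ord0 k)))) a u
     else 'd (h k) a (xi (w (lift ord0 k))))).
have dG (w : 'I_q.+1 -> 'I_q.+1) :
    isd (fun t => g t * \prod_k 'd (h k) t (xi (w (lift ord0 k)))) a (G w).
  have := isdM (holo_isd hg) (isd_prod (fun k => holo_isd (holo_d (xi (w (lift ord0 k))) (hh k)))).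
  by congr isd; apply: funext => u; rewrite /G addrC mulrC.
(* A permutation [s] from the expansion of the determinant is absorbed into [w] as a permutation
   fixing [ord0]. All [s] then contribute the same sum, whence the factorial. *)
pose up (s : 'S_q) : 'S_q.+1 := lift_perm ord0 ord0 s.
have E (w : 'S_q.+1) : isd (fun t => g t * \det (\matrix_(i < q, j < q) 'd (h j) t (xi (w (lift ord0 i))))) a
    (fun u => \sum_(s : 'S_q) (-1) ^+ s * G (up s * w)%g u).
  have -> : (fun t => g t * \det (\matrix_(i < q, j < q) 'd (h j) t (xi (w (lift ord0 i))))) =
      (fun t => \sum_(s : 'S_q) (-1) ^+ s * (g t * \prod_k 'd (h k) t (xi ((up s * w)%g (lift ord0 k))))).
    apply: funext => t; rewrite -det_tr /determinant mulr_sumr; apply: eq_bigr => s _.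
    rewrite mulrCA; congr (_ * (_ * _)); apply: eq_bigr => k _.
    by rewrite !mxE permM lift_perm_lift.
  by apply: isd_sum => s; apply: isdZ; exact: dG.
have -> : \sum_(w : 'S_q.+1) (-1) ^+ w *
    'd (fun t => g t * \det (\matrix_(i < q, j < q) 'd (h j) t (xi (w (lift ord0 i))))) a (xi (w ord0))
  = \sum_(w : 'S_q.+1) (-1) ^+ w * \sum_(s : 'S_q) (-1) ^+ s * G (up s * w)%g (xi (w ord0)) :> K.
  apply: eq_bigr => w _; congr (_ * _).
  exact: (congr1 (fun L : V -> K => L (xi (w ord0))) (isd_val (E w))).
under eq_bigr do rewrite mulr_sumr.
rewrite exchange_big /=.
have S0 : \sum_(w : 'S_q.+1) (-1) ^+ w * G w (xi (w ord0)) =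
    \det (\matrix_(i < q.+1, j < q.+1) 'd (if unlift ord0 j is Some j' then h j' else g) a (xi i)).
  transitivity (\sum_(w : 'S_q.+1) (-1) ^+ w *
      (\prod_k 'd (h k) a (xi (w (lift ord0 k))) * 'd g a (xi (w ord0)))).
    rewrite /G; under eq_bigr do rewrite mulrDr.
    rewrite big_split /=; apply: etrans (congr1 (fun c => _ + c) _) (addr0 _).
    under eq_bigr do rewrite mulrCA.
    by rewrite -mulr_sumr alternating_d2 // mulr0.
  rewrite -det_tr /determinant; apply: eq_bigr => w _; congr (_ * _).
  rewrite big_ord_recl !mxE unlift_none mulrC; congr (_ * _).
  by apply: eq_bigr => k _; rewrite !mxE liftK.
rewrite (eq_bigr (fun=> \sum_(w : 'S_q.+1) (-1) ^+ w * G w (xi (w ord0)))).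
  by rewrite sumr_const S0 card_Sn mulr_natl.
move=> s _; rewrite [RHS](reindex_inj (mulgI (up s))); apply: eq_bigr => w _ /=.
rewrite odd_permM odd_lift_perm /= signr_addb permM lift_perm_id.
by rewrite [(-1) ^+ w * _]mulrCA mulrA.
Qed.

End Cartan.

(** * Determinants behind the exterior product *)

Section Shuffle.
Variable F : comNzRingType.

(** The sign is read off from the determinant of a block diagonal permutation matrix. *)
Lemma perm_sum r s (u : 'S_r) (w : 'S_s) : exists p : 'S_(r + s),
  [/\ forall i, p (lshift s i) = lshift s (u i), forall i, p (rshift r i) = rshift r (w i) &
      (-1) ^+ p = (-1) ^+ u * (-1) ^+ w :> F].
Proof.
pose f (a : 'I_r -> 'I_r) (b : 'I_s -> 'I_s) (k : 'I_(r + s)) : 'I_(r + s) :=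
  match fintype.split k with inl i => lshift s (a i) | inr j => rshift r (b j) end.
have fl a b i :  f a b (lshift s i) = lshift s (a i) by rewrite /f (unsplitK (inl i)).
have fr a b i : f a b (rshift r i) = rshift r (b i) by rewrite /f (unsplitK (inr i)).
have finj : injective (f u w).
  apply: (can_inj (g := f (u^-1)%g (w^-1)%g)) => k; rewrite -(splitK k).
  by case: (fintype.split k) => i /=; rewrite ?fl ?fr ?fl ?fr permK.
exists (perm finj); split=> [i|i|]; rewrite ?permE //.
rewrite -!det_perm.
have -> : perm_mx (perm finj) = block_mx (perm_mx u) 0 0 (perm_mx w) :> 'M[F]_(r + s).
  apply/matrixP => i j; rewrite -(splitK i) -(splitK j).
  case: (fintype.split i) => i'; case: (fintype.split j) => j' /=; rewrite [LHS]mxE [LHS]mxE permE ?fl ?fr.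
  - by rewrite block_mxEul [RHS]mxE [RHS]mxE (inj_eq (@lshift_inj _ _)).
  - by rewrite block_mxEur !mxE eq_lrshift.
  - by rewrite block_mxEdl !mxE eq_rlshift.
  - by rewrite block_mxEdr [RHS]mxE [RHS]mxE (inj_eq (@rshift_inj _ _)).
by rewrite det_ublock.
Qed.

(** Laplace expansion over all permutations instead of shuffles: once both small determinants are
    expanded, [perm_sum] absorbs each pair of permutations into [w], and each pair yields the whole
    determinant. *)
Lemma det_shuffle r s (A : 'M[F]_(r + s, r)) (B : 'M[F]_(r + s, s)) :
  \sum_(w : 'S_(r + s)) (-1) ^+ w *
    (\det (\matrix_(i < r, j < r) A (w (lshift s i)) j) *
     \det (\matrix_(i < s, j < s) B (w (rshift r i)) j))
  = r`!%:R * s`!%:R * \det (row_mx A B).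
Proof.
pose G (w : 'S_(r + s)) := \prod_i A (w (lshift s i)) i * \prod_i B (w (rshift r i)) i.
have S0 : \sum_(w : 'S_(r + s)) (-1) ^+ w * G w = \det (row_mx A B).
  rewrite -[RHS]det_tr /determinant; apply: eq_bigr => w _; congr (_ * _).
  by rewrite big_split_ord /G; congr *%R; apply: eq_bigr => i _; rewrite [RHS]mxE ?row_mxEl ?row_mxEr.
have E w : \det (\matrix_(i < r, j < r) A (w (lshift s i)) j) *
     \det (\matrix_(i < s, j < s) B (w (rshift r i)) j) =
    \sum_(u : 'S_r) \sum_(v : 'S_s) (-1) ^+ u * (-1) ^+ v *
      (\prod_i A (w (lshift s (u i))) i * \prod_i B (w (rshift r (v i))) i).
  rewrite -det_tr -[X in _ * X]det_tr /determinant big_distrlr; apply: eq_bigr => u _; apply: eq_bigr => v _ /=.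
  by rewrite mulrACA; congr (_ * (_ * _)); apply: eq_bigr => i _; rewrite !mxE.
under eq_bigr do rewrite E mulr_sumr.
rewrite exchange_big (eq_bigr (fun=> \sum_(v : 'S_s) \det (row_mx A B))); last first.
  move=> u _; under eq_bigr do rewrite mulr_sumr.
  rewrite exchange_big; apply: eq_bigr => v _; rewrite -S0 /=.
  have [p [pl pr sp]] := perm_sum u v.
  rewrite [RHS](reindex_inj (mulgI p)); apply: eq_bigr => w _ /=.
  rewrite odd_permM signr_addb sp mulrA [(-1) ^+ w * _]mulrC; congr (_ * _).
  by rewrite /G; congr *%R; apply: eq_bigr => i _; rewrite permM ?pl ?pr.
by rewrite !sumr_const !card_Sn -!mulrnA mulnC -natrM mulr_natl.
Qed.
End Shuffle.

(** * Derivations of the stalks, read in charts *)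

Section Derivations.
Variable R : realType.
Local Notation K := (C R).
Variable X : complexSpace R.
Implicit Types (x : X) (g h : X -> K) (v : vec X).

Lemma hol_near x g h : hol x g -> (\forall y \near x, g y = h y) -> hol x h.
Proof.
move=> hg e; have [n [N [A [phi [psi [mod ch Nx]]]]]] := complexSpace_charts x.
have [u [hu gu]] := proj1 (chart_hol ch g Nx) hg.
apply: (proj2 (chart_hol ch h Nx)); exists u; split=> //.
by apply: filterS2 e gu => y -> .
Qed.

Lemma hol_op2 (op : K -> K -> K) :
  (forall n (a : 'rV[K]_n) f f', holo f a -> holo f' a -> holo (fun z => op (f z) (f' z)) a) ->
  forall x g h, hol x g -> hol x h -> hol x (fun y => op (g y) (h y)).
Proof.
move=> hop x g h hg hh; have [n [N [A [phi [psi [mod ch Nx]]]]]] := complexSpace_charts x.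
have [u [hu gu]] := proj1 (chart_hol ch g Nx) hg.
have [w [hw hw']] := proj1 (chart_hol ch h Nx) hh.
apply: (proj2 (chart_hol ch _ Nx)); exists (fun z => op (u z) (w z)); split; first exact: hop.
by apply: filterS2 gu hw' => y -> ->.
Qed.

Lemma hol_cst x (c : K) : hol x (fun=> c).
Proof.
have [n [N [A [phi [psi [mod ch Nx]]]]]] := complexSpace_charts x.
exact: (hol_chart ch (h := fun=> c) Nx (holo_cst c _)).
Qed.

Lemma hol_add x g h : hol x g -> hol x h -> hol x (fun y => g y + h y).
Proof. by apply: (hol_op2 (op := +%R)) => n a f f'; exact: holoD. Qed.

Lemma hol_mul x g h : hol x g -> hol x h -> hol x (fun y => g y * h y).
Proof. by apply: (hol_op2 (op := *%R)) => n a f f'; exact: holoM. Qed.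

Section OneDeriv.
Variables (x : X) (v : vec X).
Hypothesis dv : is_deriv x v.

Lemma deriv_near g h : hol x g -> (\forall y \near x, g y = h y) -> v g = v h.
Proof. by move=> hg e; have [h1 _ _] := dv hg (hol_near hg e); exact: h1. Qed.

Lemma deriv_mul g h : hol x g -> hol x h -> v (fun y => g y * h y) = g x * v h + h x * v g.
Proof. by move=> hg hh; have [_ _ h3] := dv hg hh. Qed.

Lemma deriv_lin (c : K) g h : hol x g -> hol x h -> v (fun y => c * g y + h y) = c * v g + v h.
Proof. by move=> hg hh; have [_ h2 _] := dv hg hh. Qed.

Lemma deriv_add g h : hol x g -> hol x h -> v (fun y => g y + h y) = v g + v h.
Proof.
move=> hg hh; have := deriv_lin 1 hg hh; rewrite mul1r => <-.
by congr v; apply: funext => y; rewrite mul1r.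
Qed.

Lemma deriv_cst (c : K) : v (fun=> c) = 0.
Proof.
have v1 : v (fun=> 1) = 0.
  have := deriv_mul (hol_cst x 1) (hol_cst x 1).
  have -> : (fun y : X => (1 : K) * 1) = (fun=> 1) by apply: funext => y; rewrite mul1r.
  by rewrite mul1r => /eqP; rewrite -subr_eq0 opprD addNKr oppr_eq0 => /eqP.
have := deriv_lin 1 (hol_cst x 0) (hol_cst x 0).
have -> : (fun y : X => (1 : K) * 0 + 0) = (fun=> 0) by apply: funext => y; rewrite mulr0 addr0.
rewrite mul1r => /eqP; rewrite -subr_eq0 opprD addNKr oppr_eq0 => /eqP v0.
have E := deriv_lin c (hol_cst x 1) (hol_cst x 0).
transitivity (v (fun y => c * 1 + 0)); last by rewrite E v1 v0 mulr0 addr0.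
by congr v; apply: funext => y; rewrite mulr1 addr0.
Qed.

Lemma deriv_sum (I : Type) (r : seq I) (G : I -> X -> K) : (forall i, hol x (G i)) ->
  hol x (fun y => \sum_(i <- r) G i y) /\ v (fun y => \sum_(i <- r) G i y) = \sum_(i <- r) v (G i).
Proof.
move=> hG; elim: r => [|i r [IH1 IH2]].
  have -> : (fun y => \sum_(i <- [::]) G i y) = (fun=> 0) by apply: funext => y; rewrite big_nil.
  by rewrite big_nil deriv_cst; split=> //; exact: hol_cst.
have -> : (fun y => \sum_(j <- i :: r) G j y) = (fun y => G i y + \sum_(j <- r) G j y).
  by apply: funext => y; rewrite big_cons.
by rewrite big_cons -IH2; split; [exact: hol_add|exact: deriv_add].
Qed.

End OneDeriv.

Section InChart.
Variables (n : nat) (N : set X) (D : set 'rV[K]_n)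
  (phi : X -> 'rV[K]_n) (psi : 'rV[K]_n -> X).
Hypotheses (ch : is_chart (@hol R X) N D phi psi) (oD : open D).

Lemma hol_phi x k : N x -> hol x (fun y => phi y 0 k).
Proof. move=> Nx; exact: (hol_chart ch (h := fun z => z 0 k) Nx (holo_coord _ k)). Qed.

(** By Hadamard's lemma. *)
Lemma deriv_chart_ext x v v' g : N x -> is_deriv x v -> is_deriv x v' ->
  (forall k, v (fun y => phi y 0 k) = v' (fun y => phi y 0 k)) -> hol x g -> v g = v' g.
Proof.
move=> Nx dv dv' vv' hg.
have hh : holo (fun z => g (psi z)) (phi x).
  by apply: (rchart_holo ch oD); [exact: chart_to ch _ Nx|rewrite (chart_toK ch Nx)].
have [k [hk kE]] := hadamard hh.
pose a := phi x; pose G i y := (phi y 0 i - a 0 i) * k i (phi y).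
have hG1 i : hol x (fun y => phi y 0 i + - a 0 i) by apply: hol_add; [exact: hol_phi|exact: hol_cst].
have hG2 i : hol x (fun y => k i (phi y)) by exact: (hol_chart ch (h := k i) Nx (hk i)).
have hG i : hol x (G i) by apply: hol_mul.
have gE : \forall y \near x, g y = g x + \sum_i G i y.
  apply: filterS2 (chart_near ch Nx) (chart_near_to ch Nx kE) => y Ny.
  by rewrite (chart_toK ch Ny) (chart_toK ch Nx).
have E w : is_deriv x w -> w g = \sum_i k i a * w (fun y => phi y 0 i).
  move=> dw; rewrite (deriv_near dw hg gE).
  have [s1 s2] := deriv_sum dw (index_enum 'I_n) hG.
  rewrite (deriv_add dw (hol_cst x _) s1) (deriv_cst dw) add0r s2; apply: eq_bigr => i _.
  rewrite (deriv_mul dw (hG1 i) (hG2 i)) -/a subrr mul0r add0r.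
  by rewrite (deriv_add dw (hol_phi i Nx) (hol_cst x _)) (deriv_cst dw) addr0.
by rewrite (E _ dv) (E _ dv'); apply: eq_bigr => i _; rewrite vv'.
Qed.

(** For fixed [xi] and varying [t], this is a constant vector field in the chart. *)
Definition coord_vec (t xi : 'rV[K]_n) : vec X := fun g => 'd (fun z => g (psi z)) t xi.

Lemma coord_vec_deriv t xi : D t -> is_deriv (psi t) (coord_vec t xi).
Proof.
move=> Dt g h hg hh; have og := rchart_holo ch oD Dt hg; have oh := rchart_holo ch oD Dt hh.
split.
- move=> e; have e' := rchart_near_of ch oD Dt e.
  exact: esym (congr1 (fun L : 'rV[K]_n -> K => L xi) (near_diffE e' (holo_diff og))).
- move=> c; exact: (congr1 (fun L : 'rV[K]_n -> K => L xi) (isd_val (isdD (isdZ c (holo_isd og)) (holo_isd oh)))).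
- exact: (congr1 (fun L : 'rV[K]_n -> K => L xi) (isd_val (isdM (holo_isd og) (holo_isd oh)))).
Qed.

Definition coords v : 'rV[K]_n := \row_k v (fun y => phi y 0 k).

Lemma deriv_coord_vec x v g : N x -> is_deriv x v -> hol x g -> v g = coord_vec (phi x) (coords v) g.
Proof.
move=> Nx dv; have Dx := chart_to ch Nx.
have dc : is_deriv x (coord_vec (phi x) (coords v)) by have := coord_vec_deriv (coords v) Dx; rewrite (chart_toK ch Nx).
apply: (deriv_chart_ext Nx dv dc) => k.
have e : \forall z \near phi x, (z : 'rV[K]_n) 0 k = phi (psi z) 0 k.
  by apply: filterS (open_nbhs_nbhs (conj oD Dx)) => z Dz; rewrite (chart_ofK ch Dz).
have := isd_val (isd_near e (isd_coord (phi x) k)).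
move=> /(congr1 (fun L : 'rV[K]_n -> K => L (coords v))) E.
by apply: esym; apply: etrans E _; rewrite mxE.
Qed.

End InChart.

End Derivations.

(** * The differential of Kähler forms *)

Section Forms.
Variable R : realType.
Local Notation K := (C R).

Definition hol_term (X : complexSpace R) q (N : set X) (t : term X q) :=
  hol_on N t.1 /\ forall i, hol_on N (t.2 i).

Lemma hol_terms_map (X Y : complexSpace R) q q' (F : term X q -> term Y q') N M l :
  (forall t, hol_term N t -> hol_term M (F t)) -> hol_terms N l -> hol_terms M [seq F t | t <- l].
Proof. by move=> h; elim: l => [//|t l IH] [h1 h2 /IH h3]; split=> //; have [] := h t. Qed.

Lemma hol_terms_cat (X : complexSpace R) q N (l l' : seq (term X q)) :
  hol_terms N l -> hol_terms N l' -> hol_terms N (l ++ l').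
Proof. by move=> + h; elim: l => [//|t l IH] [h1 h2 /IH]. Qed.

Lemma hol_terms_sub (X : complexSpace R) q N N' (l : seq (term X q)) : N' `<=` N ->
  hol_terms N l -> hol_terms N' l.
Proof.
move=> s h; rewrite -[l]map_id; apply: hol_terms_map h => t [h1 h2].
by split=> [|i] x /s; [exact: h1|exact: h2].
Qed.

Lemma kahler_nil (X : complexSpace R) q (x : X) v : kahler ([::] : seq (term X q)) x v = 0.
Proof. by rewrite /kahler big_nil. Qed.

Lemma kahler_cons (X : complexSpace R) q (t : term X q) l (x : X) v :
  kahler (t :: l) x v = t.1 x * \det (\matrix_(i < q, j < q) v i (t.2 j)) + kahler l x v.
Proof. by rewrite /kahler big_cons. Qed.

Lemma dterm_comp (X : complexSpace R) q (u : term X q) j (T : Type) (psi : T -> X) :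
  (fun z => (dterm u).2 j (psi z)) =
  (if unlift ord0 j is Some j' then fun z => u.2 j' (psi z) else fun z => u.1 (psi z)).
Proof. by apply: funext => z; rewrite /=; case: (unlift ord0 j). Qed.

Section InChart.
Variables (X : complexSpace R) (n : nat) (N : set X) (D : set 'rV[K]_n)
  (phi : X -> 'rV[K]_n) (psi : 'rV[K]_n -> X).
Hypotheses (ch : is_chart (@hol R X) N D phi psi) (oD : open D).

Lemma kahler_coord_vec q x N' (l : seq (term X q)) v : N x -> N' x -> hol_terms N' l ->
  (forall i, is_deriv x (v i)) ->
  kahler l x v = kahler l x (fun i => coord_vec psi (phi x) (coords phi (v i))).
Proof.
move=> Nx N'x hl dv; elim: l hl => [|t l IH] hl; first by rewrite !kahler_nil.
have [h1 h2 h3] := hl; rewrite !kahler_cons (IH h3).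
apply: (congr1 (fun M => t.1 x * \det M + _)); apply/matrixP => i j; rewrite !mxE.
exact: (deriv_coord_vec ch oD Nx (dv i) (h2 j x N'x)).
Qed.

Definition coord_kahler q (l : seq (term X q)) (xi : 'I_q -> 'rV[K]_n) (t : 'rV[K]_n) : K :=
  kahler l (psi t) (fun i => coord_vec psi t (xi i)).

Lemma coord_kahler_holo q N' (l : seq (term X q)) xi t : D t -> N' (psi t) -> hol_terms N' l ->
  holo (coord_kahler l xi) t.
Proof.
move=> Dt N't; elim: l => [|u l IH].
  move=> _; have -> : coord_kahler [::] xi = fun=> 0 by apply: funext => z; exact: kahler_nil.
  exact: holo_cst.
move=> [h1 h2 /IH h3].
have -> : coord_kahler (u :: l) xi = fun z => u.1 (psi z) *
    \det (\matrix_(i < q, j < q) 'd (fun z => u.2 j (psi z)) z (xi i)) + coord_kahler l xi z.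
  by apply: funext => z; exact: kahler_cons.
apply: holoD h3; apply: holoM; first exact: (rchart_holo ch oD Dt (h1 _ N't)).
apply: holo_det => i j.
have -> : (fun z => (\matrix_(i < q, j < q) 'd (fun z => u.2 j (psi z)) z (xi i)) i j) =
    (fun z => 'd (fun z => u.2 j (psi z)) z (xi i)) by apply: funext => z; rewrite mxE.
exact: holo_d (rchart_holo ch oD Dt (h2 _ _ N't)).
Qed.

(** Cartan's formula for commuting fields. The sum runs over all permutations and not over the
    choice of the differentiating vector alone, whence the factorial of [q]. *)
Lemma coord_kahler_d q N' (l : seq (term X q)) (xi : 'I_q.+1 -> 'rV[K]_n) t :
  D t -> N' (psi t) -> hol_terms N' l ->
  \sum_(w : 'S_q.+1) (-1) ^+ w *
    'd (coord_kahler l (fun i => xi (w (lift ord0 i)))) t (xi (w ord0)) =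
  q`!%:R * kahler [seq dterm u | u <- l] (psi t) (fun i => coord_vec psi t (xi i)) :> K.
Proof.
move=> Dt N't; elim: l => [|u l IH].
  move=> _; rewrite kahler_nil mulr0 big1 // => w _.
  have -> : coord_kahler [::] (fun i => xi (w (lift ord0 i))) = fun=> 0.
    by apply: funext => z; exact: kahler_nil.
  by have /(congr1 (fun L : 'rV[K]_n -> K => L (xi (w ord0)))) -> := isd_val (isd_cst 0 t); rewrite mulr0.
move=> hl; have [h1 h2 h3] := hl; have {}IH := IH h3.
have hg := rchart_holo ch oD Dt (h1 _ N't).
have hh i := rchart_holo ch oD Dt (h2 i _ N't).
have E (w : 'S_q.+1) : 'd (coord_kahler (u :: l) (fun i => xi (w (lift ord0 i)))) t (xi (w ord0)) =
    'd (fun z => u.1 (psi z) * \det (\matrix_(i < q, j < q) 'd (fun z => u.2 j (psi z)) z (xi (w (lift ord0 i))))) t (xi (w ord0))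
    + 'd (coord_kahler l (fun i => xi (w (lift ord0 i)))) t (xi (w ord0)) :> K.
  have -> : coord_kahler (u :: l) (fun i => xi (w (lift ord0 i))) = fun z => u.1 (psi z) *
    \det (\matrix_(i < q, j < q) 'd (fun z => u.2 j (psi z)) z (xi (w (lift ord0 i)))) + coord_kahler l (fun i => xi (w (lift ord0 i))) z.
    by apply: funext => z; exact: kahler_cons.
  have a1 : hol_terms N' [:: u] by split.
  have b1 : holo (coord_kahler [:: u] (fun i => xi (w (lift ord0 i)))) t := coord_kahler_holo (fun i => xi (w (lift ord0 i))) Dt N't a1.
  have b2 := coord_kahler_holo (fun i => xi (w (lift ord0 i))) Dt N't h3.
  have e1 : coord_kahler [:: u] (fun i => xi (w (lift ord0 i))) = fun z => u.1 (psi z) *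
    \det (\matrix_(i < q, j < q) 'd (fun z => u.2 j (psi z)) z (xi (w (lift ord0 i)))).
    by apply: funext => z; rewrite /coord_kahler kahler_cons kahler_nil addr0.
  rewrite e1 in b1.
  exact: (congr1 (fun L : 'rV[K]_n -> K => L (xi (w ord0))) (isd_val (isdD (holo_isd b1) (holo_isd b2)))).
have A := det_d_alternating xi hg hh.
transitivity (\sum_(w : 'S_q.+1) ((-1) ^+ w *
    'd (fun z => u.1 (psi z) * \det (\matrix_(i < q, j < q) 'd (fun z => u.2 j (psi z)) z (xi (w (lift ord0 i))))) t (xi (w ord0))
    + (-1) ^+ w * 'd (coord_kahler l (fun i => xi (w (lift ord0 i)))) t (xi (w ord0))) : K).
  by apply: eq_bigr => w _; exact: etrans (congr1 (fun c => (-1) ^+ w * c) (E w)) (mulrDr _ _ _).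
apply: etrans (big_split _ _ _ _ _) _; apply: etrans (congr2 +%R A IH) _.
apply: etrans (esym (mulrDr _ _ _)) _; apply: (congr1 (fun c => _ * c)).
rewrite [map _ _]/= kahler_cons mul1r; apply: (congr1 (fun M => \det M + _)).
apply/matrixP => i j; apply: etrans (mxE _ _ _ _) _; apply: etrans _ (esym (mxE _ _ _ _)).
exact: (congr1 (fun f : 'rV[K]_n -> K => 'd f t (xi i)) (esym (dterm_comp u j psi))).
Qed.

End InChart.

Section OneSpace.
Variable X : complexSpace R.
Implicit Types (U N : set X).

Lemma eq_form_sym q U (a b : qform X q) : eq_form U a b -> eq_form U b a.
Proof. by move=> h x Ux rx v dv; rewrite h. Qed.

Lemma eq_form_trans q U (a b c : qform X q) : eq_form U a b -> eq_form U b c -> eq_form U a c.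
Proof. by move=> h h' x Ux rx v dv; rewrite h // h'. Qed.

Lemma eq_form_sub q U N (a b : qform X q) : N `<=` U -> eq_form U a b -> eq_form N a b.
Proof. by move=> s h x /s Ux rx v dv; apply: h. Qed.

(** Functions of the coordinates determine [kahler (map dterm l)] by
    [coord_kahler_d], hence so does the form [kahler l]. *)
Lemma kahler_d_uniq q N N' (l l' : seq (term X q)) x v : open N -> N x -> open N' -> N' x ->
  hol_terms N l -> hol_terms N' l' -> eq_form (N `&` N') (kahler l) (kahler l') -> reg X x ->
  (forall i, is_deriv x (v i)) ->
  kahler [seq dterm t | t <- l] x v = kahler [seq dterm t | t <- l'] x v.
Proof.
move=> oN Nx oN' N'x hl hl' e rx dv.
have hdt M q' (k : seq (term X q')) : hol_terms M k -> hol_terms M [seq dterm t | t <- k].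
  apply: hol_terms_map => t [h1 h2]; split=> [y My|i]; first exact: hol_cst.
  by rewrite /dterm /=; case: (unlift ord0 i).
have [n [N0 [D [phi [psi [oD ch N0x]]]]]] := rx.
have Dx := chart_to ch N0x; have px := chart_toK ch N0x.
have Nx' : N (psi (phi x)) by rewrite px.
have N'x' : N' (psi (phi x)) by rewrite px.
pose xi i := coords phi (v i).
have E1 := coord_kahler_d ch oD xi Dx Nx' hl; have E2 := coord_kahler_d ch oD xi Dx N'x' hl'.
rewrite px in E1 E2.
apply: etrans (kahler_coord_vec ch oD N0x Nx (hdt _ _ _ hl) dv) _.
apply: etrans _ (esym (kahler_coord_vec ch oD N0x N'x (hdt _ _ _ hl') dv)).
have q0 : q`!%:R != 0 :> K by rewrite pnatr_eq0 -lt0n fact_gt0.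
apply: (mulfI q0); apply: etrans (esym E1) _; apply: etrans _ E2.
apply: eq_bigr => w _; apply: (congr1 (fun c => _ * c)).
have nr : \forall t \near phi x, coord_kahler psi l (fun i => xi (w (lift ord0 i))) t =
    coord_kahler psi l' (fun i => xi (w (lift ord0 i))) t.
  have nn : \forall y \near psi (phi x), N y /\ N' y.
    by rewrite px; apply: filterS2 (open_nbhs_nbhs (conj oN Nx)) (open_nbhs_nbhs (conj oN' N'x)).
  apply: filterS2 (rchart_near_of ch oD Dx nn) (open_nbhs_nbhs (conj oD Dx)) => t [Nt N't] Dt.
  apply: e; first by split.
    exact: (rchart_reg ch oD (chart_of ch Dt)).
  by move=> i; exact: (coord_vec_deriv ch oD _ Dt).
have hl0 := coord_kahler_holo ch oD (fun i => xi (w (lift ord0 i))) Dx Nx' hl.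
exact: esym (congr1 (fun L : 'rV[K]_n -> K => L (xi (w ord0))) (near_diffE nr (holo_diff hl0))).
Qed.

Lemma dform_kahler q N (l : seq (term X q)) a x v : open N -> N x -> reg X x ->
  hol_terms N l -> eq_form N a (kahler l) -> (forall i, is_deriv x (v i)) ->
  dform a x v = kahler [seq dterm t | t <- l] x v.
Proof.
move=> oN Nx rx hl e dv; rewrite /dform.
case: xgetP => [c _ [N' [l' [oN' N'x hl' e' ->]]]|h]; last first.
  by exfalso; apply: (h (kahler [seq dterm t | t <- l] x v)); exists N, l.
apply: (kahler_d_uniq oN' N'x oN Nx) => //.
apply: eq_form_trans (eq_form_sym (eq_form_sub _ e')) (eq_form_sub _ e); by move=> ? [].
Qed.

End OneSpace.
End Forms.

(** * Operations on sections of [Omega] and their pull-back *)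

Section OmegaForms.
Variable R : realType.
Local Notation K := (C R).

Section OneSpace.
Variable X : complexSpace R.
Implicit Types (U N : set X).

Definition wedge_term r s (t : term X r) (t' : term X s) : term X (r + s) :=
  (fun x => t.1 x * t'.1 x,
   fun i => match fintype.split i with inl j => t.2 j | inr j => t'.2 j end).

Lemma kahler_map q (I : Type) (r : seq I) (F : I -> term X q) (x : X) v :
  kahler [seq F i | i <- r] x v = \sum_(i <- r) (F i).1 x * \det (\matrix_(a < q, j < q) v a ((F i).2 j)).
Proof. by rewrite /kahler big_map. Qed.

(** The normalisation in [wedge] cancels the factorials of [det_shuffle]. *)
Lemma wedge_kahler r s (l : seq (term X r)) (l' : seq (term X s)) x v :
  wedge (kahler l) (kahler l') x v = kahler [seq wedge_term t t' | t <- l, t' <- l'] x v.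
Proof.
pose T (t : term X r) (t' : term X s) : K := (t.1 x * t'.1 x) *
  \det (\matrix_(a < r + s, j < r + s) v a ((wedge_term t t').2 j)).
have -> : kahler [seq wedge_term t t' | t <- l, t' <- l'] x v = \sum_(t <- l) \sum_(t' <- l') T t t'.
  by rewrite /kahler big_allpairs_dep.
have c0 : r`!%:R * s`!%:R != 0 :> K by rewrite mulf_neq0 // pnatr_eq0 -lt0n fact_gt0.
rewrite /wedge; apply: (mulfI c0); rewrite mulVKf //.
pose M (w : 'S_(r + s)) (t : term X r) := \det (\matrix_(i < r, j < r) v (w (lshift s i)) (t.2 j)).
pose M' (w : 'S_(r + s)) (t : term X s) := \det (\matrix_(i < s, j < s) v (w (rshift r i)) (t.2 j)).
transitivity (\sum_(w : 'S_(r + s)) \sum_(t <- l) \sum_(t' <- l')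
    (-1) ^+ w * (t.1 x * M w t * (t'.1 x * M' w t'))).
  apply: eq_bigr => w _; rewrite /kahler big_distrlr mulr_sumr; apply: eq_bigr => t _.
  by rewrite mulr_sumr.
rewrite exchange_big mulr_sumr; apply: eq_bigr => t _.
rewrite exchange_big mulr_sumr; apply: eq_bigr => t' _ /=.
transitivity (\sum_(w : 'S_(r + s)) (t.1 x * t'.1 x) * ((-1) ^+ w * (M w t * M' w t'))).
  by apply: eq_bigr => w _; rewrite [X in _ * X]mulrACA; exact: mulrCA.
rewrite -mulr_sumr /T mulrCA; congr (_ * _).
have := det_shuffle (\matrix_(i < r + s, j < r) v i (t.2 j)) (\matrix_(i < r + s, j < s) v i (t'.2 j)).
have -> : row_mx (\matrix_(i < r + s, j < r) v i (t.2 j)) (\matrix_(i < r + s, j < s) v i (t'.2 j)) =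
    \matrix_(a < r + s, j < r + s) v a ((wedge_term t t').2 j).
  apply/matrixP => i j; rewrite [RHS]mxE -(splitK j).
  by rewrite /wedge_term /=; case: (fintype.split j) => k; rewrite ?row_mxEl ?row_mxEr mxE (unsplitK (inl k)) || rewrite ?row_mxEl ?row_mxEr mxE (unsplitK (inr k)).
move=> <-; apply: eq_bigr => w _; apply: (congr1 (fun c => _ * c)).
by apply: (congr2 *%R); apply: (congr1 determinant); apply/matrixP => i j; rewrite 3!mxE.
Qed.

Lemma Omega_sub q U N (a : qform X q) : open N -> N `<=` U -> Omega U a -> Omega N a.
Proof.
move=> oN NU ha x Nx; have [M [l [oM Mx MU hl e]]] := ha x (NU _ Nx).
exists (M `&` N), l; split; [exact: openI|by split|by move=> y []| |].
  by apply: hol_terms_sub hl => y [].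
by apply: eq_form_sub e => y [].
Qed.

Lemma Omega_eq q U (a b : qform X q) : eq_form U a b -> Omega U a -> Omega U b.
Proof.
move=> ab ha x Ux; have [M [l [oM Mx MU hl e]]] := ha x Ux.
exists M, l; split=> //; apply: eq_form_trans e; apply: eq_form_sym.
exact: eq_form_sub ab.
Qed.

Lemma Omega_kahler q U (l : seq (term X q)) : open U -> hol_terms U l -> Omega U (kahler l).
Proof. by move=> oU hl x Ux; exists U, l; split=> //; move=> ? ?. Qed.

Lemma Omega0 q U : open U -> Omega U (@form0 R X q).
Proof. by move=> oU x Ux; exists U, [::]; split=> // y _ _ v _; rewrite kahler_nil. Qed.

Lemma Omega_op2 r s q (op : qform X r -> qform X s -> qform X q) U a b :
  (forall N a a' b b', eq_form N a a' -> eq_form N b b' -> eq_form N (op a b) (op a' b')) ->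
  (forall N l l', hol_terms N l -> hol_terms N l' ->
    exists2 k, hol_terms N k & eq_form N (op (kahler l) (kahler l')) (kahler k)) ->
  Omega U a -> Omega U b -> Omega U (op a b).
Proof.
move=> hop hk ha hb x Ux.
have [M [l [oM Mx MU hl e]]] := ha x Ux; have [M' [l' [oM' M'x M'U hl' e']]] := hb x Ux.
have s1 : M `&` M' `<=` M by move=> y [].
have s2 : M `&` M' `<=` M' by move=> y [].
have [k hkt ek] := hk _ _ _ (hol_terms_sub s1 hl) (hol_terms_sub s2 hl').
exists (M `&` M'), k; split; [exact: openI|by split|by move=> y [/MU]|exact: hkt|].
by apply: eq_form_trans ek; apply: hop; [exact: eq_form_sub e|exact: eq_form_sub e'].
Qed.

Lemma eq_form_add q U (a a' b b' : qform X q) : eq_form U a a' -> eq_form U b b' ->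
  eq_form U (form_add a b) (form_add a' b').
Proof. by move=> e e' x Ux rx v dv; rewrite /form_add e // e'. Qed.

Lemma eq_form_wedge r s U (a a' : qform X r) (b b' : qform X s) : eq_form U a a' -> eq_form U b b' ->
  eq_form U (wedge a b) (wedge a' b').
Proof.
move=> e e' x Ux rx v dv; rewrite /wedge; congr (_ * _); apply: eq_bigr => w _.
by rewrite e // e'.
Qed.

Lemma Omega_add q U (a b : qform X q) : Omega U a -> Omega U b -> Omega U (form_add a b).
Proof.
apply: Omega_op2 => [N c c' d d'|N l l' hl hl']; first exact: eq_form_add.
exists (l ++ l'); first exact: hol_terms_cat.
by move=> x Nx rx v dv; rewrite /form_add /kahler big_cat.
Qed.

Lemma Omega_wedge r s U (a : qform X r) (b : qform X s) : Omega U a -> Omega U b ->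
  Omega U (wedge a b).
Proof.
apply: Omega_op2 => [N c c' d d'|N l l' hl hl']; first exact: eq_form_wedge.
exists [seq wedge_term t t' | t <- l, t' <- l']; last by move=> x Nx rx v dv; exact: wedge_kahler.
elim: l hl => [//|t l IH] [h1 h2 /IH h3]; rewrite allpairs_cons; apply: hol_terms_cat h3.
apply: hol_terms_map hl' => t' [k1 k2]; split=> [x Nx|i]; first by apply: hol_mul; [exact: h1|exact: k1].
by rewrite /wedge_term /=; case: (fintype.split i).
Qed.

Lemma Omega_scale q U (g : X -> K) (a : qform X q) : hol_on U g -> Omega U a ->
  Omega U (form_scale g a).
Proof.
move=> hg ha x Ux; have [M [l [oM Mx MU hl e]]] := ha x Ux.
exists M, [seq ((fun y => g y * t.1 y, t.2) : term X q) | t <- l]; split=> //.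
  apply: hol_terms_map hl => t [k1 k2]; split=> //= y My.
  by apply: hol_mul; [exact: hg (MU _ My)|exact: k1].
move=> y My ry v dv; rewrite /form_scale e // kahler_map /kahler mulr_sumr.
by apply: eq_bigr => t _; rewrite mulrA.
Qed.

Lemma hol_terms_d q N (l : seq (term X q)) : hol_terms N l -> hol_terms N [seq dterm t | t <- l].
Proof.
apply: hol_terms_map => t [h1 h2]; split=> [y My|i]; first exact: hol_cst.
by rewrite /dterm /=; case: (unlift ord0 i).
Qed.

Lemma Omega_d q U (a : qform X q) : Omega U a -> Omega U (dform a).
Proof.
move=> ha x Ux; have [M [l [oM Mx MU hl e]]] := ha x Ux.
exists M, [seq dterm t | t <- l]; split=> //; first exact: hol_terms_d.
by move=> y My ry v dv; exact: dform_kahler hl e dv.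
Qed.

Lemma eq_form_d q U (a b : qform X q) : open U -> Omega (U `&` reg X) a -> eq_form U a b ->
  eq_form U (dform a) (dform b).
Proof.
move=> oU ha ab x Ux rx v dv; have [M [l [oM Mx MU hl e]]] := ha x (conj Ux rx).
rewrite (dform_kahler oM Mx rx hl e dv) (dform_kahler oM Mx rx hl _ dv) //.
apply: eq_form_trans e; apply: eq_form_sym; apply: eq_form_sub ab => y /MU[].
done.
Qed.

(** If the forms differ at [x] on [v], they still differ nearby on the constant vector fields that
    extend [v] in a chart, in particular at some point of [S]. *)
Lemma Omega_dense q U S (a b : qform X q) : Omega (U `&` reg X) a -> Omega (U `&` reg X) b ->
  dense S -> eq_form (U `&` S) a b -> eq_form U a b.
Proof.
move=> ha hb dS ab x Ux rx v dv; apply/eqP/negPn/negP => ne.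
have [M [l [oM Mx MU hl e]]] := ha x (conj Ux rx).
have [M' [l' [oM' M'x M'U hl' e']]] := hb x (conj Ux rx).
have [n [N0 [D [phi [psi [oD ch N0x]]]]]] := rx.
have Dx := chart_to ch N0x; have px := chart_toK ch N0x.
pose xi i := coords phi (v i).
pose G t := coord_kahler psi l xi t - coord_kahler psi l' xi t.
have hG : holo G (phi x).
  apply: holoB; first by apply: (coord_kahler_holo ch oD xi Dx _ hl); rewrite px.
  by apply: (coord_kahler_holo ch oD xi Dx _ hl'); rewrite px.
have G0 : G (phi x) != 0.
  apply: contra ne => /eqP; rewrite /G => /eqP; rewrite subr_eq0 => /eqP E.
  rewrite (e x Mx rx v dv) (e' x M'x rx v dv) (kahler_coord_vec ch oD N0x Mx hl dv) (kahler_coord_vec ch oD N0x M'x hl' dv).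
  by move: E; rewrite /coord_kahler px => ->.
have nG : \forall t \near phi x, G t != 0 := near_neq0 hG G0.
have nM : \forall y \near x, M y /\ M' y.
  by apply: filterS2 (open_nbhs_nbhs (conj oM Mx)) (open_nbhs_nbhs (conj oM' M'x)).
have nn : \forall y \near x, N0 y /\ (M y /\ M' y) /\ G (phi y) != 0.
  have nG' := chart_near_to ch N0x nG.
  by apply: filterS2 (chart_near ch N0x) (filterI nM nG') => y h1 [h2 h3].
have [y [[N0y [[My M'y] Gy]] Sy]] := dense_near dS nn.
have Dy := chart_to ch N0y; have py := chart_toK ch N0y.
have dcv i : is_deriv y (coord_vec psi (phi y) (xi i)) by have := coord_vec_deriv ch oD (xi i) Dy; rewrite py.
have ry := rchart_reg ch oD N0y; have [Uy _] := MU _ My.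
move/negP: Gy; apply; rewrite /G /coord_kahler py subr_eq0.
by rewrite -(e y My ry _ dcv) -(e' y M'y ry _ dcv) (ab y (conj Uy Sy) ry _ dcv).
Qed.

End OneSpace.

Section Pull.
Variables (X Y : complexSpace R) (f : X -> Y).
Hypothesis hf : holomorphic f.

Lemma deriv_pull x (v : vec X) : is_deriv x v -> is_deriv (f x) (fun g => v (g \o f)).
Proof.
move=> dv g h hg hh; have [_ hfx] := hf (x := x) I; split.
- by move=> e; exact: (deriv_near dv (hfx _ hg) (holomorphic_near hf e)).
- by move=> c; exact: (deriv_lin dv c (hfx _ hg) (hfx _ hh)).
- exact: (deriv_mul dv (hfx _ hg) (hfx _ hh)).
Qed.

(** Restricted to points over [reg Y], as [eq_form] says nothing about the values at singular points
    of [Y]. *)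
Lemma eq_form_pull q V (a b : qform Y q) : eq_form V a b ->
  eq_form (f @^-1` (V `&` reg Y)) (pull f a) (pull f b).
Proof.
move=> e x [Vx rfx] rx v dv; apply: e => // i; exact: deriv_pull.
Qed.

Lemma pull_kahler q (l : seq (term Y q)) x v :
  pull f (kahler l) x v = kahler [seq comp_term f t | t <- l] x v.
Proof. by rewrite kahler_map. Qed.

Lemma hol_terms_comp q V (l : seq (term Y q)) : hol_terms V l ->
  hol_terms (f @^-1` V) [seq comp_term f t | t <- l].
Proof.
apply: hol_terms_map => t [h1 h2]; split=> [x Vx|i x Vx]; have [_ hfx] := hf (x := x) I; apply: hfx.
  exact: h1.
exact: h2.
Qed.

Lemma open_pre V : open V -> open (f @^-1` V).
Proof.
by move=> oV; rewrite openE => x Vx; apply: (holomorphic_near hf); exact: open_nbhs_nbhs (conj oV Vx).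
Qed.

Lemma pull_dform q V (a : qform Y q) : Omega V a ->
  eq_form (f @^-1` (V `&` reg Y)) (pull f (dform a)) (dform (pull f a)).
Proof.
move=> ha x [Vx rfx] rx v dv; have [M [l [oM Mx MU hl e]]] := ha _ Vx.
have oM' : open (f @^-1` (M `&` reg Y)) by apply: open_pre; apply: openI => //; exact: open_reg.
have e' : eq_form (f @^-1` (M `&` reg Y)) (pull f a) (kahler [seq comp_term f t | t <- l]).
  move=> y hy ry w dw; rewrite (eq_form_pull e) //; exact: pull_kahler.
have hl' : hol_terms (f @^-1` (M `&` reg Y)) [seq comp_term f t | t <- l].
  by apply: hol_terms_sub (hol_terms_comp hl) => y [].
rewrite (dform_kahler oM' (conj Mx rfx) rx hl' e' dv).
rewrite /pull (dform_kahler oM Mx rfx hl e (fun i => deriv_pull (dv i))).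
rewrite -map_comp !kahler_map; apply: eq_bigr => t _; congr (_ * \det _).
by apply/matrixP => i j; rewrite !mxE /=; case: (unlift ord0 j).
Qed.

End Pull.
End OmegaForms.

(** * The sheaves [alpha[p]] and [beta], and the pull-back *)

Section Sheaves.
Variable R : realType.
Local Notation K := (C R).

Lemma Ck_cst m k (W : set 'rV[R]_m) (c : R) : Ck k W (fun=> c).
Proof.
elim: k c => [|k IH] c /=; split; try by move=> u _; exact: cst_continuous.
  done.
move=> j; split; first by move=> u _; exact: derivable_cst.
have -> : 'D_(delta_mx 0 j) (fun=> c) = (fun=> 0) :> ('rV[R]_m -> R); last exact: IH.
by apply: funext => u; exact: derive_cst.
Qed.

Section OneSpace.
Variable X : complexSpace R.
Implicit Types (U N : set X).

Lemma chart_restrict n N0 (D : set 'rV[K]_n) phi psi N : open D ->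
  is_chart (@hol R X) N0 D phi psi -> open N ->
  open (D `&` psi @^-1` N) /\ is_chart (@hol R X) (N0 `&` N) (D `&` psi @^-1` N) phi psi.
Proof.
move=> oD ch oN; split.
  rewrite openE => t [Dt Nt]; have e := rchart_near_of ch oD Dt (open_nbhs_nbhs (conj oN Nt)).
  by apply: filterS2 (open_nbhs_nbhs (conj oD Dt)) e => s h1 h2; split.
split.
- by apply: openI => //; exact: chart_open ch.
- move=> x [N0x Nx]; split; first exact: chart_to ch _ N0x.
  by rewrite /= (chart_toK ch N0x).
- by move=> t [Dt Nt]; split=> //; exact: chart_of ch _ Dt.
- by move=> x [N0x _]; exact: chart_toK ch _ N0x.
- by move=> t [Dt _]; exact: chart_ofK ch _ Dt.
- by move=> x [N0x _]; exact: chart_to_cont ch _ N0x.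
- by apply: continuous_subspaceW (chart_of_cont ch) => t [].
- by move=> x g [N0x _]; exact: chart_hol ch _ _ N0x.
Qed.

Lemma smooth_on_cst U (c : K) : open U -> U `<=` reg X -> smooth_on U (fun=> c).
Proof.
move=> oU Ur x Ux; have [n [N0 [D [phi [psi [oD ch N0x]]]]]] := Ur _ Ux.
have [oD' ch'] := chart_restrict oD ch oU.
exists n, (N0 `&` U), (D `&` psi @^-1` U), phi, psi; split=> //.
by move=> k; split; exact: Ck_cst.
Qed.

Lemma Omega_local q U (a : qform X q) :
  (forall x, U x -> exists N, [/\ open N, N x & Omega (N `&` U) a]) -> Omega U a.
Proof.
move=> h x Ux; have [N [oN Nx /(_ x (conj Nx Ux))[M [l [oM Mx MU hl e]]]]] := h x Ux.
by exists M, l; split=> // y /MU[].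
Qed.

(** The single coefficient [1] suffices. Kähler forms are the test sections on which
    [alpha_pullback] prescribes the values of a morphism. *)
Lemma kahler_alpha0 q N (l : seq (term X q)) : open N -> hol_terms N l -> alpha0 N (kahler l).
Proof.
move=> oN hl; have ho := Omega_kahler oN hl; split; first split.
- by apply: Omega_sub ho => [|y []//]; apply: openI => //; exact: open_reg.
- move=> X' tau [_ htau _ _ _]; exists (pull tau (kahler l)); split; last by move=> ? ?.
  have hl' := hol_terms_comp htau hl; have ho' := Omega_kahler (open_pre htau oN) hl'.
  by apply: Omega_eq ho' => y _ _ v _; rewrite pull_kahler.
move=> x Nx; exists N, 1%N, (fun _ _ => 1), (fun _ => kahler l); split=> //; last first.
  by move=> y _ _ v _; rewrite big_ord1 mul1r.
move=> _; split=> //; first by apply: smooth_on_cst => [|y []//]; apply: openI => //; exact: open_reg.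
by move=> y _ _; exists 1; apply: filterE => z _; rewrite normr1.
Qed.

Lemma alpha0_eq q U (a b : qform X q) : eq_form U a b -> alpha0 U a -> alpha0 U b.
Proof.
move=> ab [[h1 h2] h3].
have sr : U `&` reg X `<=` U by move=> y [].
split; first split.
- exact: Omega_eq (eq_form_sub sr ab) h1.
- move=> X' tau dt; have [_ htau _ _ _] := dt.
  have [c [hc ec]] := h2 _ _ dt; exists c; split=> //.
  exact: eq_form_trans ec (eq_form_pull htau ab).
move=> x Ux; have [N [k [rho [om [oN Nx NU ho e]]]]] := h3 x Ux.
exists N, k, rho, om; split=> //; apply: eq_form_trans (eq_form_sym (eq_form_sub NU ab)) e.
Qed.

Lemma step_sum_Omega (F : forall q, set X -> qform X q -> Prop) N q (b : qform X q) : open N ->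
  (forall r (a : qform X r), F r N a -> Omega (N `&` reg X) a) ->
  step_sum F N b -> Omega (N `&` reg X) b.
Proof.
move=> oN h; elim=> {q b} [q|q a b _ IHa _ IHb|r s a b Fa Fb|r s a b Fa Fb].
- by apply: Omega0; apply: openI => //; exact: open_reg.
- exact: Omega_add.
- by apply: Omega_wedge; exact: h.
- by apply: Omega_wedge; [exact: h|apply: Omega_d; exact: h].
Qed.

Lemma Omega_of_local_eq q U N x (a b : qform X q) : open U -> open N -> N x -> N `<=` U ->
  eq_form N a b -> Omega (N `&` reg X) b ->
  exists M, [/\ open M, M x & Omega (M `&` (U `&` reg X)) a].
Proof.
move=> oU oN Nx NU e hb; exists N; split=> //.
have -> : N `&` (U `&` reg X) = N `&` reg X.
  by apply/seteqP; split=> y [h1 h2]; [split=> //; case: h2|split=> //; split=> //; exact: NU].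
by apply: Omega_eq hb; apply: eq_form_sym; apply: eq_form_sub e => y [].
Qed.

Lemma alpha_Omega p q U (a : qform X q) : open U -> alpha p U a -> Omega (U `&` reg X) a.
Proof.
elim: p q U a => [|p IH] q U a oU; first by case=> -[].
move=> h; apply: Omega_local => x [Ux rx]; have [N [b [oN Nx NU hb e]]] := h x Ux.
apply: (Omega_of_local_eq oU oN Nx NU e); apply: step_sum_Omega hb => // r c; exact: IH.
Qed.

Lemma beta_Omega q U (a : qform X q) : open U -> beta U a -> Omega (U `&` reg X) a.
Proof.
move=> oU h; apply: Omega_local => x [Ux rx]; have [N [p [oN Nx NU ha]]] := h x Ux.
exact: (Omega_of_local_eq oU oN Nx NU (fun _ _ _ _ _ => erefl) (alpha_Omega oN ha)).
Qed.

Lemma alpha_beta p q U (a : qform X q) : open U -> alpha p U a -> beta U a.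
Proof. by move=> oU ha x Ux; exists U, p; split. Qed.

End OneSpace.

(** * Extension of the pull-back across the points over [sing Y] *)

Section Extension.
Variables (X Y : complexSpace R) (f : X -> Y).
Hypotheses (irX : irreducible X) (irY : irreducible Y) (hf : holomorphic f)
  (nsing : ~ (range f `<=` sing Y)).

(** [b] is a section on [N] that coincides with the pull-back of [a] on the
    dense open set where both sides are regular. *)
Definition extends q (N : set X) (a : qform Y q) (b : qform X q) : Prop :=
  Omega (N `&` reg X) b /\ eq_form (N `&` f @^-1` reg Y) b (pull f a).

Lemma extends_uniq q N (a : qform Y q) (b b' : qform X q) :
  extends N a b -> extends N a b' -> eq_form N b b'.
Proof.
move=> [h1 h2] [h1' h2']; apply: (Omega_dense h1 h1' (dense_regular_preimage irX irY hf nsing)).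
have s : N `&` (reg X `&` f @^-1` reg Y) `<=` N `&` f @^-1` reg Y by move=> y [? []].
exact: eq_form_trans (eq_form_sub s h2) (eq_form_sym (eq_form_sub s h2')).
Qed.

Lemma extends_sub q N N' (a : qform Y q) (b : qform X q) : open N' -> N' `<=` N ->
  extends N a b -> extends N' a b.
Proof.
move=> oN' s [h1 h2]; split.
  by apply: Omega_sub h1; [apply: openI => //; exact: open_reg|move=> y [/s]].
by apply: eq_form_sub h2 => y [/s].
Qed.

Lemma extends_eql q N V (a a' : qform Y q) (b : qform X q) : N `<=` f @^-1` V ->
  eq_form V a a' -> extends N a b -> extends N a' b.
Proof.
move=> s e [h1 h2]; split=> //; apply: eq_form_trans h2 _.
by apply: eq_form_sub (eq_form_pull hf e) => y [/s].
Qed.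

Lemma extends_eqr q N (a : qform Y q) (b b' : qform X q) :
  eq_form N b b' -> extends N a b -> extends N a b'.
Proof.
move=> e [h1 h2]; split; first by apply: Omega_eq h1; apply: eq_form_sub e => y [].
by apply: eq_form_trans h2; apply: eq_form_sym; apply: eq_form_sub e => y [].
Qed.

Lemma extends0 q N : open N -> extends N (@form0 R Y q) (@form0 R X q).
Proof. by move=> oN; split=> //; apply: Omega0; apply: openI => //; exact: open_reg. Qed.

Lemma extends_add q N (a a' : qform Y q) (b b' : qform X q) : extends N a b -> extends N a' b' ->
  extends N (form_add a a') (form_add b b').
Proof. by move=> [h1 h2] [h1' h2']; split; [exact: Omega_add|exact: (eq_form_add h2 h2')]. Qed.

Lemma extends_wedge r s N (a : qform Y r) (a' : qform Y s) (b : qform X r) (b' : qform X s) :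
  extends N a b -> extends N a' b' -> extends N (wedge a a') (wedge b b').
Proof. by move=> [h1 h2] [h1' h2']; split; [exact: Omega_wedge|exact: (eq_form_wedge h2 h2')]. Qed.

Lemma extends_scale q V (g : Y -> K) (a : qform Y q) (b : qform X q) : hol_on V g ->
  extends (f @^-1` V) a b -> extends (f @^-1` V) (form_scale g a) (form_scale (g \o f) b).
Proof.
move=> hg [h1 h2]; split; last first.
  by move=> x Vx rx v dv; rewrite /form_scale (h2 x Vx rx v dv).
apply: Omega_scale h1 => x [Vx _]; have [_ hfx] := hf (x := x) I; exact: (hfx g (hg _ Vx)).
Qed.

(** [pull_dform] gives the commutation over [reg Y]. That part is open, so the differential of [b]
    may be computed there from the pull-back of [a]. *)
Lemma extends_d q N V (a : qform Y q) (b : qform X q) : open N -> N `<=` f @^-1` V ->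
  Omega (V `&` reg Y) a -> extends N a b -> extends N (dform a) (dform b).
Proof.
move=> oN s ha [h1 h2]; split; first exact: Omega_d.
have oW : open (N `&` f @^-1` reg Y) by apply: openI => //; apply: open_pre => //; exact: open_reg.
apply: eq_form_trans (eq_form_d oW _ h2) (eq_form_sym _).
  apply: Omega_sub h1; first by apply: openI => //; exact: open_reg.
  by move=> y [[]].
by apply: eq_form_sub (pull_dform hf ha) => y [/s].
Qed.

(** The value at [x] is taken from any extension defined around [x], and is [0] if there is none. No
    open set and no [p] enters, so compatibility with restrictions and between the [alpha p] comes
    down to [extends_uniq]. *)
Definition Ext q (a : qform Y q) : qform X q :=
  fun x v => xget 0 [set c | exists (N : set X) (b : qform X q),
    [/\ open N, N x, extends N a b & c = b x v]].

Lemma Ext_eq q N (a : qform Y q) (b : qform X q) : open N -> extends N a b -> eq_form N (Ext a) b.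
Proof.
move=> oN hb x Nx rx v dv; rewrite /Ext.
case: xgetP => [c _ [N' [b' [oN' N'x hb' ->]]]|h]; last first.
  by exfalso; apply: (h (b x v)); exists N, b.
have oI : open (N `&` N') by exact: openI.
apply: (extends_uniq (extends_sub oI _ hb') (extends_sub oI _ hb)) => //; by move=> y [].
Qed.

(** Gluing: by uniqueness [Ext a] coincides with each local extension on its domain. *)
Lemma Ext_extends q U (a : qform Y q) : open U ->
  (forall x, U x -> exists N b, [/\ open N, N x, N `<=` U & extends N a b]) -> extends U a (Ext a).
Proof.
move=> oU h; split.
  apply: Omega_local => x [Ux rx]; have [N [b [oN Nx NU hb]]] := h x Ux.
  exact: (Omega_of_local_eq oU oN Nx NU (Ext_eq oN hb) hb.1).
move=> x [Ux fx] rx v dv; have [N [b [oN Nx NU hb]]] := h x Ux.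
by rewrite (Ext_eq oN hb Nx rx dv) (hb.2 x _ rx v dv).
Qed.

Section Morphisms.
Variables (FY : forall q, set Y -> qform Y q -> Prop) (FX : forall q, set X -> qform X q -> Prop).
Arguments FY {q}.
Arguments FX {q}.
Hypothesis FYO : forall q V (a : qform Y q), open V -> FY V a -> Omega (V `&` reg Y) a.
Hypothesis FXO : forall q U (a : qform X q), open U -> FX U a -> Omega (U `&` reg X) a.

(** Near a regular point a section is a Kähler form, so that a morphism is
    determined there by its values on Kähler forms. *)
Lemma morphism_extends (Psi : section_map X Y) :
  (forall q V (l : seq (term Y q)), open V -> hol_terms V l ->
     FY V (kahler l) /\ eq_form (f @^-1` V) (Psi q V (kahler l)) (kahler [seq comp_term f t | t <- l])) ->
  is_morphism f (@FY) (@FX) Psi ->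
  forall q V (a : qform Y q), open V -> FY V a -> extends (f @^-1` V) a (Psi q V a).
Proof.
move=> hk mor q V a oV Va; split.
  by apply: FXO; [exact: open_pre|exact: (mor_section mor)].
move=> x [Vx fx] rx v dv; have [M [l [oM Mx MU hl e]]] := FYO oV Va (conj Vx fx).
have [kM eM] := hk q M l oM hl.
have MV : M `<=` V by move=> y /MU[].
rewrite (mor_restr mor oV oM MV Va kM e Mx rx dv) (eM x Mx rx v dv) -pull_kahler.
by apply: esym; apply: (e _ Mx fx) => i; exact: deriv_pull.
Qed.

Lemma Ext_morphism :
  (forall q V (a : qform Y q), open V -> FY V a ->
     FX (f @^-1` V) (Ext a) /\ extends (f @^-1` V) a (Ext a)) ->
  is_morphism f (@FY) (@FX) (fun q _ a => Ext a).
Proof.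
move=> h; split.
- by move=> q V a oV Va; have [] := h q V a oV Va.
- move=> q V V' a a' oV oV' s Va Va' e; have [_ e1] := h q V a oV Va.
  apply: eq_form_sym; apply: Ext_eq; first exact: open_pre.
  apply: (extends_eql _ e); first by [].
  by apply: extends_sub e1; [exact: open_pre|move=> y /s].
- move=> q V a b oV Va Vb; apply: Ext_eq; first exact: open_pre.
  by apply: extends_add; [case: (h q V a oV Va)|case: (h q V b oV Vb)].
- move=> q V g a oV hg Va; apply: Ext_eq; first exact: open_pre.
  by apply: extends_scale => //; case: (h q V a oV Va).
Qed.

End Morphisms.

Variable Phi : section_map X Y.
Hypothesis hPhi : alpha_pullback f Phi.

Lemma alpha_pullback_extends q V (a : qform Y q) : open V -> alpha 0 V a ->
  extends (f @^-1` V) a (Phi V a).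
Proof.
have [mor hk] := hPhi.
apply: (morphism_extends (FY := fun q => @alpha R Y 0 q) (FX := fun q => @alpha R X 0 q)) mor q V a.
- by move=> q V a; exact: alpha_Omega.
- by move=> q V a; exact: alpha_Omega.
by move=> q V l oV hl; split; [exact: kahler_alpha0|exact: hk].
Qed.

Lemma alpha_Ext p q V (a : qform Y q) : open V -> alpha p V a ->
  alpha p (f @^-1` V) (Ext a) /\ extends (f @^-1` V) a (Ext a).
Proof.
elim: p q V a => [|p IH] q V a oV ha.
  have e := alpha_pullback_extends oV ha; have oV' := open_pre hf oV.
  have ee := eq_form_sym (Ext_eq oV' e); split; last exact: extends_eqr ee e.
  apply: alpha0_eq ee _; exact: (mor_section (proj1 hPhi)).
have step N (b : qform Y q) : open N -> step_sum (@alpha R Y p) N b ->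
    exists2 b' : qform X q, step_sum (@alpha R X p) (f @^-1` N) b' & extends (f @^-1` N) b b'.
  move=> oN; have oN' := open_pre hf oN.
  elim=> {q a ha b} [q|q a b _ [a' sa ea] _ [b' sb eb]|r s a b ha hb|r s a b ha hb].
  - by exists (@form0 R X q); [exact: step_zero|exact: extends0].
  - by exists (form_add a' b'); [exact: step_add|exact: extends_add].
  - have [a1 a2] := IH _ _ _ oN ha; have [b1 b2] := IH _ _ _ oN hb.
    by exists (wedge (Ext a) (Ext b)); [exact: step_wedge|exact: extends_wedge].
  - have [a1 a2] := IH _ _ _ oN ha; have [b1 b2] := IH _ _ _ oN hb.
    exists (wedge (Ext a) (dform (Ext b))); first exact: step_wedge_d.
    apply: extends_wedge => //; apply: extends_d b2 => //; first exact: subset_refl.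
    exact: alpha_Omega hb.
have loc x : V (f x) -> exists (N : set Y) (b : qform X q),
    [/\ open N, N (f x), N `<=` V, step_sum (@alpha R X p) (f @^-1` N) b & extends (f @^-1` N) a b].
  move=> Vx; have [N [b [oN Nx NV hb e]]] := ha _ Vx; have [b' sb eb] := step N b oN hb.
  exists N, b'; split=> //; apply: (extends_eql (V := N)) eb; first exact: subset_refl.
  exact: eq_form_sym.
split.
  move=> x Vx; have [N [b [oN Nx NV sb eb]]] := loc x Vx; exists (f @^-1` N), b; split=> //.
  - exact: open_pre.
  - by move=> y /NV.
  - by apply: Ext_eq => //; exact: open_pre.
apply: Ext_extends; first exact: open_pre.
move=> x Vx; have [N [b [oN Nx NV sb eb]]] := loc x Vx; exists (f @^-1` N), b; split=> //.
  exact: open_pre.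
by move=> y /NV.
Qed.

Lemma beta_Ext q V (a : qform Y q) : open V -> beta V a ->
  beta (f @^-1` V) (Ext a) /\ extends (f @^-1` V) a (Ext a).
Proof.
move=> oV h; split.
  move=> x Vx; have [N [p [oN Nx NV ha]]] := h _ Vx; have [h1 _] := alpha_Ext oN ha.
  by exists (f @^-1` N), p; split=> //; [exact: open_pre|move=> y /NV].
apply: Ext_extends; first exact: open_pre.
move=> x Vx; have [N [p [oN Nx NV ha]]] := h _ Vx; have [_ h2] := alpha_Ext oN ha.
by exists (f @^-1` N), (Ext a); split=> //; [exact: open_pre|move=> y /NV].
Qed.

(** Kähler forms are sections of [alpha 0], where agreement with [Phi] prescribes the values;
    [morphism_extends] does the rest. *)
Lemma beta_pullback_extends Psi q V (a : qform Y q) : beta_pullback f Phi Psi -> open V ->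
  beta V a -> extends (f @^-1` V) a (Psi q V a).
Proof.
move=> [mor ag _ _].
apply: (morphism_extends (FY := fun q => @beta R Y q) (FX := fun q => @beta R X q)) mor q V a.
- by move=> q V a; exact: beta_Omega.
- by move=> q V a; exact: beta_Omega.
move=> q V l oV hl; have k0 : alpha 0 V (kahler l) by exact: kahler_alpha0.
split; first exact: alpha_beta k0.
exact: eq_form_trans (ag _ _ _ oV k0) ((proj2 hPhi) _ _ _ oV hl).
Qed.

Lemma Ext_beta_pullback : beta_pullback f Phi (fun q _ a => Ext a).
Proof.
split.
- apply: (Ext_morphism (FY := fun q => @beta R Y q) (FX := fun q => @beta R X q)) => q V a; exact: beta_Ext.
- move=> q V a oV ha; apply: Ext_eq; [exact: open_pre|exact: alpha_pullback_extends].
- move=> r s V u v oV hu hv; apply: Ext_eq; first exact: open_pre.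
  by apply: extends_wedge; [case: (beta_Ext oV hu)|case: (beta_Ext oV hv)].
- move=> q V u oV hu; apply: Ext_eq; first exact: open_pre.
  have [_ e] := beta_Ext oV hu; apply: extends_d e; [exact: open_pre|exact: subset_refl|exact: beta_Omega].
Qed.

Lemma Ext_induced p Psi : beta_pullback f Phi Psi -> induced f p Psi (fun q _ a => Ext a).
Proof.
move=> hPsi; split.
  apply: (Ext_morphism (FY := fun q => @alpha R Y p q) (FX := fun q => @alpha R X p q)) => q V a; exact: alpha_Ext.
move=> q V a oV ha; apply: Ext_eq; first exact: open_pre.
by apply: beta_pullback_extends => //; exact: alpha_beta ha.
Qed.

Lemma induced_extends p Psi Psip q V (a : qform Y q) : beta_pullback f Phi Psi ->
  induced f p Psi Psip -> open V -> alpha p V a -> extends (f @^-1` V) a (Psip q V a).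
Proof.
move=> hPsi [_ ag] oV ha; apply: extends_eqr (eq_form_sym (ag _ _ _ oV ha)) _.
by apply: beta_pullback_extends => //; exact: alpha_beta ha.
Qed.

End Extension.

(** The two steps of the pull-back are explicit only at points [x] with [f x] and [g (f x)] both
    regular. Each condition holds on a dense set, and the one on [f x] on an open one, so their
    intersection is dense. *)
Lemma extends_comp (X Y Z : complexSpace R) (f : X -> Y) (g : Y -> Z) q V (a : qform Z q) b c c' :
  irreducible X -> irreducible Y -> irreducible Z -> holomorphic f -> holomorphic g ->
  ~ (range f `<=` sing Y) -> ~ (range (g \o f) `<=` sing Z) -> holomorphic (g \o f) -> open V ->
  extends (g \o f) ((g \o f) @^-1` V) a c -> extends g (g @^-1` V) a b ->
  extends f (f @^-1` (g @^-1` V)) b c' -> eq_form ((g \o f) @^-1` V) c c'.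
Proof.
move=> irX irY irZ hf hg nf ngf hgf oV [c1 c2] [b1 b2] [d1 d2].
have dW := dense_regular_preimage irX irY hf nf.
have dW' := dense_regular_preimage irX irZ hgf ngf.
have oW : open (reg X `&` f @^-1` reg Y).
  by apply: openI; [exact: open_reg|apply: open_pre => //; exact: open_reg].
apply: (Omega_dense c1 d1 (denseI oW dW dW')) => x [Vx [[_ rfx] [_ rgfx]]] rx v dv.
rewrite (c2 x (conj Vx rgfx) rx v dv) (d2 x (conj Vx rfx) rx v dv).
by rewrite /pull (b2 (f x) (conj Vx rgfx) rfx _ (fun i => deriv_pull hf (dv i))).
Qed.

Lemma holomorphic_comp (X Y Z : complexSpace R) (f : X -> Y) (g : Y -> Z) :
  holomorphic f -> holomorphic g -> holomorphic (g \o f).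
Proof.
move=> hf hg x _; have [cf hfx] := hf x I; have [cg hgx] := hg (f x) I.
split; first exact: continuous_comp.
by move=> h hh; apply: (hfx (h \o g)); exact: hgx.
Qed.

End Sheaves.

Theorem theorem2p1p5 (R : realType) :
  (* existence and uniqueness *)
  (forall (X Y : complexSpace R) (f : X -> Y) (Phi : section_map X Y),
     irreducible X -> irreducible Y -> holomorphic f ->
     ~ (range f `<=` sing Y) -> alpha_pullback f Phi ->
     exists Psi : section_map X Y, beta_pullback f Phi Psi /\
       forall Psi' : section_map X Y, beta_pullback f Phi Psi' ->
         agree_on f (@beta R Y) Psi' Psi) /\
  (* functoriality *)
  (forall (X Y Z : complexSpace R) (f : X -> Y) (g : Y -> Z)
          (Phif Psif : section_map X Y) (Phig Psig : section_map Y Z)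
          (Phigf Psigf : section_map X Z),
     irreducible X -> irreducible Y -> irreducible Z ->
     holomorphic f -> holomorphic g ->
     ~ (range f `<=` sing Y) -> ~ (g @` range f `<=` sing Z) ->
     alpha_pullback f Phif -> alpha_pullback g Phig ->
     alpha_pullback (g \o f) Phigf ->
     beta_pullback f Phif Psif -> beta_pullback g Phig Psig ->
     beta_pullback (g \o f) Phigf Psigf ->
     forall (q : nat) (V : set Z) (a : qform Z q), open V -> beta V a ->
       eq_form ((g \o f) @^-1` V) (Psigf q V a)
               (Psif q (g @^-1` V) (Psig q V a))) /\
  (* induced pull-back on each alpha[p] *)
  (forall (X Y : complexSpace R) (f : X -> Y) (Phi Psi : section_map X Y),
     irreducible X -> irreducible Y -> holomorphic f ->
     ~ (range f `<=` sing Y) -> alpha_pullback f Phi ->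
     beta_pullback f Phi Psi ->
     forall p : nat, exists Psip : section_map X Y, induced f p Psi Psip) /\
  (* functoriality on each alpha[p] *)
  (forall (X Y Z : complexSpace R) (f : X -> Y) (g : Y -> Z)
          (Phif Psif : section_map X Y) (Phig Psig : section_map Y Z)
          (Phigf Psigf : section_map X Z),
     irreducible X -> irreducible Y -> irreducible Z ->
     holomorphic f -> holomorphic g ->
     ~ (range f `<=` sing Y) -> ~ (g @` range f `<=` sing Z) ->
     alpha_pullback f Phif -> alpha_pullback g Phig ->
     alpha_pullback (g \o f) Phigf ->
     beta_pullback f Phif Psif -> beta_pullback g Phig Psig ->
     beta_pullback (g \o f) Phigf Psigf ->
     forall (p : nat) (Psifp : section_map X Y) (Psigp : section_map Y Z)
            (Psigfp : section_map X Z),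
       induced f p Psif Psifp -> induced g p Psig Psigp ->
       induced (g \o f) p Psigf Psigfp ->
       forall (q : nat) (V : set Z) (a : qform Z q), open V -> alpha p V a ->
         eq_form ((g \o f) @^-1` V) (Psigfp q V a)
                 (Psifp q (g @^-1` V) (Psigp q V a))).
Proof.
have range_comp (X Y Z : complexSpace R) (f : X -> Y) (g : Y -> Z) :
    ~ (g @` range f `<=` sing Z) -> ~ (range g `<=` sing Z) /\ ~ (range (g \o f) `<=` sing Z).
  move=> h; split=> s; apply: h => _ [_ [x _ <-] <-]; apply: s; first by exists (f x).
  by exists x.
split.
  move=> X Y f Phi irX irY hf nf hPhi; exists (fun q _ a => Ext f a).
  split; first exact: Ext_beta_pullback.
  move=> Psi' hPsi' q V a oV ha; apply: eq_form_sym; apply: Ext_eq => //; first exact: open_pre.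
  exact: beta_pullback_extends hPsi' oV ha.
split.
  move=> X Y Z f g Phif Psif Phig Psig Phigf Psigf irX irY irZ hf hg nf ngf pf pg pgf bf bg bgf q V a oV ha.
  have [ng ngf'] := range_comp _ _ _ _ _ ngf; have hgf := holomorphic_comp hf hg.
  have ogV := open_pre hg oV.
  apply: (extends_comp irX irY irZ hf hg nf ngf' hgf oV).
  - exact: (beta_pullback_extends hgf pgf bgf oV ha).
  - exact: (beta_pullback_extends hg pg bg oV ha).
  - apply: (beta_pullback_extends hf pf bf ogV); exact: (mor_section (beta_mor bg)).
split.
  move=> X Y f Phi Psi irX irY hf nf hPhi hPsi p; exists (fun q _ a => Ext f a).
  exact: Ext_induced hPsi.
move=> X Y Z f g Phif Psif Phig Psig Phigf Psigf irX irY irZ hf hg nf ngf pf pg pgf bf bg bgf.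
move=> p Psifp Psigp Psigfp jf jg jgf q V a oV ha.
have [ng ngf'] := range_comp _ _ _ _ _ ngf; have hgf := holomorphic_comp hf hg.
have ogV := open_pre hg oV.
apply: (extends_comp irX irY irZ hf hg nf ngf' hgf oV).
- exact: (induced_extends hgf pgf bgf jgf oV ha).
- exact: (induced_extends hg pg bg jg oV ha).
- apply: (induced_extends hf pf bf jf ogV); exact: (mor_section (proj1 jg)).
Qed.
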